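(* Let $\Omega$ be a bounded finitely connected region in $\mathbb{C}$ and let $K$ be a Hilbert space. For any quasi-inner functions $\theta\in H^{\infty}(\Omega)$ and $\varphi\in H^{\infty}(\Omega,L(K))$, the following assertions are equivalent: (a) $\theta\mid\varphi$, that is, $\varphi=\theta\cdot\phi'$ for some $\phi'\in H^{\infty}(\Omega,L(K))$. (b) $\varphi H^{\infty}(\Omega,K)\subset\theta H^{\infty}(\Omega,K)$. (c) $\varphi H^{2}(\Omega,K)\subset\theta H^{2}(\Omega,K)$. (d) There is a $\lambda>0$ such that $\varphi(z)\varphi(z)^{*}\leq\lambda^{2}|\theta(z)|^{2}I_{K}$ for any $z\in\Omega$, where $I_K$ is the identity operator on $K$.
   Context: Hilbert spaces are complex. $H^{\infty}(\Omega)$ is the algebra of bounded holomorphic functions on $\Omega$. $L(K)$ is the algebra of bounded linear operators on $K$; $H^{\infty}(\Omega,L(K))$ and $H^\infty(\Omega,K)$ are the spaces of bounded analytic functions on $\Omega$ with values in $L(K)$ and $K$, respectively. $H^2(\Omega,K)$ is the space of analytic functions $f:\Omega\to K$ such that the subharmonic function $\|f\|^2$ has a harmonic majorant on $\Omega$. For a space $X$ of $K$-valued functions on $\Omega$, $\varphi X=\{\varphi f: f\in X\}$ with $(\varphi f)(z)=\varphi(z)f(z)$, and $\theta X=\{\theta f:f\in X\}$. The inequality in (d) is the usual order on self-adjoint operators. Fix $z_0\in\Omega$; ''almost every'' on $\partial\Omega$ is with respect to the harmonic measure $m$ for $z_0$. For $z\in\partial\Omega$ and $k\in K$, $\varphi(z)k$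 and $\theta(z)$ denote nontangential boundary limits at $z$. The function $\varphi\in H^{\infty}(\Omega,L(K))$ is quasi-inner if there is $c>0$ such that $\|\varphi(z)k\|\ge c\|k\|$ for every $k\in K$ and almost every $z\in\partial\Omega$. The function $\theta\in H^\infty(\Omega)$ is quasi-inner if there is $c>0$ such that $|\theta(z)|\ge c$ for almost every $z\in\partial\Omega$. *)

(* Defs.v *)
From HB Require Import structures.
From mathcomp Require Import all_boot all_order all_algebra sesquilinear.
From mathcomp Require Import all_classical all_reals all_analysis.
From mathcomp Require Import complex ring lra.

Set Implicit Arguments.
Unset Strict Implicit.
Unset Printing Implicit Defensive.

Import Order.TTheory GRing.Theory Num.Theory.
Import Num.Def.
Import numFieldNormedType.Exports.

Local Open Scope classical_set_scope.
Local Open Scope ring_scope.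
Local Open Scope complex_scope.

(* The analysis library puts a topology and a normed module structure on an
   abstract numFieldType but not on the concrete type R[i]. *)
HB.instance Definition _ (R : rcfType) := GRing.ComAlgebra.copy R[i] R[i]^o.
HB.instance Definition _ (R : rcfType) := NormedModule.copy R[i] R[i]^o.

Section BoundedOperators.
Variables (R : realType) (K : normedModType R[i]).

(* Between normed spaces, bounded is the same as continuous. *)
Record bop := Bop {
  bop_fun :> K -> K;
  bop_linear : linear bop_fun;
  bop_continuous : continuous bop_fun }.

HB.instance Definition _ (A : bop) :=
  GRing.isLinear.Build R[i] K K *:%R A (bop_linear A).

Lemma bopP (A B : bop) : A =1 B -> A = B.
Proof.
case: A B => [f lf cf] [g lg cg] /= /funext fg; case: _ / fg lg cg => lg cg.
by congr Bop; exact: Prop_irrelevance.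
Qed.

HB.instance Definition _ := gen_eqMixin bop.
HB.instance Definition _ := gen_choiceMixin bop.

Fact bop_zero_linear : linear (cst 0 : K -> K).
Proof. by move=> a x y /=; rewrite scaler0 addr0. Qed.
Definition bop_zero := Bop bop_zero_linear (@cst_continuous K K 0).

Fact bop_id_linear : linear (@id K). Proof. by []. Qed.
Definition bop_id := Bop bop_id_linear (fun x => @cvg_id K (nbhs x)).

Fact bop_opp_linear (A : bop) : linear (fun x => - A x).
Proof. by move=> a x y; rewrite linearP opprD scalerN. Qed.
Fact bop_opp_continuous (A : bop) : continuous (fun x => - A x).
Proof. by move=> x; apply: cvgN; exact: bop_continuous. Qed.
Definition bop_opp A := Bop (bop_opp_linear A) (@bop_opp_continuous A).

Fact bop_add_linear (A B : bop) : linear (fun x => A x + B x).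
Proof. by move=> a x y; rewrite !linearP scalerDr addrACA. Qed.
Fact bop_add_continuous (A B : bop) : continuous (fun x => A x + B x).
Proof. by move=> x; apply: cvgD; exact: bop_continuous. Qed.
Definition bop_add A B := Bop (bop_add_linear A B) (@bop_add_continuous A B).

Fact bop_scale_linear (c : R[i]) (A : bop) : linear (fun x => c *: A x).
Proof.
by move=> a x y; rewrite linearP scalerDr !scalerA [c * a]mulrC.
Qed.
Fact bop_scale_continuous (c : R[i]) (A : bop) : continuous (fun x => c *: A x).
Proof. by move=> x; apply: cvgZr; exact: bop_continuous. Qed.
Definition bop_scale c A :=
  Bop (bop_scale_linear c A) (@bop_scale_continuous c A).

Fact bop_comp_linear (A B : bop) : linear (A \o B).
Proof. by move=> a x y /=; rewrite !linearP. Qed.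
Fact bop_comp_continuous (A B : bop) : continuous (A \o B).
Proof.
by move=> x; apply: continuous_comp; exact: bop_continuous.
Qed.
Definition bop_comp A B := Bop (bop_comp_linear A B) (@bop_comp_continuous A B).

Fact bop_addA : associative bop_add.
Proof. by move=> A B C; apply: bopP => x /=; rewrite addrA. Qed.
Fact bop_addC : commutative bop_add.
Proof. by move=> A B; apply: bopP => x /=; rewrite addrC. Qed.
Fact bop_add0 : left_id bop_zero bop_add.
Proof. by move=> A; apply: bopP => x /=; rewrite add0r. Qed.
Fact bop_addN : left_inverse bop_zero bop_opp bop_add.
Proof. by move=> A; apply: bopP => x /=; rewrite addNr. Qed.
HB.instance Definition _ :=
  GRing.isZmodule.Build bop bop_addA bop_addC bop_add0 bop_addN.

Fact bop_scaleA a b (A : bop) : bop_scale a (bop_scale b A) = bop_scale (a * b) A.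
Proof. by apply: bopP => x /=; rewrite scalerA. Qed.
Fact bop_scale1 : left_id 1 bop_scale.
Proof. by move=> A; apply: bopP => x /=; rewrite scale1r. Qed.
Fact bop_scaleDr : right_distributive bop_scale +%R.
Proof. by move=> a A B; apply: bopP => x /=; rewrite scalerDr. Qed.
Fact bop_scaleDl (A : bop) : {morph bop_scale^~ A : a b / a + b}.
Proof. by move=> a b; apply: bopP => x /=; rewrite scalerDl. Qed.
HB.instance Definition _ := GRing.Zmodule_isLmodule.Build R[i] bop
  bop_scaleA bop_scale1 bop_scaleDr bop_scaleDl.

Definition opnorm (A : bop) : R :=
  sup [set complex.Re `|A x| | x in [set x : K | `|x| <= 1]].

Lemma Re_normr (x : K) : (complex.Re `|x|)%:C = `|x|.
Proof. by apply: RRe_real; exact: normr_real. Qed.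

Lemma bop_bounded (A : bop) :
  exists2 r : R, 0 <= r & forall x, `|A x| <= r%:C * `|x|.
Proof.
have /linear_bounded_continuous/linear_boundedP := @bop_continuous A.
move=> /pinfty_ex_gt0 [r r0 rA]; exists (complex.Re r).
  by move: r0; rewrite ltcE /= => /andP[_ /ltW].
by move=> x; rewrite RRe_real ?rA// gtr0_real.
Qed.

Lemma opnorm_has_sup (A : bop) :
  has_sup [set complex.Re `|A x| | x in [set x : K | `|x| <= 1]].
Proof.
split; first by exists (complex.Re `|A 0|), 0 => //=; rewrite normr0.
have [r r0 rA] := bop_bounded A; exists r => _ [x /= x1 <-].
rewrite -lecR Re_normr (le_trans (rA x))// -[leRHS]mulr1.
by rewrite ler_wpM2l// ler0c.
Qed.

Lemma opnorm_ge0 (A : bop) : 0 <= opnorm A.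
Proof.
apply: (@le_trans _ _ (complex.Re `|A 0|)); first by rewrite linear0 normr0.
apply: (ub_le_sup (opnorm_has_sup A).2).
by exists 0 => //=; rewrite normr0.
Qed.

Lemma opnormP (A : bop) x : `|A x| <= (opnorm A)%:C * `|x|.
Proof.
have [->|x0] := eqVneq x 0; first by rewrite linear0 !normr0 mulr0.
have nx : 0 < `|x| by rewrite normr_gt0.
rewrite -ler_pdivrMr// mulrC -[X in X * _]ger0_norm ?invr_ge0//.
rewrite -normrZ -linearZ -(Re_normr (A _)) lecR.
apply: (ub_le_sup (opnorm_has_sup A).2); exists (`|x|^-1 *: x) => //=.
by rewrite normrZ ger0_norm ?invr_ge0// mulVf// gt_eqF.
Qed.

Lemma opnorm_le (A : bop) (r : R) : 0 <= r ->
  (forall x, `|A x| <= r%:C * `|x|) -> opnorm A <= r.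
Proof.
move=> r0 rA; apply: ge_sup; first exact: (opnorm_has_sup A).1.
move=> _ [x /= x1 <-]; rewrite -lecR Re_normr (le_trans (rA x))//.
by rewrite -[leRHS]mulr1 ler_wpM2l// ler0c.
Qed.

Fact bop_ler_normD (A B : bop) :
  (opnorm (A + B))%:C <= (opnorm A)%:C + (opnorm B)%:C.
Proof.
rewrite -rmorphD lecR; apply: opnorm_le; first by rewrite addr_ge0 ?opnorm_ge0.
move=> x; rewrite rmorphD mulrDl (le_trans (ler_normD _ _))//.
by rewrite lerD ?opnormP.
Qed.

Fact bop_normrZ (c : R[i]) (A : bop) :
  (opnorm (c *: A))%:C = `|c| * (opnorm A)%:C.
Proof.
have key (d : R[i]) (B : bop) : (opnorm (d *: B))%:C <= `|d| * (opnorm B)%:C.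
  have dE : (complex.Re `|d|)%:C = `|d| by rewrite RRe_real ?normr_real.
  rewrite -dE -rmorphM lecR; apply: opnorm_le.
    by rewrite mulr_ge0 ?opnorm_ge0// -lecR dE normr_ge0.
  move=> x; rewrite rmorphM /= dE normrZ -mulrA.
  by rewrite ler_wpM2l// opnormP.
apply/eqP; rewrite eq_le key /=.
have [->|c0] := eqVneq c 0; first by rewrite normr0 mul0r ler0c opnorm_ge0.
rewrite -ler_pdivlMl ?normr_gt0// -normfV.
by rewrite {1}[A](_ : _ = c^-1 *: (c *: A)) ?key// scalerA mulVf// scale1r.
Qed.

Fact bop_normr0_eq0 (A : bop) : (opnorm A)%:C = 0 -> A = 0.
Proof.
move=> A0; apply: bopP => x; apply/eqP; rewrite -normr_le0.
by rewrite (le_trans (opnormP A x))// A0 mul0r.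
Qed.

HB.instance Definition _ := Lmodule_isNormed.Build R[i] bop
  bop_ler_normD bop_normrZ bop_normr0_eq0.

End BoundedOperators.

Section Adjoint.
Variables (R : realType) (K : normedModType R[i]) (dot : {dot K for conjC}).

Definition is_adjoint (A B : bop K) := forall x y, dot (A x) y = dot x (B y).

(* On a Hilbert space the default value 0 is never used: see [adjointP]. *)
Definition adjoint (A : bop K) : bop K := xget 0 [set B | is_adjoint A B].

Definition bop_le (A B : bop K) := forall x, 0 <= dot ((B - A) x) x.

End Adjoint.

Section HilbertAdjoint.
Variables (R : realType) (K : completeNormedModType R[i]).
Variables (dot : {dot K for conjC}) (normK : forall x : K, `|x| ^+ 2 = dot x x).

Let nr (x : K) : R := complex.Re `|x|.

Let nrE x : (nr x)%:C = `|x|. Proof. exact: Re_normr. Qed.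

Let nr_ge0 x : 0 <= nr x. Proof. by rewrite -ler0c nrE. Qed.

Let dot_sub_proj x y : y != 0 ->
  `|x - (dot x y / dot y y) *: y| ^+ 2 = `|x| ^+ 2 - `|dot x y| ^+ 2 / dot y y.
Proof.
move=> y0; have n0 : dot y y != 0 by rewrite dnorm_eq0.
have nC : conjC (dot y y) = dot y y by rewrite geC0_conj ?dnorm_ge0.
rewrite !normK dnormB dnormZ linearZr_LR /= rmorphM fmorphV /= nC.
rewrite normrM exprMn normfV -normK normrX normr_id normK.
have -> : conjC (dot x y) / dot y y * dot x y = `|dot x y| ^+ 2 / dot y y.
  by rewrite mulrAC normCK [_ * conjC (dot x y)]mulrC.
have -> : conjC (`|dot x y| ^+ 2 / dot y y) = `|dot x y| ^+ 2 / dot y y.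
  by rewrite geC0_conj// divr_ge0 ?exprn_ge0 ?dnorm_ge0.
rewrite -addrA; congr (_ + _).
by rewrite expr2 mulrA divfK// opprD addNKr.
Qed.

Lemma dot_le_norm x y : `|dot x y| <= `|x| * `|y|.
Proof.
have [->|y0] := eqVneq y 0; first by rewrite linear0r !normr0 mulr0.
rewrite -(@ler_pXn2r _ 2)// ?nnegrE ?mulr_ge0// exprMn.
rewrite [`|y| ^+ 2]normK -ler_pdivrMr ?dnorm_gt0// -subr_ge0.
by rewrite -dot_sub_proj// exprn_ge0.
Qed.

Let parallelogram x y :
  nr (x - y) ^+ 2 = 2 * (nr x ^+ 2 + nr y ^+ 2) - 4 * nr (2^-1 *: (x + y)) ^+ 2.
Proof.
apply: complexI.
have sE z : (nr z ^+ 2)%:C = dot z z by rewrite rmorphXn /= nrE normK.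
rewrite rmorphB (rmorphM _ 2) (rmorphM _ 4) (rmorphD _ (nr x ^+ 2)) /= !sE.
rewrite dnormZ dnormB dnormD.
have -> : 2%:C = 2 :> R[i] by rewrite -(rmorph_nat (real_complex R)).
have -> : 4%:C = 4 :> R[i] by rewrite -(rmorph_nat (real_complex R)).
rewrite normfV normr_nat.
by field.
Qed.

Lemma riesz (f : K -> R[i]) : linear f -> continuous f ->
  exists y, forall x, f x = dot x y.
Proof.
move=> lf cf.
pose fL : {linear K -> R[i]} := HB.pack f (GRing.isLinear.Build _ _ _ _ f lf).
have f00 : f 0 = 0 := linear0 fL.
have fD x y : f (x + y) = f x + f y := linearD fL x y.
have fB x y : f (x - y) = f x - f y := linearB fL x y.
have fZ a x : f (a *: x) = a * f x by rewrite -[a *: x]addr0 lf f00 addr0.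
have [f0|/existsNP[w /eqP fw]] := pselect (forall x, f x = 0).
  by exists 0 => x; rewrite f0 linear0r.
pose S := [set x | f x = 1].
have Sw : S ((f w)^-1 *: w) by rewrite /S /= fZ mulVf.
pose D := [set nr x ^+ 2 | x in S].
have infD : has_inf D.
  split; first by exists (nr ((f w)^-1 *: w) ^+ 2), ((f w)^-1 *: w).
  by exists 0 => _ [x _ <-]; exact: sqr_ge0.
pose d := inf D.
have dle x : S x -> d <= nr x ^+ 2.
  by move=> Sx; apply: ge_inf; [exact: infD.2|exists x].
pose B (e : R) := S `&` [set x | nr x ^+ 2 < d + e].
pose F := filter_from [set e : R | 0 < e] B.
have FF : ProperFilter F.
  apply: filter_from_proper; last first.
    move=> e /= e0; have [_ [x Sx <-] xe] := inf_adherent e0 infD.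
    by exists x.
  apply: filter_from_filter; first by exists 1 => /=.
  move=> e1 e2 /= e10 e20; exists (Num.min e1 e2) => /=.
    by rewrite lt_min e10.
  move=> x [Sx /= xe]; split; split => //=; apply: (lt_le_trans xe);
    by rewrite lerD2l ge_min lexx ?orbT.
have S_mid x y : S x -> S y -> S (2^-1 *: (x + y)).
  rewrite /S /= => fx fy.
  by rewrite fZ fD fx fy; field.
have Fc : cauchy F.
  apply/cauchy_ballP => e e0.
  have eE : (complex.Re e)%:C = e by rewrite RRe_real// gtr0_real.
  have re0 : 0 < complex.Re e by rewrite -(ltcR 0) eE.
  pose r := (complex.Re e) ^+ 2 / 4.
  have r0 : 0 < r by rewrite divr_gt0// exprn_gt0.
  exists (B r, B r); first by split; exists r.
  move=> [x y] /= [[Sx xr] [Sy yr]]; rewrite -ball_normE /ball_ /=.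
  rewrite -nrE -eE ltcR -(@ltr_pXn2r _ 2)// ?nnegrE ?(ltW re0)//.
  rewrite parallelogram.
  have := dle _ (S_mid _ _ Sx Sy).
  move: xr yr; rewrite /= /r; set a := nr x ^+ 2; set b := nr y ^+ 2.
  set c := nr _ ^+ 2; lra.
have /cvg_ex[p Fp] : cvg F by exact: cauchy_cvg.
have FS : F S by exists 1 => //= x [].
have Sp : S p.
  have fp : f @ F --> f p by apply: (cvg_trans (cvg_app f Fp)); exact: cf.
  have f1 : f @ F --> (1 : R[i]) by apply: cvg_near_cst; apply: filterS FS.
  exact: (cvg_unique (@norm_hausdorff _ _) fp f1).
have pd : nr p ^+ 2 <= d.
  have near_p e : 0 < e -> exists2 x, B e x & nr (p - x) < e.
    move=> e0; have Fe : F (B e) by exists e.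
    have e0C : 0 < e%:C :> R[i] by rewrite (ltcR 0).
    have Fpe : F (ball p e%:C) by apply: Fp; exact: nbhsx_ballx.
    have [x [Bx xe]] : (B e `&` ball p e%:C) !=set0.
      by apply: (@filter_ex _ F); exact: filterI.
    by exists x => //; move: xe; rewrite -ball_normE /ball_ /= -nrE ltcR.
  rewrite leNgt; apply/negP => dp.
  have M0 : 0 < 4 + 2 * nr p by rewrite ltr_wpDr ?mulr_ge0.
  pose e := Num.min 1 ((nr p ^+ 2 - d) / (4 + 2 * nr p)).
  have e0 : 0 < e by rewrite lt_min ltr01 divr_gt0// subr_gt0.
  have e1 : e <= 1 by rewrite ge_min lexx.
  have eM : e * (4 + 2 * nr p) <= nr p ^+ 2 - d.
    by rewrite -ler_pdivlMr// ge_min lexx orbT.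
  have [x [Sx /= xe] px] := near_p e e0.
  have tri1 : nr p <= nr (p - x) + nr x.
    by rewrite -lecR rmorphD /= !nrE -{1}[p](subrK x) ler_normD.
  have tri2 : nr x <= nr (p - x) + nr p.
    by rewrite -lecR rmorphD /= !nrE -{1}[x](subKr p) [leRHS]addrC ler_normB.
  have := nr_ge0 x; have := nr_ge0 p; nra.
have dot0 v : f v = 0 -> dot p v = 0.
  move=> fv; have [->|v0] := eqVneq v 0; first by rewrite linear0r.
  set u := p - (dot p v / dot v v) *: v.
  have Su : S u.
    by rewrite /S /= fB fZ fv mulr0 subr0.
  have := le_trans pd (dle _ Su).
  rewrite -lecR !rmorphXn /= !nrE dot_sub_proj// lerBrDr gerDl.
  rewrite pmulr_lle0 ?invr_gt0 ?dnorm_gt0// => h.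
  apply/eqP; rewrite -normr_eq0 -sqrf_eq0; apply/eqP/le_anti.
  by rewrite h exprn_ge0.
have p0 : p != 0.
  by apply/eqP => p0; move: Sp; rewrite /S /= p0 f00 => /eqP; rewrite eq_sym oner_eq0.
exists ((dot p p)^-1 *: p) => x.
have : dot p (x - f x *: p) = 0.
  by apply: dot0; rewrite fB fZ Sp mulr1 subrr.
have conj_dot y z : conjC (dot y z) = dot z y by rewrite [RHS]hermC mul1r.
have n0 : dot p p != 0 by rewrite dnorm_eq0.
move/(congr1 conjC); rewrite rmorph0 conj_dot linearBl linearZl_LR /= => /eqP.
rewrite subr_eq0 => /eqP xp; rewrite linearZr_LR /= xp fmorphV /= conj_dot.
by rewrite mulrCA mulVf// mulr1.
Qed.

Lemma dot_inj y z : (forall x, dot x y = dot x z) -> y = z.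
Proof.
move=> yz; apply/eqP; rewrite -subr_eq0 -(dnorm_eq0 dot) linearBr /= yz.
by rewrite subrr.
Qed.

Lemma adjoint_exists (A : bop K) : exists B, is_adjoint dot A B.
Proof.
have /choice[b bP] y : exists z, forall x, dot (A x) y = dot x z.
  have lf : linear (fun x => dot (A x) y : R[i]).
    by move=> a x z; rewrite linearP linearDl linearZl_LR.
  apply: (riesz lf) => x.
  apply/(@cvgrPdist_lt _ R[i]) => e e0.
  have M0 : 0 < `|y| + 1 by rewrite ltr_wpDl.
  have /(@cvgrPdist_lt _ K)/(_ _ (divr_gt0 e0 M0)) := @bop_continuous _ _ A x.
  apply: filterS => z Axz; rewrite -linearBl (le_lt_trans (dot_le_norm _ _))//.
  rewrite (@le_lt_trans _ _ (`|A x - A z| * (`|y| + 1)))//.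
    by rewrite ler_wpM2l// lerDl.
  by rewrite -ltr_pdivlMr.
have bl : linear b.
  move=> a y z; apply: dot_inj => x.
  by rewrite -bP !(linearDr, linearZr_LR) /= !bP.
pose bL : {linear K -> K} := HB.pack b (GRing.isLinear.Build _ _ _ _ b bl).
have bc : continuous b.
  apply: (@bounded_linear_continuous _ _ _ bL); apply/linear_boundedP.
  near=> r => y.
  have [->|by0] := eqVneq (bL y) 0.
    rewrite normr0 mulr_ge0//; near: r; exact: nbhs_pinfty_ge.
  rewrite -(@ler_pM2l _ `|b y|) ?normr_gt0// -expr2.
  have h : `|b y| ^+ 2 <= `|A (b y)| * `|y|.
    by rewrite -[leLHS]ger0_norm ?exprn_ge0// normK -bP dot_le_norm.
  rewrite (le_trans h)// mulrA ler_wpM2r//.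
  rewrite (le_trans (opnormP _ _))// mulrC ler_wpM2l//.
  by near: r; apply: nbhs_pinfty_ge; rewrite ger0_real// ler0c opnorm_ge0.
by exists (Bop bl bc) => x y; exact: bP.
Unshelve. all: by end_near. Qed.

Lemma adjointP (A : bop K) : is_adjoint dot A (adjoint dot A).
Proof.
exact: (@xgetPex _ 0 [set B | is_adjoint dot A B] (adjoint_exists A)).
Qed.

Lemma adjoint_unique (A B : bop K) : is_adjoint dot A B -> adjoint dot A = B.
Proof.
by move=> AB; apply: bopP => y; apply: dot_inj => x; rewrite -adjointP AB.
Qed.

End HilbertAdjoint.

Section Domains.
Variable R : realType.
Implicit Type Omega : set R[i].

Definition finitely_connected Omega :=
  let E : set (one_point_compactification R[i]) := ~` (Some @` Omega) in
  finite_set (connected_component E @` E).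

Definition bounded_finitely_connected_region Omega :=
  [/\ open Omega, connected Omega, Omega !=set0,
      bounded_set Omega & finitely_connected Omega].

Definition boundary Omega := closure Omega `\` interior Omega.

End Domains.

Section HarmonicFunctions.
Variable R : realType.
Implicit Types (Omega : set R[i]) (u : R[i] -> R) (v : R[i] -> \bar R).

(* Partial derivative in the real direction [d]; it is the partial derivative
   in x for d = 1 and the one in y for d = 'i. *)
Definition partial (d : R[i]) u z : R :=
  derive1 (fun t : R => u (z + t%:C * d)) 0.

Definition C1_on Omega u := forall d, d = 1 \/ d = 'i -> forall z, Omega z ->
  derivable (fun t : R => u (z + t%:C * d)) 0 1 /\
  {for z, continuous (partial d u)}.

Definition C2_on Omega u :=
  [/\ C1_on Omega u, C1_on Omega (partial 1 u) & C1_on Omega (partial 'i u)].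

Definition harmonic_on Omega u := C2_on Omega u /\
  forall z, Omega z -> partial 1 (partial 1 u) z + partial 'i (partial 'i u) z = 0.

Definition circle_mean v (z : R[i]) (s : R) : \bar R :=
  (((2 * pi)^-1)%:E * \int[lebesgue_measure]_(t in `[0%R, (2 * pi)%R])
    v (z + s%:C * (cos t +i* sin t))%R)%E.

Definition subharmonic_on Omega v := forall z, Omega z ->
  [/\ (v z < +oo)%E,
      forall a, (v z < a)%E -> \forall w \near z, (v w < a)%E &
      exists2 r : R, 0 < r & forall s : R, 0 <= s < r ->
        (forall w, `|w - z| <= s%:C -> Omega w) /\
        (v z <= circle_mean v z s)%E].

(* Perron's solution of the Dirichlet problem with boundary data [f]. *)
Definition perron Omega (f : R[i] -> R) (z : R[i]) : \bar R :=
  ereal_sup [set v z | v in [set v | subharmonic_on Omega v /\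
    forall zeta, boundary Omega zeta ->
      (limf_esup v (within Omega (nbhs zeta)) <= (f zeta)%:E)%E]].

Definition borelC := g_sigma_algebraType (@open R[i]).

(* Representing the harmonic functions that are continuous on the closure would
   not determine [m] when the boundary has irregular points (e.g. isolated
   ones); representing the Perron solutions does. *)
Definition harmonic_measure Omega (z0 : R[i]) (m : probability borelC R) :=
  m (boundary Omega) = 1%E /\
  forall f : R[i] -> R, {within boundary Omega, continuous f} ->
    (\int[m]_(zeta in boundary Omega) (f zeta)%:E = perron Omega f z0)%E.

End HarmonicFunctions.

Section FunctionSpaces.
Variables (R : realType) (Omega : set R[i]).

(* Functions on Omega are represented by total functions, of which only the
   values on Omega matter. *)

Definition holomorphic_on (X : normedModType R[i]) (f : R[i] -> X) :=
  forall z, Omega z -> derivable f z 1.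

Definition Hinfty (X : normedModType R[i]) : set (R[i] -> X) :=
  [set f | holomorphic_on f /\ [bounded f z | z in Omega]].

Definition H2 (X : normedModType R[i]) : set (R[i] -> X) :=
  [set f | holomorphic_on f /\
    exists2 u : R[i] -> R, harmonic_on Omega u &
      forall z, Omega z -> `|f z| ^+ 2 <= (u z)%:C].

Definition nt_region (zeta : R[i]) (a : R) : set R[i] :=
  [set z | Omega z /\
    forall w, boundary Omega w -> `|z - zeta| <= (1 + a)%:C * `|z - w|].

(* The first clause makes the limit meaningful: [zeta] has to be accessible
   through some nontangential approach region. *)
Definition nt_limit (X : normedModType R[i]) (f : R[i] -> X) (zeta : R[i])
    (l : X) :=
  (exists2 a : R, 0 < a & closure (nt_region zeta a) zeta) /\
  forall a : R, 0 < a -> f @ within (nt_region zeta a) (nbhs zeta) --> l.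

Variables (m : probability (borelC R) R) (K : normedModType R[i]).

Definition quasi_inner (theta : R[i] -> R[i]) :=
  exists2 c : R, 0 < c & {ae m, forall zeta : R[i], boundary Omega zeta ->
    exists2 l, nt_limit theta zeta l & c%:C <= `|l|}.

Definition quasi_inner_op (phi : R[i] -> bop K) :=
  exists2 c : R, 0 < c & forall k : K,
    {ae m, forall zeta : R[i], boundary Omega zeta ->
      exists2 l, nt_limit (fun z => phi z k) zeta l & c%:C * `|k| <= `|l|}.

Definition op_image (phi : R[i] -> bop K) (X : set (R[i] -> K)) :
    set (R[i] -> K) :=
  [set g | exists2 f, X f & forall z, Omega z -> g z = phi z (f z)].

Definition scalar_image (theta : R[i] -> R[i]) (X : set (R[i] -> K)) :
    set (R[i] -> K) :=
  [set g | exists2 f, X f & forall z, Omega z -> g z = theta z *: f z].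

Definition divides (theta : R[i] -> R[i]) (phi : R[i] -> bop K) :=
  exists2 psi : R[i] -> bop K, Hinfty psi &
    forall z, Omega z -> phi z = theta z *: psi z.

End FunctionSpaces.

(* Main.v *)
Require Import Defs.
From HB Require Import structures.
From mathcomp Require Import all_boot all_order all_algebra sesquilinear.
From mathcomp Require Import all_classical all_reals all_analysis.
From mathcomp Require Import complex ring lra.

Set Implicit Arguments.
Unset Strict Implicit.
Unset Printing Implicit Defensive.

Import Order.TTheory GRing.Theory Num.Theory.
Import Num.Def.
Import numFieldNormedType.Exports.

Local Open Scope classical_set_scope.
Local Open Scope ring_scope.
Local Open Scope complex_scope.

(** The four assertions are compared with a fifth one: there is a constant [c]
    with [|phi z k| <= c |theta z| |k|] for all [z] in the region and all [k]
    (the predicate [dominated]).  Passing to adjoints, this is (d)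
    ([adjoint_le]).

    Domination implies (a), by [dominated_divides].  A quasi-inner [theta] is
    not identically zero, so its zeros are isolated, and off them the quotient
    [phi / theta] is holomorphic and bounded by [c]; Riemann's theorem on
    removable singularities extends it.  That (a) implies (b) and (c) is
    immediate: the quotient multiplies bounded functions to bounded functions,
    and multiplies a harmonic majorant by the square of its bound.

    Conversely, (b) implies domination by the uniform boundedness principle: for
    a constant function [k] the values [phi z k / theta z] are those of a bounded
    function, so the operators [phi z / theta z] are pointwise bounded on [K].
    That (c) implies domination is the same principle on the Hardy space, whose
    unit ball consists of the functions with a harmonic majorant of value at most
    [1] at [z0].  Let [N z] be the norm of the evaluation at [z].  By (c) the
    seminorms [f |-> |phi z (f z)| / (|theta z| N z)] are pointwise bounded.  They
    are hence uniformly bounded on the ball, and testing them on [f = g k] with a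
    scalar [g] nearly attaining [N z] bounds [phi z / theta z].  Completeness of
    the Hardy space enters as the closure of its ball under certain infinite
    convex combinations ([hardy_ball_series]), which rests on Harnack's
    inequality and on Harnack's theorem on series of harmonic functions.

    The function theory behind this is developed from complex
    differentiability: Goursat's theorem and Cauchy's formula on squares give
    finite Taylor expansions with bounded remainders ([taylor]).  From these
    follow isolated zeros, removable singularities and the stability of
    holomorphy under bounded pointwise limits, first for scalar functions and
    then, through norming families of functionals, for functions with values in
    [K] and in the bounded operators on [K].  A harmonic function is locally the
    real part of a holomorphic one, which transfers these results to majorants. *)

(** * Real-valued norms and complex derivatives *)

Section RealNorm.
Variable R : realType.
Local Notation C := R[i].

(** In a normed module over [R[i]] the norm of a vector is a complex number; [nm]
    is the same number as an element of the ordered field [R]. *)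
Definition nm (X : normedModType C) (x : X) : R := complex.Re `|x|.

Variable X : normedModType C.
Implicit Types (x y : X) (a b : C).

Lemma nmE x : (nm x)%:C = `|x|. Proof. exact: Re_normr. Qed.

Lemma nm_ge0 x : 0 <= nm x. Proof. by rewrite -ler0c nmE. Qed.

Lemma nm0 : nm (0 : X) = 0. Proof. by rewrite /nm normr0. Qed.

Lemma nm_eq0 x : (nm x == 0) = (x == 0).
Proof. by rewrite -(normr_eq0 x) -nmE; apply/eqP/eqP => [->//|/complexI]. Qed.

Lemma nm_gt0 x : (0 < nm x) = (x != 0).
Proof. by rewrite lt0r nm_eq0 nm_ge0 andbT. Qed.

Lemma nm_le0 x : (nm x <= 0) = (x == 0).
Proof. by rewrite -nm_eq0 eq_le nm_ge0 andbT. Qed.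

Lemma nmD x y : nm (x + y) <= nm x + nm y.
Proof. by rewrite -lecR rmorphD /= !nmE ler_normD. Qed.

Lemma nmN x : nm (- x) = nm x. Proof. by rewrite /nm normrN. Qed.

Lemma nmB x y : nm (x - y) <= nm x + nm y.
Proof. by rewrite (le_trans (nmD _ _))// nmN. Qed.

Lemma nm_distC x y : nm (x - y) = nm (y - x).
Proof. by rewrite /nm distrC. Qed.

Lemma nm_tri z x y : nm (x - y) <= nm (x - z) + nm (z - y).
Proof. by rewrite (_ : x - y = (x - z) + (z - y)) ?nmD// addrA subrK. Qed.

Lemma nmZ a x : nm (a *: x) = nm a * nm x.
Proof. by apply: complexI; rewrite rmorphM /= !nmE normrZ. Qed.

Lemma nm_le_sub x y : nm x - nm y <= nm (x - y).
Proof. by rewrite lerBlDr -{1}(subrK y x) nmD. Qed.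

End RealNorm.

Section RealNormC.
Variable R : realType.
Local Notation C := R[i].
Implicit Types (z w : C) (r : R).

Lemma nmM z w : nm (z * w) = nm z * nm w.
Proof. by apply: complexI; rewrite rmorphM /= !nmE normrM. Qed.

Lemma nm1 : nm (1 : C) = 1. Proof. by rewrite /nm normr1. Qed.

Lemma nmV z : nm (z^-1) = (nm z)^-1.
Proof. by apply: complexI; rewrite fmorphV /= !nmE normfV. Qed.

Lemma nmX z n : nm (z ^+ n) = nm z ^+ n.
Proof. by elim: n => [|n IH]; rewrite ?expr0 ?nm1// !exprS nmM IH. Qed.

Lemma nmR r : nm (r%:C) = `|r|.
Proof.
apply: complexI; rewrite nmE; have [r0|r0] := leP 0 r.
  by rewrite !ger0_norm// ler0c.
by rewrite !ltr0_norm// ?rmorphN// (ltcR _ 0).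
Qed.

Lemma nm_sqr z : nm z ^+ 2 = complex.Re z ^+ 2 + complex.Im z ^+ 2.
Proof.
by case: z => a b; rewrite /nm normc_def /= sqr_sqrtr// addr_ge0 ?sqr_ge0.
Qed.

Lemma nm_Re z : `|complex.Re z| <= nm z.
Proof.
by rewrite -(@ler_pXn2r _ 2)// ?nnegrE ?nm_ge0// nm_sqr real_normK ?num_real// lerDl sqr_ge0.
Qed.

Lemma nm_Im z : `|complex.Im z| <= nm z.
Proof.
by rewrite -(@ler_pXn2r _ 2)// ?nnegrE ?nm_ge0// nm_sqr real_normK ?num_real// lerDr sqr_ge0.
Qed.

Lemma nm_le_ReIm z : nm z <= `|complex.Re z| + `|complex.Im z|.
Proof.
rewrite -(@ler_pXn2r _ 2)// ?nnegrE ?nm_ge0 ?addr_ge0// nm_sqr sqrrD.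
rewrite !real_normK ?num_real// lerD2r lerDl.
by rewrite mulrn_wge0// mulr_ge0.
Qed.

Lemma Re_le_nm z : complex.Re z <= nm z.
Proof. exact: le_trans (ler_norm _) (nm_Re z). Qed.

End RealNormC.

Section EpsilonDelta.
Variable R : realType.
Local Notation C := R[i].
Variable X : normedModType C.

Lemma nbhs_nm (a : X) (P : set X) :
  nbhs a P <-> exists2 r : R, 0 < r & forall z, nm (z - a) < r -> P z.
Proof.
split.
  move=> /nbhs_ballP[e e0 eP].
  have eE : (complex.Re e)%:C = e by rewrite RRe_real// gtr0_real.
  exists (complex.Re e); first by rewrite -(ltcR 0) eE.
  move=> z zr; apply: eP; rewrite -ball_normE /ball_ /=.
  by rewrite distrC -nmE -eE ltcR.
move=> [r r0 rP]; apply/nbhs_ballP; exists r%:C => /=; first by rewrite (ltcR 0).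
move=> z; rewrite -ball_normE /ball_ /= distrC -nmE ltcR; exact: rP.
Qed.

Lemma cvg_nm (T : Type) (F : set_system T) {FF : Filter F} (f : T -> X) (l : X) :
  f @ F --> l <-> forall e : R, 0 < e -> \forall x \near F, nm (f x - l) < e.
Proof.
split.
  move=> fl e e0; apply: (fl [set y | nm (y - l) < e]).
  by apply/nbhs_nm; exists e.
move=> fl A /nbhs_nm[r r0 rA]; apply: filterS (fl r r0) => x; exact: rA.
Qed.

End EpsilonDelta.

Section ComplexDerivative.
Variable R : realType.
Local Notation C := R[i].
Variable X : normedModType C.

Lemma cvg_constant (a : C) (x : X) : (fun _ : C => x) @ a --> x.
Proof.
apply/(cvg_nm (F := nbhs a)) => e e0; apply: (filterE (F := nbhs a)) => z.
by rewrite subrr nm0.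
Qed.

Definition hasd (f : C -> X) (a : C) (d : X) := forall e : R, 0 < e ->
  exists2 r : R, 0 < r & forall h, nm h < r ->
    nm (f (a + h) - f a - h *: d) <= e * nm h.

Lemma nm_quotient (h : C) (v d : X) : h != 0 ->
  nm (v - h *: d) = nm h * nm (h^-1 *: v - d).
Proof. by move=> h0; rewrite -nmZ scalerBr scalerA mulfV// scale1r. Qed.

Lemma derivable_hasd (f : C -> X) a : derivable f a 1 <-> exists d, hasd f a d.
Proof.
have E (h : C) : h%:A + a = a + h by rewrite addrC /GRing.scale/= mulr1.
split.
  move=> /cvg_ex[d /= /cvg_nm fd]; exists d => e e0.
  have /nbhs_nm[r r0 rP] : nbhs (0 : C) [set h | h != 0 ->
      nm (h^-1 *: (f (h%:A + a) - f a) - d) < e] := fd e e0.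
  exists r => // h hr; have [->|h0] := eqVneq h 0.
    by rewrite addr0 subrr scale0r subrr !nm0 mulr0.
  have := rP h; rewrite subr0 => /(_ hr h0) /ltW.
  by rewrite nm_quotient// E mulrC => h1; rewrite ler_wpM2r// nm_ge0.
move=> [d fd]; apply/cvg_ex; exists d => /=; apply/cvg_nm => e e0.
have [r r0 rP] := fd _ (divr_gt0 e0 (ltr0n _ 2)).
apply/nbhs_nm; exists r => // h; rewrite subr0 => hr h0.
have := rP h hr; rewrite nm_quotient// E mulrC ler_pM2r ?nm_gt0//.
by move=> /le_lt_trans; apply; rewrite ltr_pdivrMr// ltr_pMr// ltr1n.
Qed.

Lemma hasd_ext (f g : C -> X) a d :
  (\forall z \near a, f z = g z) -> hasd f a d -> hasd g a d.
Proof.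
move=> /nbhs_nm[s s0 sP] fd e e0; have [r r0 rP] := fd e e0.
exists (Num.min r s); first by rewrite lt_min r0.
move=> h; rewrite lt_min => /andP[hr hs].
by rewrite -!sP ?rP// ?subrr ?nm0// addrAC subrr add0r.
Qed.

Lemma hasd_cvg (f : C -> X) a d : hasd f a d -> f @ a --> f a.
Proof.
move=> fd; apply/(cvg_nm (F := nbhs a)) => e e0; have [r r0 rP] := fd 1 ltr01.
have M0 : 0 < 1 + nm d by rewrite ltr_pwDl// nm_ge0.
apply/nbhs_nm; exists (Num.min r (e / (1 + nm d))).
  by rewrite lt_min r0 divr_gt0.
move=> z; rewrite lt_min => /andP[zr]; rewrite ltr_pdivlMr//.
apply: le_lt_trans; have := rP _ zr; rewrite [a + _]addrC subrK mul1r.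
rewrite mulrDr mulr1 -nmZ -lerBlDr; apply: le_trans; exact: nm_le_sub.
Qed.

Lemma hasd_cst (x : X) a : hasd (fun=> x) a 0.
Proof.
move=> e e0; exists 1 => // h _.
by rewrite subrr scaler0 subrr nm0 mulr_ge0 ?nm_ge0 ?ltW.
Qed.

Lemma hasdD (f g : C -> X) a d d' :
  hasd f a d -> hasd g a d' -> hasd (fun z => f z + g z) a (d + d').
Proof.
move=> fd gd e e0; have e2 : 0 < e / 2 by rewrite divr_gt0.
have [r r0 rP] := fd _ e2; have [s s0 sP] := gd _ e2.
exists (Num.min r s); first by rewrite lt_min r0.
move=> h; rewrite lt_min => /andP[hr hs].
rewrite (_ : _ - _ = (f (a + h) - f a - h *: d) + (g (a + h) - g a - h *: d')).
  by rewrite (le_trans (nmD _ _))// [in leRHS](splitr e) mulrDl lerD ?rP ?sP.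
by rewrite scalerDr !opprD !addrA; congr (_ + _); rewrite -!addrA; congr (_ + _);
  rewrite addrC -!addrA; congr (_ + _); rewrite addrC -!addrA.
Qed.

End ComplexDerivative.

Section DerivativeAlgebra.
Variable R : realType.
Local Notation C := R[i].
Variable X : normedModType C.

(** Reading the derivative as a continuous difference quotient reduces the
    product rule to a product of limits. *)
Lemma hasd_quotient (f : C -> X) a d : hasd f a d <->
  exists2 q : C -> X, q @ a --> d & forall z, f z = f a + (z - a) *: q z.
Proof.
split.
  move=> fd; exists (fun z => if z == a then d else (z - a)^-1 *: (f z - f a)).
    apply/(cvg_nm (F := nbhs a)) => e e0; have [r r0 rP] := fd _ (divr_gt0 e0 (ltr0n _ 2)).
    apply/nbhs_nm; exists r => // z zr; case: eqVneq => [_|za].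
      by rewrite subrr nm0.
    have za0 : z - a != 0 by rewrite subr_eq0.
    have := rP _ zr; rewrite [a + _]addrC subrK nm_quotient//.
    rewrite mulrC ler_pM2r ?nm_gt0// => /le_lt_trans; apply.
    by rewrite ltr_pdivrMr// ltr_pMr// ltr1n.
  move=> z; case: eqVneq => [->|za]; first by rewrite subrr scale0r addr0.
  by rewrite scalerA mulfV ?subr_eq0// scale1r addrC subrK.
move=> [q /cvg_nm qd qE] e e0; have /nbhs_nm[r r0 rP] := qd e e0.
exists r => // h hr; have := rP (a + h); rewrite qE.
rewrite [a + h]addrC addrK [f a + _]addrC addrK -scalerBr nmZ => /(_ hr) /ltW.
by rewrite mulrC => h1; rewrite ler_wpM2r ?nm_ge0.
Qed.

End DerivativeAlgebra.

Section ProductRule.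
Variable R : realType.
Local Notation C := R[i].
Variables X Y Z : normedModType C.
Variable B : X -> Y -> Z.
Hypothesis BDl : forall x x' y, B (x + x') y = B x y + B x' y.
Hypothesis BDr : forall x y y', B x (y + y') = B x y + B x y'.
Hypothesis BZl : forall c x y, B (c *: x) y = c *: B x y.
Hypothesis BZr : forall c x y, B x (c *: y) = c *: B x y.
Hypothesis B_le : forall x y, nm (B x y) <= nm x * nm y.

Lemma cvg_bilinear (f : C -> X) (g : C -> Y) (a : C) x y :
  f @ a --> x -> g @ a --> y -> (fun z => B (f z) (g z)) @ a --> B x y.
Proof.
move=> /cvg_nm fx /cvg_nm gy; apply/(cvg_nm (F := nbhs a)) => e e0.
pose M := 1 + nm x + nm y.
have M1 : 1 <= M by rewrite /M -addrA lerDl addr_ge0 ?nm_ge0.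
have M0 : 0 < M by apply: lt_le_trans M1.
pose t := Num.min 1 (e / (3 * M)).
have t0 : 0 < t by rewrite lt_min ltr01 divr_gt0// mulr_gt0.
have t1 : t <= 1 by rewrite ge_min lexx.
have te : t * M < e.
  rewrite (@le_lt_trans _ _ (e / (3 * M) * M))//.
    by rewrite ler_wpM2r ?(ltW M0)// ge_min lexx orbT.
  rewrite invfM mulrA mulfVK ?gt_eqF// ltr_pdivrMr//; lra.
have := fx _ t0; have := gy _ t0; apply: filterS2 => z gz fz.
have -> : B (f z) (g z) - B x y = B (f z - x) (g z - y) + B (f z - x) y + B x (g z - y).
  rewrite -BDr subrK.
  have -> : B (f z) (g z) = B (f z - x) (g z) + B x (g z) by rewrite -BDl subrK.
  have -> : B x (g z) = B x (g z - y) + B x y by rewrite -BDr subrK.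
  by rewrite addrA addrK.
rewrite (le_lt_trans (nmD _ _))// (le_lt_trans _ te)//.
have := nmD (B (f z - x) (g z - y)) (B (f z - x) y).
have := B_le (f z - x) (g z - y); have := B_le (f z - x) y; have := B_le x (g z - y).
have := nm_ge0 (f z - x); have := nm_ge0 (g z - y); have := nm_ge0 x; have := nm_ge0 y.
rewrite /M; move: gz fz t1 t0.
move: (nm (f z - x)) (nm (g z - y)) (nm x) (nm y) => p q u v.
by move: (nm (B _ _)) (nm (B _ _)) (nm (B _ _)) (nm (_ + _)) => *; nra.
Qed.

(** One product rule serves for scaling a vector-valued function by a scalar one
    and for evaluating an operator-valued function at a vector-valued one. *)
Lemma hasd_bilinear (f : C -> X) (g : C -> Y) a d d' :
  hasd f a d -> hasd g a d' ->
  hasd (fun z => B (f z) (g z)) a (B d (g a) + B (f a) d').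
Proof.
move=> fd gd; have ga := hasd_cvg gd.
move: fd gd => /hasd_quotient[p pd fE] /hasd_quotient[q qd gE].
apply/hasd_quotient; exists (fun z => B (p z) (g z) + B (f a) (q z)).
  apply: (cvgD (F := nbhs a)); first exact: cvg_bilinear.
  by apply: (cvg_bilinear (f := fun=> f a)); [exact: cvg_constant|].
move=> z; rewrite {1}fE BDl BZl {1}gE BDr BZr scalerDr -!addrA; congr (_ + _).
by rewrite addrC.
Qed.

End ProductRule.

Section DerivativeRules.
Variable R : realType.
Local Notation C := R[i].

Lemma hasd_id (a : C) : hasd (fun z : C => z) a 1.
Proof.
by move=> e e0; exists 1 => // h _; rewrite [a + h]addrC addrK /GRing.scale/= mulr1
  subrr nm0 mulr_ge0 ?nm_ge0 ?ltW.
Qed.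

Lemma hasd_shift (X : normedModType C) (f : C -> X) (a b : C) d :
  hasd f (a + b) d -> hasd (fun z => f (z + b)) a d.
Proof.
move=> fd e e0; have [r r0 rP] := fd e e0; exists r => // h hr.
by rewrite (addrAC a h b) rP.
Qed.

Lemma cvg_mulC (f g : C -> C) (a x y : C) :
  f @ a --> x -> g @ a --> y -> (fun z => f z * g z) @ a --> x * y.
Proof.
apply: (@cvg_bilinear _ _ _ _ (fun x y : C => x * y : C)) => *.
- by rewrite mulrDl.
- by rewrite mulrDr.
- by rewrite nmM.
Qed.

Lemma cvg_oppC (f : C -> C) (a x : C) :
  f @ a --> x -> (fun z => - f z) @ a --> - x.
Proof.
move=> /cvg_nm fx; apply/(cvg_nm (F := nbhs a)) => e /fx.
by apply: filterS => z; rewrite -opprD nmN.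
Qed.

Lemma inv_diff (F : fieldType) (x y : F) : x != 0 -> y != 0 ->
  x^-1 - y^-1 = (y - x) / (x * y).
Proof.
by move=> x0 y0; rewrite mulrBl invfM mulrCA mulfV// mulr1 mulrA mulfV// mul1r.
Qed.

Lemma hasdZ (X : normedModType C) (f : C -> C) (g : C -> X) a d d' :
  hasd f a d -> hasd g a d' ->
  hasd (fun z => f z *: g z) a (d *: g a + f a *: d').
Proof.
apply: hasd_bilinear => *.
- by rewrite scalerDl.
- by rewrite scalerDr.
- by rewrite -scalerA.
- by rewrite !scalerA mulrC.
- by rewrite nmZ.
Qed.

Lemma hasdM (f g : C -> C) a d d' :
  hasd f a d -> hasd g a d' -> hasd (fun z => f z * g z) a (d * g a + f a * d').
Proof. exact: hasdZ. Qed.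

Lemma hasdV (f : C -> C) a d : hasd f a d -> f a != 0 ->
  hasd (fun z => (f z)^-1) a (- d / (f a) ^+ 2).
Proof.
move=> fd fa0; have fa := hasd_cvg fd.
have nfa : 0 < nm (f a) by rewrite nm_gt0.
have near0 : \forall z \near a, nm (f a) / 2 <= nm (f z).
  move/cvg_nm: fa => /(_ _ (divr_gt0 nfa (ltr0n _ 2))); apply: filterS => z.
  rewrite nm_distC; have := nm_le_sub (f a) (f z); lra.
have fV : (fun z => (f z)^-1) @ a --> (f a)^-1.
  apply/(cvg_nm (F := nbhs a)) => e e0.
  have t0 : 0 < e * (nm (f a) / 2 * nm (f a)) by rewrite !mulr_gt0.
  move/cvg_nm: fa => /(_ _ t0); move: near0; apply: filterS2 => z zf zt.
  have fz0 : f z != 0 by rewrite -nm_gt0 (lt_le_trans _ zf)// divr_gt0.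
  rewrite inv_diff// nmM nmV nmM nm_distC ltr_pdivrMr ?mulr_gt0 ?nm_gt0//.
  by rewrite (lt_le_trans zt)// ler_pM2l// ler_pM2r.
move: fd => /hasd_quotient[q qd fE].
apply: (@hasd_ext _ _ (fun z => (f a)^-1 + (z - a) *: (- q z * ((f z)^-1 * (f a)^-1)))).
  move: near0; apply: filterS => z zf.
  have fz0 : f z != 0 by rewrite -nm_gt0 (lt_le_trans _ zf)// divr_gt0.
  apply: (addrI (- (f a)^-1)); rewrite addKr [RHS]addrC inv_diff// invfM /GRing.scale /= mulrA mulrN -mulNr.
  congr (_ * _); have -> : f a - f z = - ((z - a) * q z).
    by rewrite {1}(fE z) opprD addrA subrr sub0r.
  by rewrite mulNr.
apply/hasd_quotient; exists (fun z => - q z * ((f z)^-1 * (f a)^-1)); last first.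
  by move=> z; rewrite subrr scale0r addr0.
have fVa : (fun _ : C => (f a)^-1 : C) @ a --> ((f a)^-1 : C) by exact: cvg_constant.
rewrite expr2 invfM; exact: (cvg_mulC (cvg_oppC qd) (cvg_mulC fV fVa)).
Qed.

Lemma hasdN (X : normedModType C) (f : C -> X) a d :
  hasd f a d -> hasd (fun z => - f z) a (- d).
Proof.
move=> fd e e0; have [r r0 rP] := fd e e0; exists r => // h hr.
by rewrite -opprD scalerN -opprD nmN rP.
Qed.

Lemma hasdB (X : normedModType C) (f g : C -> X) a d d' :
  hasd f a d -> hasd g a d' -> hasd (fun z => f z - g z) a (d - d').
Proof. by move=> fd gd; apply: hasdD => //; exact: hasdN. Qed.

Lemma hasd_linear (X Y : normedModType C) (l : X -> Y) (f : C -> X) a d :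
  linear l -> (exists2 M, 0 < M & forall x, nm (l x) <= M * nm x) ->
  hasd f a d -> hasd (l \o f) a (l d).
Proof.
move=> ll [M M0 lM] fd e e0; have [r r0 rP] := fd _ (divr_gt0 e0 M0).
pose L : {linear X -> Y} := HB.pack l (GRing.isLinear.Build _ _ _ _ l ll).
exists r => // h hr; rewrite /= -[l]/(L : X -> Y) -linearB -linearZ -linearB.
by rewrite (le_trans (lM _))// -ler_pdivlMl// mulrA [M^-1 * e]mulrC rP.
Qed.

End DerivativeRules.

(** * Integrals along the sides of rectangles *)

Section ComplexIntegral.
Variable R : realType.
Local Notation C := R[i].
Local Notation mu := (@lebesgue_measure R).
Implicit Types (g h : R -> C) (a b c t : R).

Definition path_continuous g a b := forall t, a <= t <= b ->
  forall e : R, 0 < e -> exists2 r : R, 0 < r & forall s, `|s - t| < r ->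
    nm (g s - g t) < e.

Definition cint a b g : C :=
  Complex (\int[mu]_(t in `[a, b]) complex.Re (g t))
          (\int[mu]_(t in `[a, b]) complex.Im (g t)).

Lemma path_integrable (p : C -> R) g a b :
  (forall z w, `|p z - p w| <= nm (z - w)) -> path_continuous g a b ->
  mu.-integrable `[a, b] (EFin \o (p \o g)).
Proof.
move=> pL gc; apply: continuous_compact_integrable; first exact: segment_compact.
apply: continuous_in_subspaceT => t; rewrite inE /= in_itv /= => tab.
apply/(@cvgrPdist_lt _ R) => e e0; have [r r0 rP] := gc t tab e e0.
apply/nbhs_ballP; exists r => // s; rewrite /ball /= => ts.
by rewrite (le_lt_trans (pL _ _))// nm_distC rP// distrC.
Qed.

Lemma ReB (z w : C) : complex.Re (z - w) = complex.Re z - complex.Re w.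
Proof. by case: z w => ? ? []. Qed.
Lemma ImB (z w : C) : complex.Im (z - w) = complex.Im z - complex.Im w.
Proof. by case: z w => ? ? []. Qed.

Lemma Re_lip (z w : C) : `|complex.Re z - complex.Re w| <= nm (z - w).
Proof. by rewrite -ReB nm_Re. Qed.
Lemma Im_lip (z w : C) : `|complex.Im z - complex.Im w| <= nm (z - w).
Proof. by rewrite -ImB nm_Im. Qed.

Let intRe g a b := fun gc => @path_integrable (@complex.Re R) g a b Re_lip gc.
Let intIm g a b := fun gc => @path_integrable (@complex.Im R) g a b Im_lip gc.

Lemma eq_cint g h a b : (forall t, a <= t <= b -> g t = h t) ->
  cint a b g = cint a b h.
Proof.
move=> gh; congr Complex; apply: eq_Rintegral => t; rewrite inE /= in_itv /=;
  by move=> /gh ->.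
Qed.

Lemma cintB g h a b : path_continuous g a b -> path_continuous h a b ->
  cint a b (fun t => g t - h t) = cint a b g - cint a b h.
Proof.
move=> gc hc; apply/eqP; rewrite eq_complex; apply/andP; split; apply/eqP.
  rewrite /= -(RintegralB _ (intRe gc) (intRe hc))//.
  by apply: eq_Rintegral => t _; rewrite ReB.
rewrite /= -(RintegralB _ (intIm gc) (intIm hc))//.
by apply: eq_Rintegral => t _; rewrite ImB.
Qed.

Let fine_mu a b : a <= b -> fine (mu `[a, b]) = b - a.
Proof.
rewrite le_eqVlt lebesgue_measure_itv /= lte_fin => /predU1P[->|->//].
by rewrite ltxx subrr.
Qed.

Lemma cint_cst a b (k : C) : a <= b -> cint a b (fun=> k) = (b - a)%:C * k.
Proof.
move=> ab; apply/eqP; rewrite eq_complex /=.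
have muE : fine (mu `[a, b]) = b - a.
  exact: fine_mu.
by rewrite !Rintegral_cst//= muE; case: k => x y /=; rewrite !mul0r subr0 addr0
  ![_ * (b - a)]mulrC !eqxx.
Qed.

Lemma cint_cat g a b c : a <= c -> c <= b -> path_continuous g a b ->
  cint a b g = cint a c g + cint c b g.
Proof.
move=> ac cb gc; have gcb : path_continuous g c b.
  by move=> t /andP[ct tb]; apply: gc; rewrite tb (le_trans ac).
apply/eqP; rewrite eq_complex; apply/andP; split; apply/eqP => /=.
  apply/eqP; rewrite addrC -subr_eq Rintegral_itvB ?bnd_simp//; last exact: intRe.
  rewrite Rintegral_itv_obnd_cbnd//; apply: integrableS (intRe gcb) => //.
  by apply: subset_itvr; rewrite bnd_simp.
apply/eqP; rewrite addrC -subr_eq Rintegral_itvB ?bnd_simp//; last exact: intIm.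
rewrite Rintegral_itv_obnd_cbnd//; apply: integrableS (intIm gcb) => //.
by apply: subset_itvr; rewrite bnd_simp.
Qed.

(** The factor [2] comes from estimating the two components separately. *)
Lemma nm_cint g a b (M : R) : a <= b -> path_continuous g a b ->
  (forall t, a <= t <= b -> nm (g t) <= M) -> nm (cint a b g) <= 2 * M * (b - a).
Proof.
move=> ab gc gM.
have bound (p : C -> R) : (forall z, `|p z| <= nm z) ->
    mu.-integrable `[a, b] (EFin \o (p \o g)) ->
    `|\int[mu]_(t in `[a, b]) p (g t)| <= M * (b - a).
  move=> pL ip; apply: (le_trans (le_normr_Rintegral _ ip)) => //.
  have muE : fine (mu `[a, b]) = b - a.
    exact: fine_mu.
  rewrite -muE -Rintegral_cst//; apply: le_Rintegral => //.
  - exact: integrable_norm ip.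
  - apply: continuous_compact_integrable; first exact: segment_compact.
    by apply: continuous_subspaceT => x; exact: cvg_cst.
  - by move=> t; rewrite /= in_itv /= => /gM; apply: le_trans.
apply: (le_trans (nm_le_ReIm _)); rewrite -mulrA mulr2n mulrDl mul1r.
by apply: lerD; apply: bound; [exact: nm_Re|exact: intRe|exact: nm_Im|exact: intIm].
Qed.

Lemma path_continuous_cst (k : C) a b : path_continuous (fun=> k) a b.
Proof. by move=> t _ e e0; exists 1 => // s _; rewrite subrr nm0. Qed.

Lemma cintZ g a b (k : C) : path_continuous g a b ->
  cint a b (fun t => k * g t) = k * cint a b g.
Proof.
move=> gc; have iR := intRe gc; have iI := intIm gc.
have iZ (c : R) (p : R -> R) : mu.-integrable `[a, b] (EFin \o p) ->
    mu.-integrable `[a, b] (EFin \o (fun t => c * p t)).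
  by move=> ip; apply: (integrableZl _ c ip).
case: k => x y; apply/eqP; rewrite eq_complex /=; apply/andP; split; apply/eqP.
  rewrite -!RintegralZl//; rewrite -(RintegralB _ (iZ x _ iR) (iZ y _ iI))//.
  by apply: eq_Rintegral => t _ /=; case: (g t).
rewrite -!RintegralZl//; rewrite -(RintegralD _ (iZ x _ iI) (iZ y _ iR))//.
by apply: eq_Rintegral => t _ /=; case: (g t).
Qed.

End ComplexIntegral.

Section Rectangles.
Variable R : realType.
Local Notation C := R[i].
Implicit Types (f g : C -> C) (a b c d e x y : R) (z w : C).

Definition contpt f z := f w @[w --> z] --> f z.

Definition ii : C := Complex 0 1.

Definition hint f c a b := cint a b (fun x => f (Complex x c)).
Definition vint f a c d := cint c d (fun y => f (Complex a y)).

(** The integral of [f] along the boundary of a rectangle, counterclockwise. *)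
Definition rint f a b c d : C :=
  hint f c a b - hint f d a b + ii * (vint f b c d - vint f a c d).

Definition rect a b c d z :=
  (a <= complex.Re z <= b) && (c <= complex.Im z <= d).

Definition edge a b c d z := rect a b c d z /\
  [\/ complex.Re z = a, complex.Re z = b, complex.Im z = c | complex.Im z = d].

Lemma nm_horizontal x y c : nm (Complex x c - Complex y c) = `|x - y|.
Proof. by rewrite -nmR; congr nm; apply/eqP; rewrite eq_complex /= subrr !eqxx. Qed.

Lemma nm_vertical x y c : nm (Complex c x - Complex c y) = `|x - y|.
Proof.
rewrite (_ : Complex c x - Complex c y = ii * (x - y)%:C).
  have -> : nm (ii * (x - y)%:C) = nm ii * nm ((x - y)%:C : C) by rewrite nmM.
  by rewrite nmR /nm normc_def /= expr0n /= add0r expr1n sqrtr1 mul1r.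
by apply/eqP; rewrite eq_complex /= subrr; apply/andP; split; apply/eqP; ring.
Qed.

Lemma hcont f c a b : (forall x, a <= x <= b -> contpt f (Complex x c)) ->
  path_continuous (fun x => f (Complex x c)) a b.
Proof.
move=> fc t /fc /cvg_nm ft e /ft /nbhs_nm[r r0 rP]; exists r => // s sr.
by apply: rP; rewrite nm_horizontal.
Qed.

Lemma vcont f a c d : (forall y, c <= y <= d -> contpt f (Complex a y)) ->
  path_continuous (fun y => f (Complex a y)) c d.
Proof.
move=> fc t /fc /cvg_nm ft e /ft /nbhs_nm[r r0 rP]; exists r => // s sr.
by apply: rP; rewrite nm_vertical.
Qed.

Lemma edges a b c d (P : set C) : a <= b -> c <= d ->
  (forall z, edge a b c d z -> P z) ->
  [/\ forall x, a <= x <= b -> P (Complex x c),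
      forall x, a <= x <= b -> P (Complex x d),
      forall y, c <= y <= d -> P (Complex b y) &
      forall y, c <= y <= d -> P (Complex a y)].
Proof.
move=> ab cd eP; split => t tP; apply: eP; split; rewrite /rect /= ?tP ?lexx ?ab ?cd//.
- by apply: Or43.
- by apply: Or44.
- by apply: Or42.
- by apply: Or41.
Qed.

Lemma edge_rect a b c d z : edge a b c d z -> rect a b c d z.
Proof. by case. Qed.

Lemma rint_ext f g a b c d : a <= b -> c <= d ->
  (forall z, edge a b c d z -> f z = g z) -> rint f a b c d = rint g a b c d.
Proof.
move=> ab cd /(edges ab cd)[h1 h2 h3 h4].
congr (_ - _ + _ * (_ - _)); apply: eq_cint; [exact: h1|exact: h2|exact: h3|exact: h4].
Qed.

Lemma rintB f g a b c d : a <= b -> c <= d ->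
  (forall z, edge a b c d z -> contpt f z) ->
  (forall z, edge a b c d z -> contpt g z) ->
  rint (fun z => f z - g z) a b c d = rint f a b c d - rint g a b c d.
Proof.
move=> ab cd /(edges ab cd)[/hcont f1 /hcont f2 /vcont f3 /vcont f4].
move=> /(edges ab cd)[/hcont g1 /hcont g2 /vcont g3 /vcont g4].
by rewrite /rint /hint /vint !cintB//; move: ii => j; ring.
Qed.

Lemma rintZ f a b c d (k : C) : a <= b -> c <= d ->
  (forall z, edge a b c d z -> contpt f z) ->
  rint (fun z => k * f z) a b c d = k * rint f a b c d.
Proof.
move=> ab cd /(edges ab cd)[/hcont f1 /hcont f2 /vcont f3 /vcont f4].
by rewrite /rint /hint /vint !cintZ//; move: ii => j; ring.
Qed.

Lemma nm_ii : nm (ii : C) = 1.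
Proof. by rewrite /nm normc_def /= expr0n /= add0r expr1n sqrtr1. Qed.

Lemma nm_rint f a b c d (M : R) : a <= b -> c <= d ->
  (forall z, edge a b c d z -> contpt f z) ->
  (forall z, edge a b c d z -> nm (f z) <= M) ->
  nm (rint f a b c d) <= 4 * M * ((b - a) + (d - c)).
Proof.
move=> ab cd /(edges ab cd)[/hcont f1 /hcont f2 /vcont f3 /vcont f4].
move=> /(edges ab cd)[M1 M2 M3 M4].
have := nm_cint ab f1 M1; have := nm_cint ab f2 M2.
have := nm_cint cd f3 M3; have := nm_cint cd f4 M4.
rewrite /rint /hint /vint.
set h := cint a b _; set h' := cint a b _; set v := cint c d _; set v' := cint c d _.
move=> hv' hv hh' hh; apply: (le_trans (nmD _ _)); rewrite nmM nm_ii mul1r.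
apply: (le_trans (lerD (nmB _ _) (nmB _ _))).
move: hv' hv hh' hh; move: (nm h) (nm h') (nm v) (nm v') => ? ? ? ?; lra.
Qed.

Lemma rint_catx f a e b c d : a <= e -> e <= b -> c <= d ->
  (forall x, a <= x <= b -> contpt f (Complex x c) /\ contpt f (Complex x d)) ->
  rint f a b c d = rint f a e c d + rint f e b c d.
Proof.
move=> ae eb cd fc; have f1 := hcont (fun x xP => (fc x xP).1).
have f2 := hcont (fun x xP => (fc x xP).2).
rewrite /rint /hint (cint_cat ae eb f1) (cint_cat ae eb f2).
by move: ii => j; ring.
Qed.

Lemma rint_caty f a b c e d : c <= e -> e <= d -> a <= b ->
  (forall y, c <= y <= d -> contpt f (Complex a y) /\ contpt f (Complex b y)) ->
  rint f a b c d = rint f a b c e + rint f a b e d.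
Proof.
move=> ce ed ab fc; have f1 := vcont (fun x xP => (fc x xP).1).
have f2 := vcont (fun x xP => (fc x xP).2).
rewrite /rint /vint (cint_cat ce ed f1) (cint_cat ce ed f2).
by move: ii => j; ring.
Qed.

Lemma contpt_hasd f z D : hasd f z D -> contpt f z.
Proof. exact: hasd_cvg. Qed.

Lemma hasd_affine (A D z : C) : hasd (fun w => A + D * w) z D.
Proof.
have := hasdD (@hasd_cst _ C A z) (hasdM (@hasd_cst _ C D z) (hasd_id z)).
by rewrite add0r mul0r add0r mulr1.
Qed.

(** At a small scale a differentiable function is affine up to a negligible
    error, so this is the infinitesimal case of Goursat's theorem. *)
Lemma rint_affine (A D : C) a b c d : a <= b -> c <= d ->
  rint (fun z => A + D * z) a b c d = 0.
Proof.
move=> ab cd; set f := fun z => _.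
have fc z : contpt f z by apply: contpt_hasd; exact: hasd_affine.
have h x : path_continuous (fun t => f (Complex t x)) a b by apply: hcont.
have v x : path_continuous (fun t => f (Complex x t)) c d by apply: vcont.
rewrite /rint /hint /vint -!cintB//.
rewrite (@eq_cint _ _ (fun=> D * ii * (c - d)%:C)); last first.
  move=> t _; rewrite /f opprD addrACA subrr add0r -mulrBr -mulrA.
  by congr (_ * _); apply/eqP; rewrite eq_complex /=; apply/andP; split; apply/eqP; ring.
rewrite [X in ii * X](@eq_cint _ _ (fun=> D * (b - a)%:C)); last first.
  move=> t _; rewrite /f opprD addrACA subrr add0r -mulrBr.
  by congr (_ * _); apply/eqP; rewrite eq_complex /=; apply/andP; split; apply/eqP; ring.
rewrite !cint_cst// !rmorphB /=.
by move: ii (a%:C) (b%:C) (c%:C) (d%:C) => j a' b' c' d'; ring.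
Qed.

End Rectangles.

(** * Goursat's theorem and Cauchy's formula *)

Section Goursat.
Variable R : realType.
Local Notation C := R[i].
Implicit Types (f g : C -> C) (a b c d e x y : R) (z w : C).

Lemma rectW a b c d a' b' c' d' z : a' <= a -> b <= b' -> c' <= c -> d <= d' ->
  rect a b c d z -> rect a' b' c' d' z.
Proof. by rewrite /rect => *; lra. Qed.

Lemma rint_quarters f a e b c o d : a <= e -> e <= b -> c <= o -> o <= d ->
  (forall z, rect a b c d z -> contpt f z) ->
  rint f a b c d = rint f a e c o + rint f a e o d +
                   (rint f e b c o + rint f e b o d).
Proof.
move=> ae eb co od fc.
have fR x y : a <= x <= b -> c <= y <= d -> contpt f (Complex x y).
  by move=> xP yP; apply: fc; rewrite /rect xP.
rewrite (@rint_catx _ f a e b)//; last 2 first.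
- by rewrite (le_trans co).
- by move=> x xP; split; apply: fR => //; lra.
by rewrite (@rint_caty _ f a e c o d)// ?(@rint_caty _ f e b c o d)//;
  move=> y yP; split; apply: fR => //; lra.
Qed.

Lemma large_term (m p q s t : R) : 4 * m < p + q + (s + t) ->
  (m < p \/ m < q) \/ (m < s \/ m < t).
Proof.
move=> H; have [|h1] := ltP m p; first by left; left.
have [|h2] := ltP m q; first by left; right.
have [|h3] := ltP m s; first by right; left.
by right; right; lra.
Qed.

(** Bisection keeps one of the four quarters of a rectangle with a large
    integral; sizes are recorded separately from corners, so that a degenerate
    rectangle causes no ambiguity. *)
Lemma quarter_large f a c l k (m : R) : 0 <= l -> 0 <= k ->
  (forall z, rect a (a + l) c (c + k) z -> contpt f z) ->
  4 * m < nm (rint f a (a + l) c (c + k)) ->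
  exists p : R * R, [/\ a <= p.1, p.1 + l / 2 <= a + l, c <= p.2,
    p.2 + k / 2 <= c + k &
    m < nm (rint f p.1 (p.1 + l / 2) p.2 (p.2 + k / 2))].
Proof.
move=> l0 k0 fc; rewrite (@rint_quarters f a (a + l / 2) _ c (c + k / 2))//; try lra.
have al : a + l = a + l / 2 + l / 2 by lra.
have ck : c + k = c + k / 2 + k / 2 by lra.
have la : a + l / 2 <= a + l by lra.
have kc : c + k / 2 <= c + k by lra.
have la' : a <= a + l / 2 by lra.
have kc' : c <= c + k / 2 by lra.
rewrite {1 2}al {1 2}ck.
set u := rint f a _ c _; set v := rint f a _ _ _.
set u' := rint f _ _ c _; set v' := rint f _ _ _ _ => H.
have {}H : 4 * m < nm u + nm v + (nm u' + nm v').
  by apply: (lt_le_trans H); apply: (le_trans (nmD _ _)); apply: lerD; exact: nmD.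
have [[mu|mv]|[mu'|mv']] : (m < nm u \/ m < nm v) \/ (m < nm u' \/ m < nm v').
  exact: large_term H.
- exists (a, c); split; [exact: lexx|exact: la|exact: lexx|exact: kc|exact: mu].
- exists (a, c + k / 2); split; [exact: lexx|exact: la|exact: kc'| |exact: mv].
  by rewrite /= -ck.
- exists (a + l / 2, c); split; [exact: la'| |exact: lexx|exact: kc|exact: mu'].
  by rewrite /= -al.
- exists (a + l / 2, c + k / 2).
  by split; [exact: la'|rewrite /= -al|exact: kc'|rewrite /= -ck|exact: mv'].
Qed.

Lemma nested_point (x : nat -> R) l : 0 <= l ->
  (forall n, x n <= x n.+1) ->
  (forall n, x n.+1 + l / 2 ^+ n.+1 <= x n + l / 2 ^+ n) ->
  exists p, forall n, x n <= p <= x n + l / 2 ^+ n.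
Proof.
move=> l0 xS lS.
have xm m n : (m <= n)%N -> x m <= x n by move: m n; exact: (nondecreasing_seqP x).1.
have lm m n : (m <= n)%N -> x n + l / 2 ^+ n <= x m + l / 2 ^+ m.
  by move: m n; exact: (nonincreasing_seqP (fun i => x i + l / 2 ^+ i)).1.
have l2 n : 0 <= l / 2 ^+ n by rewrite divr_ge0// exprn_ge0.
have ub n : ubound (range x) (x n + l / 2 ^+ n).
  move=> _ [m _ <-]; have [mn|/ltnW nm] := leqP m n.
    by rewrite (le_trans (xm _ _ mn))// lerDl.
  by rewrite (le_trans _ (lm _ _ nm))// lerDl.
exists (sup (range x)) => n; apply/andP; split.
  by apply: ub_le_sup; [exists (x 0%N + l / 2 ^+ 0); exact: ub|exists n].
by apply: ge_sup => //; exists (x 0%N), 0%N.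
Qed.

Lemma pow2_small (s r : R) : 0 < r -> exists n, s / 2 ^+ n < r.
Proof.
move=> r0; exists (truncn `|s / r|).+1.
rewrite ltr_pdivrMr ?exprn_gt0// -ltr_pdivrMl// mulrC.
apply: (le_lt_trans (ler_norm _)).
apply: (@lt_trans _ _ (truncn `|s / r|).+1%:R); first exact: truncnS_gt.
by rewrite -natrX ltr_nat ltn_expl.
Qed.

Lemma nm_Complex x y x' y' :
  nm (Complex x y - Complex x' y') <= `|x - x'| + `|y - y'|.
Proof. exact: nm_le_ReIm. Qed.

(** If the integral were nonzero, bisection would give rectangles shrinking to a
    point [p] whose integrals are at least a fixed multiple [e] of the squared
    half perimeter.  Near [p] the function differs from an affine one by
    [o(|w - p|)], which makes these integrals smaller than that. *)
Theorem goursat f a b c d : a <= b -> c <= d ->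
  (forall z, rect a b c d z -> exists D, hasd f z D) -> rint f a b c d = 0.
Proof.
move=> ab cd fhol; apply/eqP/negP => /negP; rewrite -nm_gt0.
set q := nm _ => q0; pose l := b - a; pose k := d - c.
have l0 : 0 <= l by rewrite subr_ge0.
have k0 : 0 <= k by rewrite subr_ge0.
have fcont z : rect a b c d z -> contpt f z by move=> /fhol[D /contpt_hasd].
(* Adding 1 keeps the denominator positive for a degenerate rectangle. *)
pose e := q / (1 + (l + k) ^+ 2).
have M0 : 0 < 1 + (l + k) ^+ 2 by rewrite ltr_wpDr ?sqr_ge0.
have e0 : 0 < e by rewrite divr_gt0.
have eq : e * (l + k) ^+ 2 < q.
  have : e * (1 + (l + k) ^+ 2) = q by rewrite divfK// gt_eqF.
  move: e0; nra.
pose L n := l / 2 ^+ n; pose K n := k / 2 ^+ n.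
have L0 n : 0 <= L n by rewrite divr_ge0// exprn_ge0.
have K0 n : 0 <= K n by rewrite divr_ge0// exprn_ge0.
have LS n : L n.+1 = L n / 2 by rewrite /L exprS invfM [2^-1 * _]mulrC mulrA.
have KS n : K n.+1 = K n / 2 by rewrite /K exprS invfM [2^-1 * _]mulrC mulrA.
pose good n (p : R * R) :=
  [/\ a <= p.1, p.1 + L n <= b, c <= p.2, p.2 + K n <= d &
      e * (L n + K n) ^+ 2 < nm (rint f p.1 (p.1 + L n) p.2 (p.2 + K n))].
have /choice[step stepP] (np : nat * (R * R)) : exists p' : R * R,
    good np.1 np.2 -> [/\ good np.1.+1 p', np.2.1 <= p'.1, np.2.2 <= p'.2,
      p'.1 + L np.1.+1 <= np.2.1 + L np.1 & p'.2 + K np.1.+1 <= np.2.2 + K np.1].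
  case: np => n [x y] /=; have [gn|] := pselect (good n (x, y)); last by exists (0, 0).
  move: (gn) => [/= ax xb cy yd big].
  have fr z : rect x (x + L n) y (y + K n) z -> contpt f z.
    by move=> zr; apply: fcont; apply: rectW zr.
  have big4 : 4 * (e * (L n.+1 + K n.+1) ^+ 2) < nm (rint f x (x + L n) y (y + K n)).
    apply: le_lt_trans big; rewrite LS KS -mulrDl exprMn.
    by rewrite le_eqVlt; apply/orP; left; apply/eqP; field.
  have [[x' y'] /= [xx' xl yy' yk m]] := quarter_large (L0 n) (K0 n) fr big4.
  rewrite -LS in xl m; rewrite -KS in yk m.
  exists (x', y') => _; split; [|exact: xx'|exact: yy'|exact: xl|exact: yk].
  split; [exact: le_trans ax xx'|exact: le_trans xl xb|exact: le_trans cy yy'| |exact: m].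
  exact: le_trans yk yd.
pose s := fix s n := if n is n'.+1 then step (n', s n') else (a, c).
have sg n : good n (s n).
  elim: n => [|n IH]; last by case: (stepP (n, s n) IH).
  have [L0E K0E] : L 0%N = l /\ K 0%N = k by rewrite /L /K expr0 !divr1.
  have [al ck] : a + l = b /\ c + k = d by rewrite /l /k ![_ + (_ - _)]addrC !subrK.
  by rewrite /good /= L0E K0E al ck; split; [exact: lexx|exact: lexx|exact: lexx|exact: lexx|exact: eq].
have sS n := stepP (n, s n) (sg n).
have [px pxP] : exists p, forall n, (s n).1 <= p <= (s n).1 + L n.
  by apply: nested_point => // n; case: (sS n).
have [py pyP] : exists p, forall n, (s n).2 <= p <= (s n).2 + K n.
  by apply: nested_point => // n; case: (sS n).
pose p := Complex px py.
have [D fD] : exists D, hasd f p D.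
  have [/andP[px0 px1] /andP[py0 py1]] := (pxP 0%N, pyP 0%N).
  have [h1 h2 h3 h4 _] := sg 0%N; apply: fhol; rewrite /rect /=.
  by rewrite (le_trans h1 px0) (le_trans px1 h2) (le_trans h3 py0) (le_trans py1 h4).
(* The factor 4 in [nm_rint] turns [e / 8] into [e / 2], which is below [e]. *)
have [r r0 rP] := fD _ (divr_gt0 e0 (ltr0n _ 8)).
have [n nr] := pow2_small (l + k) r0.
have LKr : L n + K n < r by rewrite /L /K -mulrDl.
case: (sg n); set x := (s n).1; set y := (s n).2 => ax xb cy yd.
pose g w := f w - (f p - D * p + D * w).
have near w : rect x (x + L n) y (y + K n) w -> nm (w - p) <= L n + K n.
  case: w => u v; rewrite /rect /= => uv; apply: (le_trans (nm_Complex _ _ _ _)).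
  by apply: lerD; rewrite ler_norml; have := pxP n; have := pyP n; lra.
have xl : x <= x + L n by rewrite lerDl.
have yk : y <= y + K n by rewrite lerDl.
have fr z : edge x (x + L n) y (y + K n) z -> contpt f z.
  by move=> /edge_rect zr; apply: fcont; apply: rectW zr.
have ac z : contpt (fun w => f p - D * p + D * w) z.
  by apply: contpt_hasd; exact: hasd_affine.
have -> : rint f x (x + L n) y (y + K n) = rint g x (x + L n) y (y + K n).
  by rewrite (rintB xl yk fr (fun z _ => ac z)) (rint_affine _ _ xl yk) subr0.
apply/negP; rewrite -leNgt.
have gb z : edge x (x + L n) y (y + K n) z -> nm (g z) <= e / 8 * (L n + K n).
  move=> /edge_rect /near zp; have := rP (z - p).
  rewrite [p + _]addrC subrK => /(_ (le_lt_trans zp LKr)) H.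
  have -> : g z = f z - f p - (z - p) *: D.
    by rewrite /g /GRing.scale /= mulrC; move: (f z) (f p) => u v; ring.
  by apply: (le_trans H); rewrite ler_wpM2l// divr_ge0// ltW.
have gc z : edge x (x + L n) y (y + K n) z -> contpt g z.
  move=> /edge_rect zr; have [|D' fD'] := fhol z; first by apply: rectW zr.
  by apply: contpt_hasd; apply: (hasdB fD'); exact: hasd_affine.
apply: (le_trans (nm_rint xl yk gc gb)).
have -> : x + L n - x + (y + K n - y) = L n + K n by ring.
have : 0 <= (L n + K n) ^+ 2 by rewrite sqr_ge0.
move: (L n + K n) e0 => t; nra.
Qed.

End Goursat.

(* Some side goals are equations in [R[i]], on which [lra] must not be tried. *)
Ltac side := lazymatch goal with |- is_true _ => try lra | _ => idtac end.

Section Cauchy.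
Variable R : realType.
Local Notation C := R[i].
Local Notation mu := (@lebesgue_measure R).
Implicit Types (f g : C -> C) (b c d e s t x y : R) (a z w : C).

Definition sqint f a s := rint f (complex.Re a - s) (complex.Re a + s)
  (complex.Im a - s) (complex.Im a + s).

Definition sq a s z := rect (complex.Re a - s) (complex.Re a + s)
  (complex.Im a - s) (complex.Im a + s) z.

Definition sqedge a s z := edge (complex.Re a - s) (complex.Re a + s)
  (complex.Im a - s) (complex.Im a + s) z.

Lemma complex_neq z w : complex.Re z != complex.Re w \/ complex.Im z != complex.Im w ->
  z != w.
Proof. by case=> h; apply: contraNneq h => ->. Qed.

(** Goursat's theorem on the four rectangles between two squares. *)
Lemma sqint_shrink f a w s e : 0 < e ->
  complex.Re a - s <= complex.Re w - e -> complex.Re w + e <= complex.Re a + s ->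
  complex.Im a - s <= complex.Im w - e -> complex.Im w + e <= complex.Im a + s ->
  (forall z, sq a s z -> z != w -> exists D, hasd f z D) ->
  sqint f a s = sqint f w e.
Proof.
rewrite /sqint /sq.
move: (complex.Re a - s) (complex.Re a + s) (complex.Im a - s) (complex.Im a + s).
move=> x0 x1 y0 y1 e0 h1 h2 h3 h4 fhol.
have fc z : rect x0 x1 y0 y1 z -> z != w -> contpt f z.
  by move=> zr zw; have [D /contpt_hasd] := fhol z zr zw.
have fcc x y : x0 <= x <= x1 -> y0 <= y <= y1 ->
    x != complex.Re w \/ y != complex.Im w -> contpt f (Complex x y).
  by move=> xP yP xy; apply: fc; [rewrite /rect xP|exact: complex_neq].
have gour b c d y : x0 <= b -> b <= c -> c <= x1 -> y0 <= d -> d <= y -> y <= y1 ->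
    [\/ c < complex.Re w, complex.Re w < b, y < complex.Im w | complex.Im w < d] ->
    rint f b c d y = 0.
  move=> xb bc cx yd dy yy out; apply: goursat => // z zr; apply: fhol.
    by apply: rectW zr.
  apply: complex_neq; move: zr; rewrite /rect => /andP[/andP[zb zc] /andP[zd zy]].
  by case: out => h; [left|left|right|right]; rewrite neq_lt; lra.
set wx := complex.Re w in h1 h2 fcc gour *; set wy := complex.Im w in h3 h4 fcc gour *.
rewrite (@rint_catx _ f x0 (wx - e))//; side; last first.
  by move=> x xP; split; apply: fcc => //; side; right; rewrite neq_lt; lra.
rewrite (@rint_catx _ f (wx - e) (wx + e))//; side; last first.
  by move=> x xP; split; apply: fcc => //; side; right; rewrite neq_lt; lra.
rewrite (@rint_caty _ f (wx - e) (wx + e) y0 (wy - e))//; side; last first.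
  by move=> x xP; split; apply: fcc => //; side; left; rewrite neq_lt; lra.
rewrite (@rint_caty _ f (wx - e) (wx + e) (wy - e) (wy + e))//; side; last first.
  by move=> x xP; split; apply: fcc => //; side; left; rewrite neq_lt; lra.
rewrite (gour x0) ?(gour (wx + e)) ?(gour (wx - e) (wx + e) y0 (wy - e)); side;
  try by [apply: Or41; lra|apply: Or42; lra|apply: Or43; lra|apply: Or44; lra].
rewrite (gour (wx - e) (wx + e) (wy + e) y1); side; last by apply: Or44; lra.
by rewrite !add0r !addr0.
Qed.

Lemma Rintegral_atan c e : 0 < e ->
  \int[mu]_(t in `[c - e, c + e]) (e / ((t - c) ^+ 2 + e ^+ 2)) = 2 * atan 1.
Proof.
move=> e0; pose F t := atan ((t - c) / e).
have dF t : is_derive t 1 F (e / ((t - c) ^+ 2 + e ^+ 2)).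
  have h : is_derive t 1 (fun t => (t - c) / e) e^-1.
    apply: is_derive_eq; rewrite /GRing.scale /= mulr0 add0r subr0 mulr1 //.
  have := @is_derive1_comp _ atan (fun t => (t - c) / e) t _ _ (is_derive1_atan _) h.
  have -> : (1 + ((t - c) / e) ^+ 2)^-1 * e^-1 = e / ((t - c) ^+ 2 + e ^+ 2); last by [].
  have d0 : (t - c) ^+ 2 + e ^+ 2 != 0.
    by rewrite gt_eqF// ltr_wpDl ?sqr_ge0// exprn_gt0.
  have e1 : e != 0 by rewrite gt_eqF.
  rewrite -invfM; apply: (mulfI d0); rewrite [RHS]mulrCA mulfV// mulr1.
  have -> : (t - c) ^+ 2 + e ^+ 2 = e * ((1 + ((t - c) / e) ^+ 2) * e).
    by rewrite expr_div_n; field.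
  rewrite mulfK// mulf_neq0// gt_eqF// ltr_wpDr ?sqr_ge0//.
have cF t : {for t, continuous F}.
  by apply: differentiable_continuous; apply/derivable1_diffP; have [] := dF t.
rewrite /Rintegral (@continuous_FTC2 _ _ F).
- rewrite -EFinB /= /F [c + e]addrC addrK [c - e - c]addrAC subrr sub0r.
  by rewrite mulNr divff ?gt_eqF// atanN opprK mulr2n mulrDl mul1r.
- lra.
- apply: continuous_subspaceT => t; apply: cvgM; first exact: cvg_cst.
  apply: cvgV; first by rewrite gt_eqF// ltr_wpDl ?sqr_ge0// exprn_gt0.
  apply: cvgD; last exact: cvg_cst.
  by apply: (@cvg_comp _ _ _ (fun t => t - c) (fun t => t ^+ 2));
    [apply: cvgB; [exact: cvg_id|exact: cvg_cst]|exact: exprn_continuous].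
- split; first by move=> t _; have [] := dF t.
  + by apply: cvg_at_right_filter; exact: cF.
  + by apply: cvg_at_left_filter; exact: cF.
- by move=> t _; rewrite derive1E; have [_ ->] := dF t.
Qed.

End Cauchy.

Section CauchyFormula.
Variable R : realType.
Local Notation C := R[i].
Local Notation mu := (@lebesgue_measure R).
Implicit Types (f g : C -> C) (b c d e s t x y : R) (a z w : C).

Let pk e c t : R := e / ((t - c) ^+ 2 + e ^+ 2).

Let pk_continuous e c : 0 < e -> continuous (pk e c).
Proof.
move=> e0 t; apply: cvgM; first exact: cvg_cst.
apply: cvgV; first by rewrite gt_eqF// ltr_wpDl ?sqr_ge0// exprn_gt0.
apply: cvgD; last exact: cvg_cst.
by apply: (@cvg_comp _ _ _ (fun t => t - c) (fun t => t ^+ 2));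
  [apply: cvgB; [exact: cvg_id|exact: cvg_cst]|exact: exprn_continuous].
Qed.

Let pk_path e c (a b : R) : 0 < e -> path_continuous (fun t => (pk e c t)%:C) a b.
Proof.
move=> e0 t _ d d0; have := @pk_continuous e c e0 t.
move=> /(@cvgrPdist_lt _ R)/(_ _ d0)/nbhs_ballP[r r0 rP].
exists r => // s sr; rewrite -rmorphB nmR distrC; apply: rP.
by rewrite /ball /= distrC.
Qed.

Let cint_pk e c : 0 < e ->
  cint (c - e) (c + e) (fun t => (pk e c t)%:C) = (pi / 2)%:C.
Proof.
move=> e0; congr Complex; last by rewrite /= Rintegral_cst//= mul0r.
by rewrite /= Rintegral_atan// atan1; field.
Qed.

Lemma contpt_inv a z : z != a -> contpt (fun w => (w - a)^-1) z.
Proof.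
move=> za; have h := hasdB (hasd_id z) (@hasd_cst _ _ a z).
by apply: contpt_hasd; apply: (hasdV h); rewrite subr_eq0.
Qed.

Lemma sqedge_neq a s z : 0 < s -> sqedge a s z -> z != a.
Proof.
move=> s0 [_]; case=> h; apply: complex_neq; rewrite h !neq_lt;
  [left|left|right|right]; lra.
Qed.

(** On two opposite sides of the square the integrands [1 / (z - w)] combine to
    twice the kernel [e / ((t - c) ^+ 2 + e ^+ 2)], whose primitive is an
    arctangent. *)
Lemma sqint_inv w e : 0 < e ->
  sqint (fun z => (z - w)^-1) w e = (2 * pi)%:C * ii R.
Proof.
move=> e0; rewrite /sqint.
have xx : complex.Re w - e <= complex.Re w + e by lra.
have yy : complex.Im w - e <= complex.Im w + e by lra.
have fc z : sqedge w e z -> contpt (fun z => (z - w)^-1) z.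
  by move=> /(sqedge_neq e0); exact: contpt_inv.
have [h1 h2 v1 v2] := edges xx yy fc.
rewrite /rint /hint /vint -(cintB (hcont h1) (hcont h2)) -(cintB (vcont v1) (vcont v2)).
rewrite (@eq_cint _ _ (fun t => (2 * ii R) * (pk e (complex.Re w) t)%:C)); last first.
  move=> t _; case: w {xx yy fc h1 h2 v1 v2} => p q /=; rewrite /pk.
  have -> : (Complex t (q - e) - Complex p q) = Complex (t - p) (- e).
    by congr Complex => /=; ring.
  have -> : (Complex t (q + e) - Complex p q) = Complex (t - p) e.
    by congr Complex => /=; ring.
  apply/eqP; rewrite eq_complex /=; apply/andP; split; apply/eqP.
    by rewrite sqrrN; ring.
  by rewrite sqrrN; ring.
rewrite [X in ii R * X](@eq_cint _ _ (fun t => 2 * (pk e (complex.Im w) t)%:C)); last first.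
  move=> t _; case: w {xx yy fc h1 h2 v1 v2} => p q /=; rewrite /pk.
  have -> : (Complex (p + e) t - Complex p q) = Complex e (t - q).
    by congr Complex => /=; ring.
  have -> : (Complex (p - e) t - Complex p q) = Complex (- e) (t - q).
    by congr Complex => /=; ring.
  apply/eqP; rewrite eq_complex /=; apply/andP; split; apply/eqP.
    by rewrite sqrrN [e ^+ 2 + _]addrC; ring.
  by rewrite sqrrN [e ^+ 2 + _]addrC; ring.
rewrite cintZ ?cint_pk//; last exact: pk_path.
rewrite cintZ ?cint_pk//; last exact: pk_path.
have -> : (2 * pi)%:C = 4 * (pi / 2)%:C :> C.
  have -> : 4 = (4 : R)%:C by rewrite -(rmorph_nat (real_complex R)).
  by rewrite -rmorphM; congr (_%:C); field.
by move: (ii R) ((pi / 2)%:C) => j p; ring.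
Qed.

End CauchyFormula.

Section Taylor.
Variable R : realType.
Local Notation C := R[i].
Implicit Types (f g : C -> C) (b c d e s t x y : R) (a z w : C).

(** The square may be shrunk to half-side [e] around [w]; there [f z - f w] is
    at most a multiple of [z - w], so replacing [f z] by [f w] costs [O(e)]. *)
Lemma cauchy_formula f a s w :
  complex.Re a - s < complex.Re w -> complex.Re w < complex.Re a + s ->
  complex.Im a - s < complex.Im w -> complex.Im w < complex.Im a + s ->
  (forall z, sq a s z -> exists D, hasd f z D) ->
  sqint (fun z => f z * (z - w)^-1) a s = (2 * pi)%:C * ii R * f w.
Proof.
move=> h1 h2 h3 h4 fhol.
have hasd_inv z : z != w -> exists D, hasd (fun z => (z - w)^-1) z D.
  move=> zw; have h := hasdB (hasd_id z) (@hasd_cst _ _ w z).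
  by eexists; apply: (hasdV h); rewrite subr_eq0.
have wsq : sq a s w by rewrite /sq /rect; lra.
have [D fD] := fhol w wsq; have [r r0 rP] := fD 1 ltr01.
apply/eqP; rewrite -subr_eq0 -nm_le0; apply/ler_addgt0Pr => q q0; rewrite add0r.
have M0 : 0 < 1 + nm D by rewrite ltr_wpDr ?nm_ge0.
have [e [e0 e1 e2 e3 [e4 er eq]]] : exists e, [/\ 0 < e,
    complex.Re a - s <= complex.Re w - e, complex.Re w + e <= complex.Re a + s,
    complex.Im a - s <= complex.Im w - e &
    [/\ complex.Im w + e <= complex.Im a + s, 2 * e < r & 16 * (1 + nm D) * e <= q]].
  exists (Num.min (Num.min (Num.min (complex.Re w - (complex.Re a - s))
      (complex.Re a + s - complex.Re w)) (Num.min (complex.Im w - (complex.Im a - s))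
      (complex.Im a + s - complex.Im w))) (Num.min (r / 4) (q / (16 * (1 + nm D))))).
  set m := Num.min _ _.
  have : m <= m by []; rewrite {2}/m !le_min.
  move=> /andP[/andP[/andP[m1 m2] /andP[m3 m4]] /andP[m5 m6]].
  split; [|lra|lra|lra|split; [lra|lra|]].
    rewrite /m !lt_min !divr_gt0// ?mulr_gt0//; lra.
  by rewrite mulrC -ler_pdivlMr// mulr_gt0.
rewrite (@sqint_shrink _ _ a w s e)//; last first.
  by move=> z /fhol[D' fD'] /hasd_inv[D'' gD'']; eexists; exact: hasdM fD' gD''.
have xx : complex.Re w - e <= complex.Re w + e by lra.
have yy : complex.Im w - e <= complex.Im w + e by lra.
have in_sq z : sq w e z -> sq a s z by apply: rectW.
have c1 z : sqedge w e z -> contpt (fun z => f z * (z - w)^-1) z.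
  move=> zw; have [D' fD'] := fhol _ (in_sq _ (edge_rect zw)).
  have [D'' gD''] := hasd_inv _ (sqedge_neq e0 zw).
  exact: contpt_hasd (hasdM fD' gD'').
have c2 z : sqedge w e z -> contpt (fun z => (z - w)^-1) z.
  by move=> zw; apply: contpt_inv; exact: sqedge_neq zw.
have c3 z : sqedge w e z -> contpt (fun z => f w * (z - w)^-1) z.
  move=> zw; have [D'' gD''] := hasd_inv _ (sqedge_neq e0 zw).
  exact: contpt_hasd (hasdM (@hasd_cst _ _ (f w) z) gD'').
have c4 z : sqedge w e z -> contpt (fun z => f z * (z - w)^-1 - f w * (z - w)^-1) z.
  move=> zw; have [D' fD'] := fhol _ (in_sq _ (edge_rect zw)).
  have [D'' gD''] := hasd_inv _ (sqedge_neq e0 zw).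
  exact: contpt_hasd (hasdB (hasdM fD' gD'') (hasdM (@hasd_cst _ _ (f w) z) gD'')).
rewrite -(sqint_inv w e0) mulrC -(rintZ (f w) xx yy c2) -(rintB xx yy c1 c3).
apply: (le_trans (@nm_rint _ _ _ _ _ _ (1 + nm D) xx yy c4 _)); last lra.
move=> z zw; have zw0 : z - w != 0 by rewrite subr_eq0 (sqedge_neq e0 zw).
rewrite -mulrBl nmM nmV ler_pdivrMr ?nm_gt0//.
have zr : nm (z - w) < r.
  apply: le_lt_trans er; have := edge_rect zw; rewrite /rect => H.
  have := nm_le_ReIm (z - w); rewrite ReB ImB => /le_trans; apply.
  have : `|complex.Re z - complex.Re w| <= e by rewrite ler_norml; lra.
  have : `|complex.Im z - complex.Im w| <= e by rewrite ler_norml; lra.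
  lra.
have := rP _ zr; rewrite [w + _]addrC subrK mul1r => H.
have := nm_le_sub (f z - f w) ((z - w) *: D); rewrite nmZ => H'.
rewrite mulrDl mul1r -lerBlDr [nm D * _]mulrC.
exact: le_trans H' H.
Qed.

Lemma sq_disc a r z : 0 < r -> sq a (r / 2) z -> nm (z - a) < r.
Proof.
move=> r0; rewrite /sq /rect => H.
rewrite -(@ltr_pXn2r _ 2)// ?nnegrE ?nm_ge0 ?ltW// nm_sqr ReB ImB; nra.
Qed.

Lemma sqedge_far a s z : sqedge a s z -> 0 < s -> s <= nm (z - a).
Proof.
move=> [_ h] s0; have := nm_Re (z - a); have := nm_Im (z - a); rewrite ReB ImB.
have := ler_norm (complex.Re z - complex.Re a).
have := ler_norm (complex.Im z - complex.Im a).
have := ler_norm (- (complex.Re z - complex.Re a)).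
have := ler_norm (- (complex.Im z - complex.Im a)).
rewrite !normrN; case: h => ->; lra.
Qed.

(** With [p = z - a] and [q = z - w], one step of the expansion of [1 / (z - w)]
    in powers of [(w - a) / (z - a)]. *)
Lemma geometric_step (F : fieldType) (v u p q : F) : p != 0 -> q != 0 ->
  v * (u * q^-1) - (p - q) * (v * (u * p^-1 * q^-1)) = v * (u * p^-1).
Proof. by move=> p0 q0; field; rewrite p0 q0. Qed.

(** Finite Taylor expansions with remainders that stay bounded up to a smaller
    disc: this form is closed under pointwise limits, so it replaces power
    series below. *)
Theorem taylor f a r M : 0 < r ->
  (forall z, nm (z - a) < r -> exists D, hasd f z D) ->
  (forall z, nm (z - a) < r -> nm (f z) <= M) ->
  exists (c : nat -> C) (rem : nat -> C -> C), forall w, nm (w - a) < r / 4 ->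
    rem 0%N w = f w /\ forall n, rem n w = c n + (w - a) * rem n.+1 w /\
      nm (rem n w) <= 8 * M * (2 / r) ^+ n.
Proof.
move=> r0 fhol fM; pose s := r / 2; have s0 : 0 < s by rewrite divr_gt0.
pose k : C := (2 * pi)%:C * ii R.
have kE : nm k = 2 * pi.
  by rewrite nmM nm_ii mulr1 nmR ger0_norm// mulr_ge0// pi_ge0.
have k0 : k != 0 by rewrite -nm_gt0 kE mulr_gt0 ?pi_gt0.
pose F n w z := f z * ((z - a)^-1 ^+ n * (z - w)^-1).
pose G n z := f z * (z - a)^-1 ^+ n.+1.
exists (fun n => k^-1 * sqint (G n) a s), (fun n w => k^-1 * sqint (F n w) a s).
move=> w wr.
have xx : complex.Re a - s <= complex.Re a + s by lra.
have yy : complex.Im a - s <= complex.Im a + s by lra.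
have wre := nm_Re (w - a); have wim := nm_Im (w - a).
rewrite ReB ler_norml in wre; rewrite ImB ler_norml in wim.
have hasd_inv u z : z != u -> exists D, hasd (fun z => (z - u)^-1) z D.
  move=> zu; have h := hasdB (hasd_id z) (@hasd_cst _ _ u z).
  by eexists; apply: (hasdV h); rewrite subr_eq0.
have edge_a z : sqedge a s z -> z != a by exact: sqedge_neq.
have far_w z : sqedge a s z -> r / 4 <= nm (z - w).
  move=> /sqedge_far/(_ s0); have := nm_tri w z a; rewrite /s.
  move: wr; lra.
have edge_w z : sqedge a s z -> z != w.
  move=> /far_w; apply: contraTneq => ->; rewrite subrr nm0 -ltNge divr_gt0//.
have edge_r z : sqedge a s z -> nm (z - a) < r.
  by move=> /edge_rect; exact: sq_disc.
have hasd_pow n z : z != a -> exists D, hasd (fun z => (z - a)^-1 ^+ n) z D.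
  move=> za; elim: n => [|n [D IH]].
    by exists 0; apply: (hasd_ext _ (@hasd_cst R C (1 : C) z)); apply: (filterE (F := nbhs z)).
  have [D' h] := hasd_inv _ _ za; eexists; apply: (hasd_ext _ (hasdM h IH)).
  by apply: (filterE (F := nbhs z)) => y; rewrite exprS.
have Gc n z : sqedge a s z -> contpt (G n) z.
  move=> ze; have [D fD] := fhol z (edge_r _ ze).
  have [D' gD] := hasd_pow n.+1 z (edge_a _ ze); exact: contpt_hasd (hasdM fD gD).
have Fc n z : sqedge a s z -> contpt (F n w) z.
  move=> ze; have [D fD] := fhol z (edge_r _ ze).
  have [D' gD] := hasd_pow n z (edge_a _ ze).
  have [D'' hD] := hasd_inv w z (edge_w _ ze).
  exact: contpt_hasd (hasdM fD (hasdM gD hD)).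
have wFc n z : sqedge a s z -> contpt (fun z => (w - a) * F n w z) z.
  move=> ze; have [D fD] := fhol z (edge_r _ ze).
  have [D' gD] := hasd_pow n z (edge_a _ ze).
  have [D'' hD] := hasd_inv w z (edge_w _ ze).
  exact: contpt_hasd (hasdM (@hasd_cst _ _ (w - a) z) (hasdM fD (hasdM gD hD))).
split.
  rewrite /F /sqint (@rint_ext _ _ (fun z => f z * (z - w)^-1))//; last first.
    by move=> z _; rewrite expr0 mul1r.
  rewrite -/(sqint _ a s) cauchy_formula ?mulKf//; try (rewrite /s; lra).
  by move=> z /(sq_disc r0); exact: fhol.
move=> n; split.
  rewrite mulrCA -mulrDr; congr (_ * _).
  rewrite -[(w - a) * _](rintZ (w - a) xx yy (Fc n.+1)).
  apply/eqP; rewrite -subr_eq; apply/eqP.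
  rewrite -(rintB xx yy (Fc n) (wFc n.+1)).
  apply: rint_ext => // z ze; rewrite /G /F.
  have za := edge_a _ ze; have zw := edge_w _ ze.
  rewrite exprSr (_ : w - a = (z - a) - (z - w)); last first.
    by rewrite opprB [RHS]addrC addrA subrK.
  by apply: geometric_step; rewrite subr_eq0.
rewrite nmM nmV kE.
have Fb z : sqedge a s z -> nm (F n w z) <= M * ((2 / r) ^+ n * (4 / r)).
  move=> ze; rewrite !nmM nmX !nmV.
  apply: ler_pM; rewrite ?nm_ge0 ?fM ?edge_r//.
    by rewrite mulr_ge0 ?exprn_ge0 ?invr_ge0 ?nm_ge0.
  apply: ler_pM; rewrite ?exprn_ge0 ?invr_ge0 ?nm_ge0//.
    apply: lerXn2r; rewrite ?nnegrE ?invr_ge0 ?nm_ge0 ?divr_ge0 ?(ltW r0)//.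
    have -> : 2 / r = s^-1 by rewrite invf_div.
    by rewrite lef_pV2 ?posrE ?nm_gt0 ?subr_eq0 ?edge_a// sqedge_far.
  have -> : 4 / r = (r / 4)^-1 by rewrite invf_div.
  by rewrite lef_pV2 ?posrE ?nm_gt0 ?subr_eq0 ?edge_w ?far_w// divr_gt0.
rewrite mulrC ler_pdivrMr ?mulr_gt0 ?pi_gt0//.
apply: (le_trans (nm_rint xx yy (Fc n) Fb)).
have -> : 4 * (M * ((2 / r) ^+ n * (4 / r))) *
   (complex.Re a + s - (complex.Re a - s) + (complex.Im a + s - (complex.Im a - s))) =
   32 * (M * (2 / r) ^+ n).
  rewrite /s; move: ((2 / r) ^+ n) => p; field; exact: lt0r_neq0.
rewrite -mulrA; have : 0 <= M * (2 / r) ^+ n.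
  rewrite mulr_ge0 ?exprn_ge0 ?divr_ge0 ?(ltW r0)//.
  by apply: le_trans (fM a _); rewrite ?nm_ge0 ?subrr ?nm0.
have := @pi_ge2 R; move: (M * _) => m; nra.
Qed.

End Taylor.

Section Primitive.
Variable R : realType.
Local Notation C := R[i].
Implicit Types (f : C -> C) (b c d e s t u v x y : R) (a z w k : C).

Lemma cint_increment (g : R -> C) b c u v k e : path_continuous g b c ->
  b <= u <= c -> b <= v <= c ->
  (forall t, (u <= t <= v) || (v <= t <= u) -> nm (g t - k) <= e) ->
  nm (cint b v g - cint b u g - (v - u)%:C * k) <= 2 * e * `|v - u|.
Proof.
move=> gc; wlog uv : u v / u <= v => [wl|] ub vb gk.
  have [/wl|/ltW vu] := leP u v; first exact.
  have H : nm (cint b u g - cint b v g - (u - v)%:C * k) <= 2 * e * `|u - v|.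
    by apply: wl => // t; rewrite orbC; exact: gk.
  rewrite distrC -nmN; congr (nm _ <= _): H.
  rewrite -(opprB u v) rmorphN /= mulNr.
  by move: (cint _ _ _) (cint _ _ _) (_%:C) => *; ring.
have gcv : path_continuous g b v by move=> t tP; apply: gc; lra.
have guv : path_continuous g u v by move=> t tP; apply: gc; lra.
have kc := @path_continuous_cst R k u v.
rewrite (cint_cat _ uv gcv); last lra.
rewrite [cint b u g + _]addrC addrK -(cint_cst k uv) -cintB// ger0_norm ?subr_ge0//.
apply: nm_cint => //; last by move=> t tP; apply: gk; rewrite tP.
move=> t tP q q0; have [r r0 rP] := guv t tP q q0; exists r => // w wr.
by rewrite opprB addrA subrK rP.
Qed.

(** The primitive is the integral from a corner of a square along a path with one
    horizontal and one vertical leg.  By Goursat's theorem the order of the legs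
    does not matter, so horizontal and vertical increments are both integrals of
    [f] over short segments. *)
Theorem primitive f a r : 0 < r ->
  (forall z, nm (z - a) < r -> exists D, hasd f z D) ->
  exists F, forall z, nm (z - a) < r / 2 -> hasd F z (f z).
Proof.
move=> r0 fhol; pose s := r / 2; have s0 : 0 < s by rewrite divr_gt0.
pose x0 := complex.Re a - s; pose x1 := complex.Re a + s.
pose y0 := complex.Im a - s; pose y1 := complex.Im a + s.
have hol z : rect x0 x1 y0 y1 z -> exists D, hasd f z D.
  by move=> /(sq_disc r0); exact: fhol.
have cont z : rect x0 x1 y0 y1 z -> contpt f z.
  by move=> /hol[D /contpt_hasd].
have hc y b c : y0 <= y <= y1 -> x0 <= b -> c <= x1 ->
    path_continuous (fun x => f (Complex x y)) b c.
  by move=> yP xb cx; apply: hcont => x xP; apply: cont; rewrite /rect /= yP andbT; lra.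
have vc x b c : x0 <= x <= x1 -> y0 <= b -> c <= y1 ->
    path_continuous (fun y => f (Complex x y)) b c.
  by move=> xP yb cy; apply: vcont => y yP; apply: cont; rewrite /rect /= xP /=; lra.
pose F z := hint f y0 x0 (complex.Re z) + ii R * vint f (complex.Re z) y0 (complex.Im z).
have F2 x y : x0 <= x <= x1 -> y0 <= y <= y1 ->
    F (Complex x y) = hint f y x0 x + ii R * vint f x0 y0 y.
  move=> xP yP; have : rint f x0 x y0 y = 0.
    apply: goursat; [lra|lra|] => z; rewrite /rect => zr; apply: hol.
    by rewrite /rect; lra.
  rewrite /rint /F /=; move: (hint _ _ _ _) (hint _ _ _ _) (vint _ _ _ _) (vint _ _ _ _).
  move: (ii R) => j h h' v v' /eqP; rewrite mulrBr addrACA -opprD subr_eq0.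
  by move/eqP.
exists F => z; rewrite -/s => zs e e0.
have e4 : 0 < e / 4 by rewrite divr_gt0.
have inside w : nm (w - a) < s -> (x0 <= complex.Re w <= x1) /\ (y0 <= complex.Im w <= y1).
  move=> ws; have := nm_Re (w - a); have := nm_Im (w - a).
  rewrite ReB ImB !ler_norml /x0 /x1 /y0 /y1; lra.
have [zx zy] := inside z zs.
have /cvg_nm/(_ _ e4)/nbhs_nm[d d0 dP] : contpt f z by apply: cont; rewrite /rect zx zy.
exists (Num.min (d / 2) (s - nm (z - a))); first by rewrite lt_min divr_gt0// subr_gt0.
move=> h; rewrite lt_min => /andP[hd hs].
have [wx wy] : (x0 <= complex.Re (z + h) <= x1) /\ (y0 <= complex.Im (z + h) <= y1).
  by apply: inside; rewrite addrAC; have := nmD (z - a) h; lra.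
case: z h zs zx zy dP hd hs wx wy => x y [p q] zs /= zx zy dP hd hs wx wy.
have hp : `|p| <= nm (Complex p q) := nm_Re (Complex p q).
have hq : `|q| <= nm (Complex p q) := nm_Im (Complex p q).
have -> : Complex x y + Complex p q = Complex (x + p) (y + q) by [].
pose k := f (Complex x y).
have -> : F (Complex (x + p) (y + q)) - F (Complex x y) - Complex p q *: f (Complex x y) =
    (hint f (y + q) x0 (x + p) - hint f (y + q) x0 x - (x + p - x)%:C * k) +
    ii R * (vint f x y0 (y + q) - vint f x y0 y - (y + q - y)%:C * k).
  have -> : F (Complex (x + p) (y + q)) - F (Complex x y) =
     (F (Complex (x + p) (y + q)) - F (Complex x (y + q))) +
     (F (Complex x (y + q)) - F (Complex x y)) by rewrite addrA subrK.
  rewrite (F2 (x + p) (y + q))// {1}(F2 x (y + q))// /F /=.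
  rewrite (_ : Complex p q *: f (Complex x y) =
    (x + p - x)%:C * k + ii R * (y + q - y)%:C * k); last first.
    rewrite -mulrDl; congr (_ * _); congr Complex; ring.
  move: (hint _ _ _ _) (hint _ _ _ _) (hint _ _ _ _).
  move: (vint _ _ _ _) (vint _ _ _ _) (vint _ _ _ _) (ii R) k (_%:C) (_%:C).
  by move=> *; ring.
have near t t' : `|t - x| <= `|p| -> `|t' - y| <= `|q| ->
    nm (f (Complex t t') - k) <= e / 4.
  move=> tx ty; apply/ltW/dP; apply: (le_lt_trans (nm_Complex _ _ _ _)); lra.
apply: (le_trans (nmD _ _)); rewrite nmM nm_ii mul1r.
have H1 := @cint_increment _ x0 x1 x (x + p) k (e / 4)
  (hc (y + q) x0 x1 wy (lexx _) (lexx _)) zx wx.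
have H2 := @cint_increment _ y0 y1 y (y + q) k (e / 4)
  (vc x y0 y1 zx (lexx _) (lexx _)) zy wy.
apply: (@le_trans _ _ (2 * (e / 4) * `|p| + 2 * (e / 4) * `|q|)).
  apply: lerD.
    rewrite [X in _ * `|X|](_ : p = x + p - x); last by ring.
    apply: H1 => t tP; apply: near; last by rewrite addrAC subrr add0r.
    by rewrite ler_norml; have := ler_norm p; have := ler_norm (- p); rewrite normrN; lra.
  rewrite [X in _ * `|X|](_ : q = y + q - y); last by ring.
  apply: H2 => t tP; apply: near; first by rewrite subrr normr0.
  by rewrite ler_norml; have := ler_norm q; have := ler_norm (- q); rewrite normrN; lra.
have := ler_wpM2l (ltW e4) hp; have := ler_wpM2l (ltW e4) hq; lra.
Qed.

End Primitive.

(** * Holomorphic functions with values in a complete space *)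

Section SequentialCompleteness.
Variable R : realType.
Local Notation C := R[i].

Definition tends (X : normedModType C) (u : nat -> X) (l : X) :=
  forall e : R, 0 < e -> exists N, forall n, (N <= n)%N -> nm (u n - l) <= e.

Definition seq_complete (X : normedModType C) := forall u : nat -> X,
  (forall e : R, 0 < e -> exists N, forall m n, (N <= m)%N -> (N <= n)%N ->
    nm (u m - u n) <= e) -> exists l, tends u l.

Lemma complete_seq_complete (X : completeNormedModType C) : seq_complete X.
Proof.
move=> u uC; have /cauchy_cvgP/cvg_ex[l ul] : cauchy (u @ \oo).
  apply/cauchy_exP => e e0.
  have eE : (complex.Re e)%:C = e by rewrite RRe_real// gtr0_real.
  have re0 : 0 < complex.Re e by rewrite -(ltcR 0) eE.
  have [N NP] := uC _ (divr_gt0 re0 (ltr0n _ 2)).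
  exists (u N); exists N => // n /= Nn; rewrite -ball_normE /ball_ /= -nmE -eE ltcR.
  by rewrite (le_lt_trans (NP _ _ _ _))// ltr_pdivrMr// ltr_pMr// ltr1n.
exists l => e e0; move/cvg_nm: ul => /(_ _ e0)[N _ NP].
by exists N => n Nn; apply/ltW/NP.
Qed.

Lemma complex_complete : seq_complete (C : normedModType C).
Proof.
move=> u uC.
have part (p : C -> R) : (forall z w, `|p z - p w| <= nm (z - w)) ->
    exists l : R, forall e, 0 < e -> exists N, forall n, (N <= n)%N -> `|p (u n) - l| <= e.
  move=> pL; have /cauchy_cvgP/cvg_ex[l ul] : cauchy ((p \o u) @ \oo).
    apply/cauchy_exP => e e0; have [N NP] := uC _ (divr_gt0 e0 (ltr0n _ 2)).
    exists (p (u N)); exists N => // n /= Nn; rewrite /ball /=.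
    apply: (le_lt_trans (pL _ _)); apply: (le_lt_trans (NP _ _ _ _)) => //.
    by rewrite ltr_pdivrMr// ltr_pMr// ltr1n.
  exists l => e e0; move/(@cvgrPdist_lt _ R): ul => /(_ _ e0)[N _ NP].
  by exists N => n Nn; rewrite distrC; apply/ltW/NP.
have [x xP] := part _ (@Re_lip R); have [y yP] := part _ (@Im_lip R).
exists (Complex x y) => e e0; have e2 : 0 < e / 2 by rewrite divr_gt0.
have [N NP] := xP _ e2; have [N' NP'] := yP _ e2.
exists (maxn N N') => n; rewrite geq_max => /andP[/NP h /NP' h'].
apply: (le_trans (nm_le_ReIm _)); rewrite ReB ImB /=; lra.
Qed.

Lemma nm_bop (K : normedModType C) (A : bop K) x : nm (A x) <= nm A * nm x.
Proof. by rewrite -lecR rmorphM /= !nmE opnormP. Qed.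

Lemma nm_bop_le (K : normedModType C) (A : bop K) (M : R) : 0 <= M ->
  (forall x, nm (A x) <= M * nm x) -> nm A <= M.
Proof.
move=> M0 AM; apply: opnorm_le => // x.
by rewrite -!nmE -rmorphM lecR.
Qed.

Lemma bopB (K : normedModType C) (A B : bop K) x : (A - B) x = A x - B x.
Proof. by []. Qed.

Lemma tends_unique (X : normedModType C) (u : nat -> X) l l' :
  tends u l -> tends u l' -> l = l'.
Proof.
move=> ul ul'; apply/eqP; rewrite -subr_eq0 -nm_le0; apply/ler_addgt0Pr => e e0.
have e2 : 0 < e / 2 by rewrite divr_gt0.
have [N NP] := ul _ e2; have [N' NP'] := ul' _ e2.
have := NP (maxn N N'); have := NP' (maxn N N').
rewrite leq_maxl leq_maxr => /(_ isT) h' /(_ isT) h.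
by rewrite add0r (le_trans (nm_tri (u (maxn N N')) _ _))// nm_distC; lra.
Qed.

Lemma tendsD (X : normedModType C) (u v : nat -> X) l l' :
  tends u l -> tends v l' -> tends (fun n => u n + v n) (l + l').
Proof.
move=> ul vl e e0; have e2 : 0 < e / 2 by rewrite divr_gt0.
have [N NP] := ul _ e2; have [N' NP'] := vl _ e2.
exists (maxn N N') => n; rewrite geq_max => /andP[/NP h /NP' h'].
by rewrite opprD addrACA (le_trans (nmD _ _))//; lra.
Qed.

Lemma tendsZ (X : normedModType C) (u : nat -> X) l (a : C) :
  tends u l -> tends (fun n => a *: u n) (a *: l).
Proof.
move=> ul e e0; have a0 : 0 < 1 + nm a by rewrite ltr_wpDr ?nm_ge0.
have [N NP] := ul _ (divr_gt0 e0 a0); exists N => n /NP.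
rewrite -scalerBr nmZ ler_pdivlMr// => h; have := nm_ge0 (u n - l); nra.
Qed.

Lemma tends_nm_le (X : normedModType C) (u : nat -> X) l (M : R) :
  tends u l -> (forall n, nm (u n) <= M) -> nm l <= M.
Proof.
move=> ul uM; apply/ler_addgt0Pr => e e0; have [N /(_ N (leqnn N)) h] := ul _ e0.
have := nm_le_sub l (u N); rewrite nm_distC; have := uM N; lra.
Qed.

(** The limit is taken pointwise; it is linear and, by the uniform estimates,
    bounded and a limit in the operator norm. *)
Lemma bop_complete (K : completeNormedModType C) : seq_complete (bop K).
Proof.
move=> u uC; have ux x : exists l, tends (fun n => u n x) l.
  apply: complete_seq_complete => e e0; have x0 : 0 < 1 + nm x by rewrite ltr_wpDr ?nm_ge0.
  have [N NP] := uC _ (divr_gt0 e0 x0); exists N => m n Nm Nn.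
  rewrite -bopB (le_trans (nm_bop _ _))//; have := NP m n Nm Nn.
  rewrite ler_pdivlMr//; have := nm_ge0 (u m - u n); nra.
have /choice[l lP] := ux.
have ll : linear l.
  move=> a x y; apply: (tends_unique (lP _)).
  have := tendsD (tendsZ a (lP x)) (lP y); congr tends; apply/funext => n.
  by rewrite linearP.
pose L : {linear K -> K} := HB.pack l (GRing.isLinear.Build _ _ _ _ l ll).
have close e : 0 < e -> exists N, forall n, (N <= n)%N ->
    forall x, nm (u n x - l x) <= e * nm x.
  move=> e0; have [N NP] := uC _ e0; exists N => n Nn x.
  rewrite nm_distC; have h : tends (fun m => u (m + N)%N x - u n x) (l x - u n x).
    move=> d d0; have [N' NP'] := lP x d d0; exists N' => m N'm.
    rewrite opprB addrA subrK; apply: NP'.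
    by rewrite (leq_trans N'm)// leq_addr.
  apply: (tends_nm_le h) => m; rewrite -bopB (le_trans (nm_bop _ _))//.
  by rewrite ler_wpM2r ?nm_ge0// NP// leq_addl.
have lc : continuous l.
  apply: (@bounded_linear_continuous _ _ _ L); apply/linear_boundedP.
  have [N /(_ N (leqnn N)) NP] := close 1 ltr01.
  have lb x : nm (l x) <= (1 + nm (u N)) * nm x.
    have := NP x; rewrite nm_distC; have := nm_le_sub (l x) (u N x).
    have := nm_bop (u N) x; lra.
  near=> r => x.
  rewrite -!nmE (@le_trans _ _ ((1 + nm (u N)) * nm x)%:C) ?lecR ?lb//.
  rewrite rmorphM /= ler_wpM2r ?ler0c ?nm_ge0//.
  near: r; apply: nbhs_pinfty_ge; rewrite ger0_real// ler0c.
  by rewrite addr_ge0 ?nm_ge0.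
exists (Bop ll lc) => e e0; have [N NP] := close e e0.
by exists N => n Nn; apply: nm_bop_le; [exact: ltW|exact: NP].
Unshelve. all: by end_near. Qed.

End SequentialCompleteness.

Section VectorValued.
Variable R : realType.
Local Notation C := R[i].

(** Functionals of norm at most one that together recover the norm: an estimate
    for vector-valued functions that is linear in the function follows from the
    scalar one. *)
Definition norming (X : normedModType C) (L : set (X -> C)) :=
  (forall l, L l -> linear l /\ forall x, nm (l x) <= nm x) /\
  forall x (M : R), 0 <= M -> (forall l, L l -> nm (l x) <= M) -> nm x <= M.

Definition slope (X : normedModType C) (f : C -> X) (a h : C) :=
  h^-1 *: (f (a + h) - f a).

Definition weakly_holomorphic (X : normedModType C) (L : set (X -> C))
    (f : C -> X) (D : set C) :=
  forall l, L l -> forall z, D z -> exists d, hasd (l \o f) z d.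

Lemma norming_id : norming [set (id : C -> C)].
Proof. by split=> [_ ->|x M M0 /(_ id erefl)]. Qed.

Lemma linear_slope (X : normedModType C) (l : X -> C) (f : C -> X) a h :
  linear l -> l (slope f a h) = slope (l \o f) a h.
Proof.
move=> ll; pose f' : {linear X -> C} := HB.pack l (GRing.isLinear.Build _ _ _ _ l ll).
by rewrite /slope -[l]/(f' : X -> C) linearZ linearB.
Qed.

Lemma linear_sub (X : normedModType C) (l : X -> C) x y :
  linear l -> l (x - y) = l x - l y.
Proof.
move=> ll; pose f' : {linear X -> C} := HB.pack l (GRing.isLinear.Build _ _ _ _ l ll).
by rewrite -[l]/(f' : X -> C) linearB.
Qed.

Lemma weakly_holomorphicW (X : normedModType C) (L : set (X -> C)) (f : C -> X)
    (D : set C) : norming L -> (forall z, D z -> exists d, hasd f z d) ->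
  weakly_holomorphic L f D.
Proof.
move=> [Ll _] fD l /Ll[ll lM] z /fD[d fd]; exists (l d).
by apply: hasd_linear => //; exists 1 => // x; rewrite mul1r.
Qed.

(** By the Taylor expansion of order two, a difference quotient differs from the
    derivative by a bounded multiple of the increment.  Comparing two quotients
    avoids naming the derivative: the estimate is stable under pointwise limits
    and, in a complete space, implies differentiability. *)
Lemma slope_lipschitz_scalar (f : C -> C) a (r M : R) : 0 < r ->
  (forall z, nm (z - a) < r -> exists d, hasd f z d) ->
  (forall z, nm (z - a) < r -> nm (f z) <= M) ->
  forall h k, h != 0 -> k != 0 -> nm h < r / 4 -> nm k < r / 4 ->
  nm (slope f a h - slope f a k) <= 8 * M * (2 / r) ^+ 2 * (nm h + nm k).
Proof.
move=> r0 fhol fM; have [c [rem remP]] := taylor r0 fhol fM.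
have r4 : 0 < r / 4 by rewrite divr_gt0.
have ar : nm (a - a) < r / 4 by rewrite subrr nm0.
have [fa /(_ 0%N)[c0 _]] := remP _ ar.
rewrite subrr mul0r addr0 in c0.
have E h : h != 0 -> nm h < r / 4 -> exists2 q, nm q <= 8 * M * (2 / r) ^+ 2 &
    slope f a h = c 1%N + h * q.
  move=> h0 hr; have hE : a + h - a = h by rewrite addrAC subrr add0r.
  have := remP (a + h); rewrite hE => /(_ hr)[fh' remh].
  exists (rem 2%N (a + h)); first by have [_] := remh 2%N.
  rewrite /slope -fh' -fa c0 (remh 0%N).1 (remh 1%N).1.
  by rewrite [c 0%N + _]addrC addrK /GRing.scale /= mulKf.
move=> h k h0 k0 hr kr; have [q qB ->] := E h h0 hr; have [p pB ->] := E k k0 kr.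
rewrite opprD addrACA subrr add0r (le_trans (nmB _ _))// !nmM mulrDr.
by rewrite [X in _ <= X + _]mulrC [X in _ <= _ + X]mulrC lerD// ler_wpM2l// nm_ge0.
Qed.

Lemma slope_lipschitz (X : normedModType C) (L : set (X -> C)) (f : C -> X) a (r M : R) :
  norming L -> 0 < r ->
  weakly_holomorphic L f [set z | nm (z - a) < r] ->
  (forall z, nm (z - a) < r -> nm (f z) <= M) ->
  forall h k, h != 0 -> k != 0 -> nm h < r / 4 -> nm k < r / 4 ->
  nm (slope f a h - slope f a k) <= 8 * M * (2 / r) ^+ 2 * (nm h + nm k).
Proof.
move=> [Ll Ln] r0 fh fM h k h0 k0 hr kr; apply: Ln.
  rewrite !mulr_ge0 ?exprn_ge0 ?divr_ge0 ?addr_ge0 ?nm_ge0 ?invr_ge0 ?(ltW r0)//.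
  by apply: le_trans (fM a _); rewrite ?nm_ge0// subrr nm0.
move=> l lL; have [ll lM] := Ll l lL.
rewrite linear_sub// (linear_slope f a h ll) (linear_slope f a k ll).
apply: (@slope_lipschitz_scalar (l \o f) a r M) => // z zr; first exact: fh.
exact: le_trans (lM _) (fM _ zr).
Qed.

Lemma ex_small (r : R) : 0 < r ->
  exists u : nat -> C, (forall n, u n != 0 /\ nm (u n) < r) /\ tends u 0.
Proof.
move=> r0; exists (fun n => (r / 2 / 2 ^+ n)%:C); split.
  move=> n; have h : 0 < r / 2 / 2 ^+ n by rewrite !divr_gt0// exprn_gt0.
  split; first by rewrite -nm_gt0 nmR gtr0_norm.
  rewrite nmR gtr0_norm// ltr_pdivrMr ?exprn_gt0//.
  have : 1 <= (2 : R) ^+ n by rewrite exprn_ege1// ler1n.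
  move: (2 ^+ n) => t; nra.
move=> e e0; have [N NP] := pow2_small (r / 2) e0; exists N => n Nn.
rewrite subr0 nmR ger0_norm; last by rewrite !divr_ge0 ?exprn_ge0// ltW.
apply: le_trans (ltW NP); rewrite ler_wpM2l ?divr_ge0 ?(ltW r0)//.
by rewrite lef_pV2 ?posrE ?exprn_gt0// ler_weXn2l// ler1n.
Qed.

(** The difference quotients form a Cauchy family as the increment tends to 0. *)
Lemma slope_hasd (X : normedModType C) (f : C -> X) a (r B : R) :
  seq_complete X -> 0 < r -> 0 <= B ->
  (forall h k, h != 0 -> k != 0 -> nm h < r -> nm k < r ->
    nm (slope f a h - slope f a k) <= B * (nm h + nm k)) ->
  exists d, hasd f a d.
Proof.
move=> Xc r0 B0 fB; have [u [uP u0]] := ex_small r0.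
have u_small e : 0 < e -> exists N, forall n, (N <= n)%N -> B * nm (u n) <= e.
  move=> e0; have B1 : 0 < B + 1 by rewrite ltr_wpDl.
  have [N NP] := u0 _ (divr_gt0 e0 B1); exists N => n /NP.
  rewrite subr0 ler_pdivlMr//; have := nm_ge0 (u n); nra.
have [d dP] : exists d, tends (fun n => slope f a (u n)) d.
  apply: Xc => e e0; have [N NP] := u_small _ (divr_gt0 e0 (ltr0n _ 2)).
  exists N => m n /NP hm /NP hn; have [um0 umr] := uP m; have [un0 unr] := uP n.
  by rewrite (le_trans (fB _ _ um0 un0 umr unr))// mulrDr; lra.
have dB h : h != 0 -> nm h < r -> nm (slope f a h - d) <= B * nm h.
  move=> h0 hr; apply/ler_addgt0Pr => e e0; have e2 : 0 < e / 2 by rewrite divr_gt0.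
  have [N NP] := u_small _ e2; have [N' NP'] := dP _ e2.
  have := NP (maxn N N'); have := NP' (maxn N N').
  rewrite leq_maxl leq_maxr => /(_ isT) h1 /(_ isT) h2.
  have [un0 unr] := uP (maxn N N').
  have := fB _ _ h0 un0 hr unr; have := nm_tri (slope f a (u (maxn N N'))) (slope f a h) d.
  rewrite mulrDr; lra.
exists d => e e0; have B1 : 0 < B + 1 by rewrite ltr_wpDl.
exists (Num.min r (e / (B + 1))); first by rewrite lt_min r0 divr_gt0.
move=> h; rewrite lt_min ltr_pdivlMr// => /andP[hr he].
have [->|h0] := eqVneq h 0; first by rewrite addr0 subrr scale0r subrr !nm0 mulr0.
rewrite nm_quotient// mulrC ler_wpM2r ?nm_ge0// (le_trans (dB _ h0 hr))//.
have := nm_ge0 h; nra.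
Qed.

(** The estimate [slope_lipschitz] depends only on a bound of the functions, so it
    passes to the pointwise limit, where [slope_hasd] applies. *)
Lemma hasd_limit (X : normedModType C) (L : set (X -> C)) (u : nat -> C -> X)
    (f : C -> X) a (r M : R) :
  norming L -> seq_complete X -> 0 < r ->
  (forall n z, nm (z - a) < r -> exists d, hasd (u n) z d) ->
  (forall n z, nm (z - a) < r -> nm (u n z) <= M) ->
  (forall z, nm (z - a) < r -> tends (u ^~ z) (f z)) ->
  exists d, hasd f a d.
Proof.
move=> Ln Xc r0 uh uM uf; have r4 : 0 < r / 4 by rewrite divr_gt0.
have aa : nm (a - a) < r by rewrite subrr nm0.
have M0 : 0 <= M by apply: le_trans (nm_ge0 _) (uM 0%N a aa).
have B0 : 0 <= 8 * M * (2 / r) ^+ 2.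
  by rewrite !mulr_ge0 ?exprn_ge0 ?divr_ge0 ?invr_ge0 ?(ltW r0).
apply: (slope_hasd Xc r4 B0) => h k h0 k0 hr kr.
have st t : nm t < r / 4 -> tends (fun n => slope (u n) a t) (slope f a t).
  move=> tr; apply: tendsZ; rewrite -scaleN1r.
  have := tendsD (uf (a + t) _) (tendsZ (-1) (uf a aa)).
  rewrite addrAC subrr add0r => H.
  have {}H : nm t < r -> _ := H; have tr' : nm t < r by lra.
  by have := H tr'; congr tends; apply/funext => n; rewrite scaleN1r.
have := tendsD (st h hr) (tendsZ (-1) (st k kr)).
rewrite scaleN1r => /tends_nm_le; apply => n; rewrite scaleN1r.
exact: (slope_lipschitz Ln r0 (weakly_holomorphicW Ln (uh n)) (uM n)).
Qed.

End VectorValued.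

Section LocalTheory.
Variable R : realType.
Local Notation C := R[i].

Lemma nm_slope (f : C -> C) a (r M : R) : 0 < r ->
  (forall z, nm (z - a) < r -> exists d, hasd f z d) ->
  (forall z, nm (z - a) < r -> nm (f z) <= M) ->
  forall h, h != 0 -> nm h < r / 4 -> nm (slope f a h) <= 8 * M * (2 / r).
Proof.
move=> r0 fhol fM; have [c [rem remP]] := taylor r0 fhol fM.
have r4 : 0 < r / 4 by rewrite divr_gt0.
have ar : nm (a - a) < r / 4 by rewrite subrr nm0.
have [fa /(_ 0%N)[c0 _]] := remP _ ar.
rewrite subrr mul0r addr0 in c0.
move=> h h0 hr; have hE : a + h - a = h by rewrite addrAC subrr add0r.
have := remP (a + h); rewrite hE => /(_ hr)[fh' remh].
have -> : slope f a h = rem 1%N (a + h).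
  by rewrite /slope -fh' -fa c0 (remh 0%N).1 [c 0%N + _]addrC addrK /GRing.scale /= mulKf.
by have [_] := remh 1%N; rewrite expr1.
Qed.

Lemma locally_bounded (X : normedModType C) (f : C -> X) a d (r : R) :
  hasd f a d -> 0 < r ->
  exists2 s : R, 0 < s <= r & forall z, nm (z - a) < s -> nm (f z) <= 1 + nm (f a).
Proof.
move=> /hasd_cvg/cvg_nm/(_ 1 ltr01)/nbhs_nm[s s0 sP] r0.
exists (Num.min s r); first by rewrite lt_min s0 r0 ge_min lexx orbT.
move=> z; rewrite lt_min => /andP[/sP zs _].
have := nm_le_sub (f z) (f a); lra.
Qed.

(** The derivative is the pointwise limit of difference quotients, and these are
    holomorphic and locally bounded. *)
Lemma derivative_holomorphic (f f' : C -> C) a (r : R) : 0 < r ->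
  (forall z, nm (z - a) < r -> hasd f z (f' z)) -> exists d, hasd f' a d.
Proof.
move=> r0 ff'; have aa : nm (a - a) < r by rewrite subrr nm0.
have [s /andP[s0 sr] sM] := locally_bounded (ff' a aa) r0.
pose t := s / 2; have t0 : 0 < t by rewrite divr_gt0.
have t4 : 0 < t / 4 by rewrite divr_gt0.
have [u [uP u0]] := ex_small t4.
have far w z : nm (w - a) < t -> nm (z - w) < t -> nm (z - a) < s.
  by move=> wt zt; have := nm_tri w z a; rewrite /t in wt zt; lra.
apply: (@hasd_limit _ _ [set id] (fun n w => slope f w (u n)) f' a t
  (8 * (1 + nm (f a)) * (2 / t)) (norming_id R) (@complex_complete R) t0).
- move=> n z zt; have [un0 unt] := uP n.
  have zun : nm (z + u n - a) < r.
    by apply: lt_le_trans sr; apply: (far z) => //; rewrite addrAC subrr add0r; lra.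
  have zr : nm (z - a) < r by apply: lt_le_trans sr; rewrite /t in zt; lra.
  have h1 := hasd_shift (ff' _ zun); have h2 := hasdB h1 (ff' _ zr).
  by eexists; exact: (hasdZ (@hasd_cst _ _ ((u n)^-1) z) h2).
- move=> n z zt; have [un0 unt] := uP n; apply: nm_slope => //.
    move=> w wz; exists (f' w); apply: ff'.
    by apply: lt_le_trans sr; exact: (far z).
  by move=> w wz; apply: sM; exact: (far z).
- move=> z zt e e0; have zr : nm (z - a) < r.
    by apply: lt_le_trans sr; rewrite /t in zt; lra.
  have [d d0 dP] := ff' z zr e e0.
  have [N NP] := u0 _ (divr_gt0 d0 (ltr0n _ 2)); exists N => n /NP.
  rewrite subr0 => ud; have [un0 _] := uP n.
  have {}ud : nm (u n) < d by apply: (le_lt_trans ud); rewrite ltr_pdivrMr// ltr_pMr// ltr1n.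
  have := dP _ ud; rewrite nm_quotient// mulrC ler_pM2r ?nm_gt0//.
Qed.

(** The function [(z - a) ^+ 2 * g z], extended by [0], is differentiable at [a]
    as well.  Its Taylor coefficients of order 0 and 1 vanish, and dividing the
    expansion by [(z - a) ^+ 2] gives one of [g]: its constant term [c] is the
    missing value, and its difference quotients are controlled. *)
Lemma removable_scalar (g : C -> C) (a : C) (r M : R) : 0 < r -> 0 <= M ->
  (forall z, z != a -> nm (z - a) < r -> exists d, hasd g z d) ->
  (forall z, z != a -> nm (z - a) < r -> nm (g z) <= M) ->
  exists c : C, (forall h : C, h != 0 -> nm h < r / 4 ->
      nm (g (a + h) - c) <= 8 * (r ^+ 2 * M) * (2 / r) ^+ 3 * nm h) /\
    forall h k : C, h != 0 -> k != 0 -> nm h < r / 4 -> nm k < r / 4 ->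
      nm (h^-1 * (g (a + h) - c) - k^-1 * (g (a + k) - c)) <=
        8 * (r ^+ 2 * M) * (2 / r) ^+ 4 * (nm h + nm k).
Proof.
move=> r0 M0 gh gM; pose f z := if z == a then 0 else (z - a) ^+ 2 * g z.
have fE (h : C) : h != 0 -> f (a + h) = h ^+ 2 * g (a + h).
  move=> h0; rewrite /f [a + h]addrC addrK ifN//.
  by rewrite -subr_eq0 addrK.
have f0 : f a = 0 by rewrite /f eqxx.
have fhol z : nm (z - a) < r -> exists d, hasd f z d.
  move=> zr; have [->|za] := eqVneq z a.
    exists 0 => e e0; exists (Num.min r (e / (M + 1))).
      by rewrite lt_min r0 divr_gt0// ltr_wpDl.
    move=> h; rewrite lt_min ltr_pdivlMr ?ltr_wpDl// => /andP[hr he].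
    rewrite scaler0 subr0 f0 subr0.
    have [->|h0] := eqVneq h 0; first by rewrite addr0 f0 !nm0 mulr0.
    rewrite fE// nmM nmX expr2 -mulrA mulrC ler_wpM2r ?nm_ge0//.
    have ah : a + h != a by rewrite -subr_eq0 addrAC subrr add0r.
    have := gM _ ah; rewrite addrAC subrr add0r => /(_ hr).
    by have := nm_ge0 h; have := nm_ge0 (g (a + h)); nra.
  have [d gd] := gh z za zr.
  have h := hasdB (hasd_id z) (@hasd_cst _ _ a z).
  eexists; apply: (hasd_ext _ (hasdM (hasdM h h) gd)).
  have za0 : 0 < nm (z - a) by rewrite nm_gt0 subr_eq0.
  apply/nbhs_nm; exists (nm (z - a)) => // w wz; rewrite /f expr2 ifN//.
  by apply: contraTneq wz => ->; rewrite nm_distC ltxx.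
have fM z : nm (z - a) < r -> nm (f z) <= r ^+ 2 * M.
  move=> zr; rewrite /f; case: eqVneq => [_|za].
    by rewrite nm0 mulr_ge0// exprn_ge0// ltW.
  rewrite nmM nmX ler_pM ?exprn_ge0 ?nm_ge0 ?gM// lerXn2r ?nnegrE ?nm_ge0 ?ltW//.
have [c [rem remP]] := taylor r0 fhol fM.
have r4 : 0 < r / 4 by rewrite divr_gt0.
have ar : nm (a - a) < r / 4 by rewrite subrr nm0.
have [fa /(_ 0%N)[c0 _]] := remP _ ar.
rewrite subrr mul0r addr0 fa f0 in c0.
have rem1 (h : C) : h != 0 -> nm h < r / 4 -> rem 0%N (a + h) = f (a + h) /\
   forall n, rem n (a + h) = c n + h * rem n.+1 (a + h) /\
      nm (rem n (a + h)) <= 8 * (r ^+ 2 * M) * (2 / r) ^+ n.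
  move=> h0 hr; have hE : a + h - a = h by rewrite addrAC subrr add0r.
  by have := remP (a + h); rewrite hE => /(_ hr).
have hg (h : C) : h != 0 -> nm h < r / 4 -> h * g (a + h) = rem 1%N (a + h).
  move=> h0 hr; have [E /(_ 0%N)[E0 _]] := rem1 h h0 hr.
  move: E; rewrite E0 -c0 add0r fE// expr2 -mulrA => /(mulfI h0) ->//.
have c1 : c 1%N = 0.
  apply/eqP; rewrite -nm_le0; apply/ler_addgt0Pr => e e0; rewrite add0r.
  pose B := 8 * (r ^+ 2 * M) * (2 / r) ^+ 2 + M + 1.
  have B0 : 0 < B.
    by rewrite ltr_wpDl// addr_ge0// !mulr_ge0 ?exprn_ge0 ?divr_ge0 ?invr_ge0 ?(ltW r0).
  have s0 : 0 < Num.min (r / 4) (e / B) by rewrite lt_min r4 divr_gt0.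
  have [u [/(_ 0%N)[h0]]] := ex_small s0; set h := u 0%N in h0 *.
  rewrite lt_min => /andP[hr]; rewrite ltr_pdivlMr// => hB _.
  have [_ remh] := rem1 h h0 hr; have [E _] := remh 1%N; have [_ B2] := remh 2%N.
  have ah : a + h != a by rewrite -subr_eq0 addrAC subrr add0r.
  have gB : nm (g (a + h)) <= M.
    by apply: gM => //; rewrite addrAC subrr add0r; lra.
  rewrite -hg// in E; have -> : c 1%N = h * (g (a + h) - rem 2%N (a + h)).
    by rewrite mulrBr E addrK.
  rewrite nmM; have := nmB (g (a + h)) (rem 2%N (a + h)).
  by have := nm_ge0 h; move: hB; rewrite /B; nra.
have gE (h : C) : h != 0 -> nm h < r / 4 -> g (a + h) = c 2%N + h * rem 3%N (a + h).
  move=> h0 hr; have [_ remh] := rem1 h h0 hr; rewrite -(remh 2%N).1.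
  by apply: (mulfI h0); rewrite hg// (remh 1%N).1 c1 add0r.
exists (c 2%N); split.
  move=> h h0 hr; rewrite gE// [c 2%N + _]addrC addrK nmM mulrC ler_wpM2r ?nm_ge0//.
  by have [_ remh] := rem1 h h0 hr; have [] := remh 3%N.
have E (h : C) : h != 0 -> nm h < r / 4 -> h^-1 * (g (a + h) - c 2%N) = c 3%N + h * rem 4%N (a + h).
  move=> h0 hr; rewrite gE// [c 2%N + _]addrC addrK mulKf//.
  by have [_ remh] := rem1 h h0 hr; rewrite (remh 3%N).1.
move=> h k h0 k0 hr kr; rewrite !E// opprD addrACA subrr add0r.
rewrite (le_trans (nmB _ _))// !nmM mulrDr.
rewrite [X in _ <= X + _]mulrC [X in _ <= _ + X]mulrC.
have [_ remh] := rem1 h h0 hr; have [_ remk] := rem1 k k0 kr.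
by rewrite lerD// ler_wpM2l ?nm_ge0//; [have [] := remh 4%N|have [] := remk 4%N].
Qed.

Lemma tends_linear (X : normedModType C) (l : X -> C) (u : nat -> X) x :
  linear l -> (forall y, nm (l y) <= nm y) -> tends u x -> tends (l \o u) (l x).
Proof.
move=> ll lM ux e e0; have [N NP] := ux e e0; exists N => n /NP; apply: le_trans.
by rewrite /= -linear_sub.
Qed.

(** Riemann's theorem on removable singularities, for functions that are only
    known to be holomorphic through a norming family of functionals. *)
Theorem removable (X : normedModType C) (L : set (X -> C)) (f : C -> X) a (r M : R) :
  norming L -> seq_complete X -> 0 < r -> 0 <= M ->
  weakly_holomorphic L f [set z | z != a /\ nm (z - a) < r] ->
  (forall z, z != a -> nm (z - a) < r -> nm (f z) <= M) ->
  exists2 x, nm x <= M & exists d, hasd (fun z => if z == a then x else f z) a d.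
Proof.
move=> [Ll Ln] Xc r0 M0 fh fM; have r4 : 0 < r / 4 by rewrite divr_gt0.
have ah (h : C) : h != 0 -> a + h != a by move=> ?; rewrite -subr_eq0 addrAC subrr add0r.
have hE (h : C) : a + h - a = h by rewrite addrAC subrr add0r.
have B_ge0 n : 0 <= 8 * (r ^+ 2 * M) * (2 / r) ^+ n.
  by rewrite !mulr_ge0 ?exprn_ge0 ?mulr_ge0 ?invr_ge0 ?(ltW r0).
have lf l : L l -> _ := fun lL => @removable_scalar (l \o f) a r M r0 M0
  (fun z za zr => fh l lL z (conj za zr))
  (fun z za zr => le_trans ((Ll l lL).2 _) (fM z za zr)).
have [u [uP u0]] := ex_small r4.
set B := 8 * (r ^+ 2 * M) in B_ge0 lf.
have [x ux] : exists x, tends (fun n => f (a + u n)) x.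
  apply: Xc => e e0; have B1 : 0 < B * (2 / r) ^+ 3 + 1 by rewrite ltr_wpDl.
  have [N NP] := u0 _ (divr_gt0 e0 (mulr_gt0 (ltr0n _ 2) B1)).
  exists N => m n /NP hm /NP hn; apply: Ln; first exact: ltW.
  move=> l lL; have [ll lM] := Ll l lL; rewrite linear_sub//.
  have [c [cP _]] := lf l lL; have [um0 umr] := uP m; have [un0 unr] := uP n.
  have /= := cP _ um0 umr; have /= := cP _ un0 unr.
  have := nm_tri c (l (f (a + u m))) (l (f (a + u n))).
  rewrite [nm (c - _)]nm_distC.
  move: hm hn; rewrite !subr0 !ler_pdivlMr ?mulr_gt0//.
  have := nm_ge0 (u m); have := nm_ge0 (u n); nra.
exists x.
  apply: (tends_nm_le ux) => n; have [un0 unr] := uP n; apply: fM; first exact: ah.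
  by rewrite hE; lra.
apply: (@slope_hasd _ _ _ a _ (B * (2 / r) ^+ 4) Xc r4) => //.
move=> h k h0 k0 hr kr; rewrite /slope eqxx !ifN ?ah//.
apply: Ln; first by rewrite mulr_ge0// addr_ge0 ?nm_ge0.
move=> l lL; have [ll lM] := Ll l lL; have [c [cP cP']] := lf l lL.
pose l' : {linear X -> C} := HB.pack l (GRing.isLinear.Build _ _ _ _ l ll).
have lx : l x = c.
  apply: (tends_unique (tends_linear ll lM ux)) => e e0.
  have B1 : 0 < B * (2 / r) ^+ 3 + 1 by rewrite ltr_wpDl.
  have [N NP] := u0 _ (divr_gt0 e0 B1); exists N => n /NP.
  rewrite subr0 ler_pdivlMr// => h1; have [un0 unr] := uP n.
  apply: (le_trans (cP _ un0 unr)); have := nm_ge0 (u n); nra.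
have := cP' h k h0 k0 hr kr; congr (nm _ <= _).
by rewrite -lx -[l]/(l' : X -> C) linearB !linearZ !linearB.
Qed.

End LocalTheory.

Section Zeros.
Variable R : realType.
Local Notation C := R[i].

(** If all Taylor coefficients vanish, the remainder bounds force the function to
    vanish near [a]; otherwise the first nonzero coefficient dominates. *)
Lemma zero_dichotomy (f : C -> C) (a : C) (r M : R) : 0 < r ->
  (forall z, nm (z - a) < r -> exists d, hasd f z d) ->
  (forall z, nm (z - a) < r -> nm (f z) <= M) ->
  (exists2 s : R, 0 < s & forall z, nm (z - a) < s -> f z = 0) \/
  (exists2 s : R, 0 < s & forall z, z != a -> nm (z - a) < s -> f z != 0).
Proof.
move=> r0 fhol fM; have [c [rem remP]] := taylor r0 fhol fM.
have r4 : 0 < r / 4 by rewrite divr_gt0.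
have M0 : 0 <= M by apply: le_trans (fM a _); rewrite ?nm_ge0// subrr nm0.
have below N w : (forall n, (n < N)%N -> c n = 0) -> nm (w - a) < r / 4 ->
    f w = (w - a) ^+ N * rem N w.
  move=> cN wr; have [fw remw] := remP w wr; rewrite -fw.
  elim: N cN => [|N IH] cN; first by rewrite expr0 mul1r.
  rewrite IH; last by move=> n nN; apply: cN; rewrite ltnS ltnW.
  by rewrite (remw N).1 cN// add0r mulrA -exprSr.
have [c0|/existsNP ex] := pselect (forall n, c n = 0); [left|right].
  exists (r / 4) => // w wr; apply/eqP; rewrite -nm_le0.
  apply/ler_addgt0Pr => e e0; rewrite add0r.
  have [n nP] := pow2_small (8 * M) e0; apply: le_trans (ltW nP).
  rewrite (below n w)// nmM nmX; have [_ remw] := remP w wr; have [_ B] := remw n.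
  apply: (@le_trans _ _ ((r / 4) ^+ n * (8 * M * (2 / r) ^+ n))).
    rewrite ler_pM ?exprn_ge0 ?nm_ge0//.
    by apply: lerXn2r; rewrite ?nnegrE ?nm_ge0 ?(ltW r4) ?(ltW wr).
  rewrite mulrCA -exprMn (_ : r / 4 * (2 / r) = 2^-1) ?exprVn//.
  by field; exact: lt0r_neq0.
have ex' : exists n, c n != 0 by case: ex => n /eqP; exists n.
case: (ex_minnP ex') => N cN Nmin.
have cN0 n : (n < N)%N -> c n = 0.
  by move=> nN; apply/eqP; apply: contraTT nN => h; rewrite -leqNgt Nmin.
pose B := 8 * M * (2 / r) ^+ N.+1 + 1.
have B0 : 0 < B by rewrite ltr_wpDl// !mulr_ge0 ?exprn_ge0 ?mulr_ge0 ?invr_ge0 ?(ltW r0).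
exists (Num.min (r / 4) (nm (c N) / B)).
  by rewrite lt_min r4 divr_gt0// nm_gt0.
move=> w wa; rewrite lt_min => /andP[wr]; rewrite ltr_pdivlMr// => wB.
rewrite (below N w)// mulf_neq0 ?expf_neq0 ?subr_eq0//.
have [_ remw] := remP w wr; have [-> _] := remw N; have [_ BN] := remw N.+1.
apply: contraTneq wB => /eqP; rewrite addr_eq0 => /eqP ->.
rewrite nmN nmM -leNgt ler_wpM2l ?nm_ge0//; rewrite /B; lra.
Qed.

(** The set on which the function vanishes identically nearby is open, and by
    [zero_dichotomy] it is also closed in the region. *)
Theorem isolated_zeros (Omega : set C) (f : C -> C) z1 :
  open Omega -> connected Omega -> Omega z1 -> f z1 != 0 ->
  (forall z, Omega z -> exists d, hasd f z d) ->
  forall a, Omega a -> exists2 s : R, 0 < s &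
    forall z, z != a -> nm (z - a) < s -> f z != 0.
Proof.
move=> oO cO Oz1 fz1 fhol a Oa.
have disc b : Omega b -> exists2 r : R, 0 < r & forall z, nm (z - b) < r -> Omega z.
  by move=> Ob; have /nbhs_nm[r r0 rP] := open_nbhs_nbhs (conj oO Ob); exists r.
have dich b : Omega b ->
  (exists2 s : R, 0 < s & forall z, nm (z - b) < s -> f z = 0) \/
  (exists2 s : R, 0 < s & forall z, z != b -> nm (z - b) < s -> f z != 0).
  move=> Ob; have [r r0 rO] := disc b Ob; have [d fd] := fhol b Ob.
  have [s /andP[s0 sr] sM] := locally_bounded fd r0.
  apply: (zero_dichotomy s0 _ sM) => z zs; apply: fhol; apply: rO; exact: lt_le_trans sr.
case: (dich a Oa) => // -[s s0 sP]; exfalso.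
pose Z := [set b | Omega b /\ exists2 s : R, 0 < s & forall z, nm (z - b) < s -> f z = 0].
have Zopen : open Z.
  rewrite openE => b [Ob [t t0 tP]]; apply/nbhs_nm.
  have [r r0 rO] := disc b Ob.
  exists (Num.min r (t / 2)); first by rewrite lt_min r0 divr_gt0.
  move=> w; rewrite lt_min => /andP[wr wt]; split; first exact: rO.
  exists (t / 2); first by rewrite divr_gt0.
  by move=> z zw; apply: tP; have := nm_tri w z b; lra.
have ZO : Z = Omega.
  apply: cO; first by exists a; split => //; exists s.
    by exists Z => //; rewrite setIidr// => b [].
  exists (~` [set b | Omega b /\
      exists2 s : R, 0 < s & forall z, z != b -> nm (z - b) < s -> f z != 0]).
    apply: open_closedC; rewrite openE => b [Ob [t t0 tP]]; apply/nbhs_nm.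
    have [r r0 rO] := disc b Ob.
    exists (Num.min r (t / 2)); first by rewrite lt_min r0 divr_gt0.
    move=> w; rewrite lt_min => /andP[wr wt]; split; first exact: rO.
    have [->|wb] := eqVneq w b; first by exists t.
    exists (nm (w - b)); first by rewrite nm_gt0 subr_eq0.
    move=> z zw zwb; apply: tP; last by have := nm_tri w z b; lra.
    by apply: contraTneq zwb => ->; rewrite nm_distC ltxx.
  apply/seteqP; split=> [b [Ob [t t0 tP]]|b [Ob nb]].
    split=> // -[_ [q q0 qP]].
    have m0 : 0 < Num.min t q by rewrite lt_min t0.
    have [u [/(_ 0%N)[u0]]] := ex_small m0; rewrite lt_min => /andP[ut uq] _.
    have ub : b + u 0%N != b by rewrite -subr_eq0 addrAC subrr add0r.
    have hE : b + u 0%N - b = u 0%N by rewrite addrAC subrr add0r.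
    have := qP _ ub; rewrite hE => /(_ uq).
    have := tP (b + u 0%N); rewrite hE => /(_ ut) -> /eqP.
    by apply.
  by split=> //; case: (dich b Ob) => // h; case: nb.
have : Z z1 by rewrite ZO.
move=> [_ [t t0 /(_ z1)]]; rewrite subrr nm0 => /(_ t0) /eqP.
by rewrite (negPf fz1).
Qed.

End Zeros.

(** * Harmonic functions as real parts *)

Section LineDerivatives.
Variable R : realType.
Local Notation C := R[i].
Implicit Types (u v : C -> R) (d z w : C) (t s e D : R).

Lemma is_derive_eps (g : R -> R) (t D : R) : is_derive t 1 g D <->
  forall e, 0 < e -> exists2 r : R, 0 < r & forall h, `|h| < r ->
    `|g (t + h) - g t - h * D| <= e * `|h|.
Proof.
have E h : h%:A + t = t + h :> R by rewrite addrC /GRing.scale/= mulr1.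
split.
  move=> [/cvg_ex[D' gD'] gD]; have DD' : D' = D by rewrite -gD; apply/esym/cvg_lim.
  rewrite {}DD' {gD} in gD' => e e0.
  have H : \forall h \near 0^', `|D - h^-1 *: (g (h%:A + t) - g t)| < e.
    by move: e e0; apply/(@cvgrPdist_lt _ R).
  have {}H : nbhs (0 : R) [set h | h != 0 ->
    `|D - h^-1 *: (g (h%:A + t) - g t)| < e] := H.
  move/nbhs_ballP: H => [r /= r0 rP].
  exists r => // h hr; have [->|h0] := eqVneq h 0.
    by rewrite addr0 mul0r !subrr !normr0 mulr0.
  have := rP h; rewrite /ball /= sub0r normrN => /(_ hr h0) /ltW.
  rewrite E distrC -(@ler_pM2r _ `|h|) ?normr_gt0// -normrM mulrBl.
  by rewrite /GRing.scale /= mulrAC mulVf// mul1r [D * h]mulrC.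
move=> gD; have gc : h^-1 *: (g (h%:A + t) - g t) @[h --> 0^'] --> D.
  apply/(@cvgrPdist_lt _ R) => e e0.
  have [r r0 rP] := gD _ (divr_gt0 e0 (ltr0n _ 2)).
  apply/nbhs_ballP; exists r => // h; rewrite /ball /= sub0r normrN => hr h0.
  rewrite E distrC -(@ltr_pM2r _ `|h|) ?normr_gt0// -normrM mulrBl.
  rewrite /GRing.scale /= mulrAC mulVf// mul1r [D * h]mulrC.
  apply: (le_lt_trans (rP h hr)); rewrite ltr_pM2r ?normr_gt0//.
  by rewrite ltr_pdivrMr// ltr_pMr// ltr1n.
by split; [apply/cvg_ex; exists D|exact: cvg_lim].
Qed.

Definition hasl u d z D := forall e, 0 < e -> exists2 r : R, 0 < r &
  forall h : R, `|h| < r -> `|u (z + h%:C * d) - u z - h * D| <= e * `|h|.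

Lemma is_derive_line u d z t D :
  is_derive t 1 (fun s => u (z + s%:C * d)) D <-> hasl u d (z + t%:C * d) D.
Proof.
rewrite is_derive_eps /hasl; split=> H e /H[r r0 rP]; exists r => // h /rP;
  by rewrite rmorphD mulrDl addrA.
Qed.

Lemma hasl_partial u d z D :
  (derivable (fun t : R => u (z + t%:C * d)) 0 1 /\ partial d u z = D) <-> hasl u d z D.
Proof.
have zE : z = z + 0%:C * d by rewrite mul0r addr0.
rewrite [X in hasl u d X]zE -is_derive_line /partial derive1E; split.
  by move=> [h <-]; exact: derivableP.
by move=> [h <-].
Qed.

Lemma hasl_ext u v d z D : d = 1 \/ d = 'i -> (\forall w \near z, u w = v w) ->
  hasl u d z D -> hasl v d z D.
Proof.
move=> dP /nbhs_nm[s s0 sP] ud e e0; have [r r0 rP] := ud e e0.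
exists (Num.min r s); first by rewrite lt_min r0.
have nd : nm d = 1 by case: dP => ->; [exact: nm1|exact: nm_ii].
move=> h; rewrite lt_min => /andP[hr hs]; rewrite -!sP ?rP ?subrr ?nm0//.
by rewrite addrAC subrr add0r nmM nmR nd mulr1.
Qed.

Lemma hasl_Re (F : C -> C) d z (D : C) : d = 1 \/ d = 'i -> hasd F z D ->
  hasl (fun w => complex.Re (F w)) d z (complex.Re (d * D)).
Proof.
move=> dP FD e e0; have [r r0 rP] := FD e e0; exists r => // h hr.
have nd : nm d = 1 by case: dP => ->; [exact: nm1|exact: nm_ii].
have hd : nm (h%:C * d) = `|h| by rewrite nmM nmR nd mulr1.
have := rP (h%:C * d); rewrite hd => /(_ hr); apply: le_trans.
apply: le_trans (nm_Re _); rewrite !ReB /GRing.scale /= -mulrA.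
by case: (d * D) => x y /=; rewrite mul0r subr0.
Qed.

Lemma line_mean_value u d z p : (forall t, `|t| <= `|p| ->
    derivable (fun s : R => u (z + t%:C * d + s%:C * d)) 0 1) ->
  exists2 t, `|t| <= `|p| & u (z + p%:C * d) - u z = p * partial d u (z + t%:C * d).
Proof.
move=> ud; pose g s := u (z + s%:C * d).
have gd t : `|t| <= `|p| -> is_derive t 1 g (partial d u (z + t%:C * d)).
  by move=> tp; apply/is_derive_line/hasl_partial; split => //; exact: ud.
have gc a b : (forall t, a <= t <= b -> `|t| <= `|p|) -> {within `[a, b], continuous g}.
  move=> abp; apply: continuous_in_subspaceT => t; rewrite inE /= in_itv /= => /abp tp.
  by apply: differentiable_continuous; apply/derivable1_diffP; have [] := gd t tp.
have u0 : u z = g 0 by rewrite /g mul0r addr0.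
have [p0|p0] := leP 0 p.
  have tp t : 0 <= t <= p -> `|t| <= `|p|.
    by move=> /andP[t0 tp]; rewrite !ger0_norm.
  have [t tP E] : exists2 t, t \in `[0, p] & g p - g 0 =
      partial d u (z + t%:C * d) * (p - 0).
    apply: MVT_segment => // [t|]; last exact: gc.
    by rewrite in_itv /= => /andP[t0 tpp]; apply: gd; apply: tp; rewrite !ltW.
  exists t; first by apply: tp; move: tP; rewrite in_itv.
  by rewrite u0 -/(g p) E subr0 mulrC.
have tp t : p <= t <= 0 -> `|t| <= `|p|.
  by move=> /andP[tp t0]; rewrite !ler0_norm ?lerN2// ltW.
have [t tP E] : exists2 t, t \in `[p, 0] & g 0 - g p =
    partial d u (z + t%:C * d) * (0 - p).
  apply: MVT_segment => // [|t|]; [exact: ltW| |exact: gc].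
  by rewrite in_itv /= => /andP[t0 tpp]; apply: gd; apply: tp; rewrite !ltW.
exists t; first by apply: tp; move: tP; rewrite in_itv.
by rewrite u0 -/(g p) -opprB E sub0r mulrN opprK mulrC.
Qed.

Lemma nm_line d z t : d = 1 \/ d = 'i -> nm (z + t%:C * d - z) = `|t|.
Proof.
move=> dP; have nd : nm d = 1 by case: dP => ->; [exact: nm1|exact: nm_ii].
by rewrite addrAC subrr add0r nmM nmR nd mulr1.
Qed.

Lemma ReIm z : z = (complex.Re z)%:C * 1 + (complex.Im z)%:C * 'i.
Proof. by case: z => x y; apply/eqP; rewrite eq_complex /=; apply/andP; split; apply/eqP; ring. Qed.

(** The increment is split into a horizontal and a vertical one, and the mean
    value theorem is applied to each. *)
Lemma C1_total u z r : 0 < r -> C1_on [set w | nm (w - z) < r] u ->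
  forall e, 0 < e -> exists2 s : R, 0 < s & forall h, nm h < s ->
    `|u (z + h) - u z - (complex.Re h * partial 1 u z + complex.Im h * partial 'i u z)|
      <= e * nm h.
Proof.
move=> r0 uC1 e e0; have zz : nm (z - z) < r by rewrite subrr nm0.
have e2 : 0 < e / 2 by rewrite divr_gt0.
have [_ /(@cvgrPdist_lt _ R)/(_ _ e2)/nbhs_nm[s1 s10 s1P]] := uC1 1 (or_introl erefl) z zz.
have [_ /(@cvgrPdist_lt _ R)/(_ _ e2)/nbhs_nm[s2 s20 s2P]] := uC1 'i (or_intror erefl) z zz.
exists (Num.min r (Num.min s1 s2) / 2); first by rewrite divr_gt0// !lt_min r0 s10.
move=> h; rewrite ltr_pdivlMr// !lt_min => /andP[hr /andP[h1 h2]].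
set p := complex.Re h; set q := complex.Im h.
have hp : `|p| <= nm h := nm_Re h. have hq : `|q| <= nm h := nm_Im h.
have hE : z + h = z + p%:C * 1 + q%:C * 'i by rewrite -addrA -ReIm.
have [t tp E1] : exists2 t, `|t| <= `|p| &
    u (z + p%:C * 1) - u z = p * partial 1 u (z + t%:C * 1).
  apply: line_mean_value => t tp; apply: (uC1 1 (or_introl erefl) _ _).1 => /=.
  by rewrite nm_line; [lra|left].
have nz t' : `|t'| <= `|q| -> nm (z + p%:C * 1 + t'%:C * 'i - z) <= `|p| + `|q|.
  move=> tq; apply: (le_trans (nm_tri (z + p%:C * 1) _ _)).
  by rewrite !nm_line; [lra|left|right].
have [t' tq E2] : exists2 t, `|t| <= `|q| &
    u (z + p%:C * 1 + q%:C * 'i) - u (z + p%:C * 1) =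
      q * partial 'i u (z + p%:C * 1 + t%:C * 'i).
  apply: line_mean_value => t' tq; apply: (uC1 'i (or_intror erefl) _ _).1 => /=.
  by have := nz _ tq; lra.
have -> : u (z + h) - u z - (p * partial 1 u z + q * partial 'i u z) =
   p * (partial 1 u (z + t%:C * 1) - partial 1 u z) +
   q * (partial 'i u (z + p%:C * 1 + t'%:C * 'i) - partial 'i u z).
  rewrite !mulrBr -E1 -E2 hE; ring.
apply: (le_trans (ler_normD _ _)); rewrite !normrM.
have := s1P (z + t%:C * 1); rewrite nm_line; last by left.
rewrite distrC => /(_ _)/ltW H1; have {}H1 := H1 (le_lt_trans tp (le_lt_trans hp _)).
have := s2P (z + p%:C * 1 + t'%:C * 'i); rewrite distrC => H2.
have {}H1 : `|partial 1 u (z + t%:C * 1) - partial 1 u z| <= e / 2 by apply: H1; lra.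
have {}H2 : `|partial 'i u (z + p%:C * 1 + t'%:C * 'i) - partial 'i u z| <= e / 2.
  by apply/ltW/H2; have := nz _ tq; lra.
have := ler_pM (normr_ge0 p) (normr_ge0 _) hp H1.
have := ler_pM (normr_ge0 q) (normr_ge0 _) hq H2; lra.
Qed.

End LineDerivatives.

Section HarmonicRealPart.
Variable R : realType.
Local Notation C := R[i].
Implicit Types (u v : C -> R) (d z w a : C) (t s e D r : R).

Lemma haslB u v d z D D' : hasl u d z D -> hasl v d z D' ->
  hasl (fun w => u w - v w) d z (D - D').
Proof.
move=> uD vD e e0; have e2 : 0 < e / 2 by rewrite divr_gt0.
have [r r0 rP] := uD _ e2; have [s s0 sP] := vD _ e2.
exists (Num.min r s); first by rewrite lt_min r0.
move=> h; rewrite lt_min => /andP[/rP hr /sP hs].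
set U := u (z + _) in hr *; set V := v (z + _) in hs *.
rewrite (_ : U - V - (u z - v z) - h * (D - D') =
  (U - u z - h * D) - (V - v z - h * D')); last by ring.
by apply: (le_trans (ler_normB _ _)); lra.
Qed.

Lemma hasl_shift u d z b D : hasl u d (z + b) D -> hasl (fun w => u (w + b)) d z D.
Proof.
move=> uD e e0; have [r r0 rP] := uD e e0; exists r => // h hr.
by rewrite (addrAC z _ b) rP.
Qed.

Lemma second_difference u d d' z r t : d = 1 \/ d = 'i -> d' = 1 \/ d' = 'i ->
  0 < t -> 2 * t < r -> C1_on [set w | nm (w - z) < r] u ->
  C1_on [set w | nm (w - z) < r] (partial d u) ->
  exists2 x, nm (x - z) <= 2 * t & u (z + t%:C * d' + t%:C * d) - u (z + t%:C * d) -
    u (z + t%:C * d') + u z = t * (t * partial d' (partial d u) x).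
Proof.
move=> dP dP' t0 tr u1 u2; pose v w := u (w + t%:C * d') - u w.
have nt : `|t| = t by rewrite gtr0_norm.
have in1 p : `|p| <= t -> nm (z + p%:C * d - z) < r by rewrite nm_line//; lra.
have in2 p q : `|p| <= t -> `|q| <= t -> nm (z + p%:C * d + q%:C * d' - z) <= 2 * t.
  move=> pt qt; have := nm_tri (z + p%:C * d) (z + p%:C * d + q%:C * d') z.
  by rewrite !nm_line//; lra.
have ul p : `|p| <= t -> hasl v d (z + p%:C * d)
    (partial d u (z + p%:C * d + t%:C * d') - partial d u (z + p%:C * d)).
  move=> pt; apply: haslB.
    apply: hasl_shift; apply/hasl_partial; split => //.
    by apply: (u1 d dP _ _).1 => /=; have := in2 p t pt; rewrite nt => /(_ (lexx t)); lra.
  by apply/hasl_partial; split => //; apply: (u1 d dP _ _).1 => /=; exact: in1.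
have [p pt E] : exists2 p, `|p| <= `|t| &
    v (z + t%:C * d) - v z = t * partial d v (z + p%:C * d).
  by apply: line_mean_value => p; rewrite nt => /ul /hasl_partial[].
rewrite nt in pt; have /hasl_partial[_ Ev] := ul p pt.
have [q qt E'] : exists2 q, `|q| <= `|t| &
    partial d u (z + p%:C * d + t%:C * d') - partial d u (z + p%:C * d) =
    t * partial d' (partial d u) (z + p%:C * d + q%:C * d').
  apply: line_mean_value => q; rewrite nt => qt; apply: (u2 d' dP' _ _).1 => /=.
  by have := in2 p q pt qt; lra.
rewrite nt in qt; exists (z + p%:C * d + q%:C * d'); first exact: in2.
rewrite -E' -Ev -E /v [z + t%:C * d + _]addrAC; ring.
Qed.

Lemma dist_halves (x y p e : R) :
  `|x - p| < e / 2 -> `|y - p| < e / 2 -> `|x - y| <= e.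
Proof.
move=> xp yp; rewrite (_ : x - y = (x - p) - (y - p)); last by ring.
by apply: (le_trans (ler_normB _ _)); lra.
Qed.

(** The second difference of [u] over a small square is symmetric in the two
    directions, and by [second_difference] it is a value of either mixed
    derivative near [z]. *)
Lemma mixed_partials u z r : 0 < r -> C2_on [set w | nm (w - z) < r] u ->
  partial 'i (partial 1 u) z = partial 1 (partial 'i u) z.
Proof.
move=> r0 [u1 ux uy]; have zz : nm (z - z) < r by rewrite subrr nm0.
apply/eqP; rewrite -subr_eq0 -normr_le0; apply/ler_addgt0Pr => e e0; rewrite add0r.
have e2 : 0 < e / 2 by rewrite divr_gt0.
have [_ /(@cvgrPdist_lt _ R)/(_ _ e2)/nbhs_nm[s1 s10 s1P]] := ux 'i (or_intror erefl) z zz.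
have [_ /(@cvgrPdist_lt _ R)/(_ _ e2)/nbhs_nm[s2 s20 s2P]] := uy 1 (or_introl erefl) z zz.
pose m := Num.min r (Num.min s1 s2); have m0 : 0 < m by rewrite !lt_min r0 s10.
have /andP[mr /andP[m1 m2]] : [&& m <= r, m <= s1 & m <= s2].
  by rewrite !ge_min !lexx ?orbT.
have [t t0 tm] : exists2 t, 0 < t & 2 * t < m by exists (m / 4); lra.
have tr := lt_le_trans tm mr.
have [x xz E] := second_difference (or_introl erefl) (or_intror erefl) t0 tr u1 ux.
have [y yz E'] := second_difference (or_intror erefl) (or_introl erefl) t0 tr u1 uy.
have h1 := s1P x (le_lt_trans xz (lt_le_trans tm m1)).
have h2 := s2P y (le_lt_trans yz (lt_le_trans tm m2)).
have sw (p p' q s w : R) : p = p' -> p - q - s + w = p' - s - q + w.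
  by move=> ->; rewrite (addrAC p').
have xy := etrans (esym E) (etrans (sw _ _ _ _ _ (congr1 u (addrAC z _ _))) E').
have {}xy : partial 'i (partial 1 u) x = partial 1 (partial 'i u) y.
  by move: xy => /(mulfI (lt0r_neq0 t0))/(mulfI (lt0r_neq0 t0)).
by rewrite -xy in h2; exact: (dist_halves h1 h2).
Qed.

Definition real_part_on u a r := exists F : C -> C, forall z, nm (z - a) < r ->
  u z = complex.Re (F z) /\ exists D : C, hasd F z D.

Lemma C1_onW (A B : set C) u : A `<=` B -> C1_on B u -> C1_on A u.
Proof. by move=> AB uB d dP z /AB; exact: uB. Qed.

Lemma C2_onW (A B : set C) u : A `<=` B -> C2_on B u -> C2_on A u.
Proof. by move=> AB [h1 h2 h3]; split; apply: C1_onW AB _. Qed.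

Lemma cauchy_riemann (P Q : C -> R) z (A B B' A' : R) : B = B' -> A + A' = 0 ->
  (forall e, 0 < e -> exists2 s : R, 0 < s & forall h, nm h < s ->
    `|P (z + h) - P z - (complex.Re h * A + complex.Im h * B)| <= e * nm h) ->
  (forall e, 0 < e -> exists2 s : R, 0 < s & forall h, nm h < s ->
    `|Q (z + h) - Q z - (complex.Re h * B' + complex.Im h * A')| <= e * nm h) ->
  hasd (fun w => Complex (P w) (- Q w)) z (Complex A (- B)).
Proof.
move=> <- /eqP; rewrite addrC addr_eq0 => /eqP -> Pd Qd e e0.
have e2 : 0 < e / 2 by rewrite divr_gt0.
have [s1 s10 s1P] := Pd _ e2; have [s2 s20 s2P] := Qd _ e2.
exists (Num.min s1 s2); first by rewrite lt_min s10.
move=> h; rewrite lt_min => /andP[/s1P h1 /s2P h2].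
apply: (le_trans (nm_le_ReIm _)).
have -> : complex.Re (Complex (P (z + h)) (- Q (z + h)) - Complex (P z) (- Q z) -
    h *: Complex A (- B)) = P (z + h) - P z - (complex.Re h * A + complex.Im h * B).
  by case: h {h1 h2} => p q /=; ring.
have -> : complex.Im (Complex (P (z + h)) (- Q (z + h)) - Complex (P z) (- Q z) -
    h *: Complex A (- B)) = - (Q (z + h) - Q z - (complex.Re h * B + complex.Im h * - A)).
  by case: h {h1 h2} => p q /=; ring.
rewrite normrN; apply: (le_trans (lerD h1 h2)).
by rewrite -mulrDl -splitr.
Qed.

(** The function [u_x - i u_y] satisfies the Cauchy-Riemann equations and so has
    a primitive on a smaller disc; the real part of the primitive has the same
    gradient as [u]. *)
Theorem harmonic_real_part (Omega : set C) u a r : 0 < r -> harmonic_on Omega u ->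
  (forall z, nm (z - a) < r -> Omega z) -> real_part_on u a (r / 2).
Proof.
move=> r0 [uC2 uL] rO.
have sub b s : nm (b - a) + s <= r -> [set w | nm (w - b) < s] `<=` Omega.
  by move=> bs w /= wb; apply: rO; have := nm_tri b w a; lra.
pose g z := Complex (partial 1 u z) (- partial 'i u z).
have ghol z : nm (z - a) < r -> exists D : C, hasd g z D.
  move=> zr; pose s := r - nm (z - a); have s0 : 0 < s by rewrite subr_gt0.
  have zs : nm (z - a) + s <= r by rewrite /s; lra.
  have uC := C2_onW (sub _ _ zs) uC2; have [_ ux uy] := uC.
  eexists; apply: (cauchy_riemann (mixed_partials s0 uC) (uL z (rO z zr))).
    exact: (C1_total s0 ux).
  exact: (C1_total s0 uy).
have [G GP] := primitive r0 ghol.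
have c z : nm (z - a) < r / 2 -> u z - complex.Re (G z) = u a - complex.Re (G a).
  move=> zr; pose v w := u w - complex.Re (G w).
  have vl d w : d = 1 \/ d = 'i -> nm (w - a) < r / 2 -> hasl v d w 0.
    move=> dP wr; have -> : 0 = partial d u w - complex.Re (d * g w).
      by case: dP => ->; rewrite /g /=; ring.
    apply: haslB; last by apply: hasl_Re => //; exact: GP.
    apply/hasl_partial; split => //; have [u1 _ _] := uC2; apply: (u1 d dP _ _).1.
    by apply: rO; lra.
  set h := z - a in zr; have hp := nm_Re h; have hq := nm_Im h.
  set p := complex.Re h in hp; set q := complex.Im h in hq.
  have zE : z = a + p%:C * 1 + q%:C * 'i by rewrite -addrA -ReIm addrC subrK.
  have [t tp] : exists2 t, `|t| <= `|p| &
      v (a + p%:C * 1) - v a = p * partial 1 v (a + t%:C * 1).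
    apply: line_mean_value => t tp.
    have [|//] := (hasl_partial _ _ _ 0).2 (vl 1 (a + t%:C * 1) (or_introl erefl) _).
    by rewrite nm_line; [lra|left].
  have := vl 1 (a + t%:C * 1) (or_introl erefl); rewrite nm_line; last by left.
  move=> /(_ (le_lt_trans tp (le_lt_trans hp zr)))/hasl_partial[_ ->].
  rewrite mulr0 => /eqP; rewrite subr_eq0 => /eqP E1.
  have near t' : `|t'| <= `|q| -> nm (a + p%:C * 1 + t'%:C * 'i - a) < r / 2.
    move=> tq; apply: le_lt_trans zr.
    rewrite -(addrA a) (addrAC a) subrr add0r.
    rewrite -(@ler_pXn2r _ 2)// ?nnegrE ?nm_ge0// !nm_sqr.
    have -> : complex.Re (p%:C * 1 + t'%:C * 'i) = p by rewrite /=; ring.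
    have -> : complex.Im (p%:C * 1 + t'%:C * 'i) = t' by rewrite /=; ring.
    rewrite lerD2l -[t' ^+ 2]real_normK ?num_real// -[_ h ^+ 2]real_normK ?num_real//.
    by rewrite lerXn2r ?nnegrE.
  have [t' tq] : exists2 t, `|t| <= `|q| & v (a + p%:C * 1 + q%:C * 'i) -
      v (a + p%:C * 1) = q * partial 'i v (a + p%:C * 1 + t%:C * 'i).
    apply: line_mean_value => t' tq.
    exact: ((hasl_partial _ _ _ 0).2 (vl 'i _ (or_intror erefl) (near _ tq))).1.
  have /hasl_partial[_ ->] := vl 'i _ (or_intror erefl) (near _ tq).
  rewrite mulr0 => /eqP; rewrite subr_eq0 -zE E1 => /eqP.
  by rewrite /v.
exists (fun z => G z + (u a - complex.Re (G a))%:C) => z zr; split.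
  by have := c z zr; case: (G z) => x y /=; lra.
by eexists; exact: hasdD (GP z zr) (@hasd_cst _ _ _ z).
Qed.

(** The derivatives of the real part of [F] along [1] and ['i] are the real parts
    of [F'] and ['i F'], hence again real parts of holomorphic functions. *)
Lemma real_part_partial u a r d : d = 1 \/ d = 'i -> 0 < r ->
  real_part_on u a r -> (forall z, nm (z - a) < r ->
    derivable (fun t : R => u (z + t%:C * d)) 0 1) /\
  exists F' : C -> C, forall z, nm (z - a) < r ->
    partial d u z = complex.Re (d * F' z) /\ exists D : C, hasd F' z D.
Proof.
move=> dP r0 [F FP].
have /choice[F' F'P] z : exists D : C, nm (z - a) < r -> hasd F z D.
  by have [/FP[_ [D FD]]|h] := pselect (nm (z - a) < r); [exists D|exists 0 => /h].
have ul z : nm (z - a) < r -> hasl u d z (complex.Re (d * F' z)).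
  move=> zr; apply: (@hasl_ext _ (fun w => complex.Re (F w))) => //; last first.
    by apply: hasl_Re => //; exact: F'P.
  apply/nbhs_nm; exists (r - nm (z - a)); first by rewrite subr_gt0.
  by move=> w wz; apply/esym; apply: (FP w _).1; have := nm_tri z w a; lra.
split; first by move=> z /ul /hasl_partial[].
exists F' => z zr; split; first by have /hasl_partial[_ ->] := ul z zr.
have s0 : 0 < r - nm (z - a) by rewrite subr_gt0.
apply: (derivative_holomorphic s0) => w wz; apply: F'P.
by have := nm_tri z w a; lra.
Qed.

Lemma real_part_on_partial u a r d : d = 1 \/ d = 'i -> 0 < r ->
  real_part_on u a r -> real_part_on (partial d u) a r.
Proof.
move=> dP r0 /(real_part_partial dP r0)[_ [F' F'P]].
exists (fun z => d * F' z) => z /F'P[-> [D FD]]; split=> //.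
by eexists; exact: hasdM (@hasd_cst _ _ d z) FD.
Qed.

Lemma real_part_C1 (Omega : set C) u :
  (forall a, Omega a -> exists2 r, 0 < r & real_part_on u a r) -> C1_on Omega u.
Proof.
move=> uO d dP a /uO[r r0 ur]; have aa : nm (a - a) < r by rewrite subrr nm0.
split; first exact: (real_part_partial dP r0 ur).1.
have [G GP] := real_part_on_partial dP r0 ur.
have [pG [D /hasd_cvg /cvg_nm GD]] := GP a aa.
apply/(@cvgrPdist_lt _ R _ (nbhs a)) => e e0.
have /nbhs_nm[s s0 sP] := GD e e0; apply/nbhs_nm.
exists (Num.min r s); first by rewrite lt_min r0.
move=> z; rewrite lt_min => /andP[/GP[-> _] /sP]; rewrite pG.
by rewrite distrC; apply: le_lt_trans; exact: Re_lip.
Qed.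

Theorem real_part_harmonic (Omega : set C) u :
  (forall a, Omega a -> exists2 r, 0 < r & real_part_on u a r) -> harmonic_on Omega u.
Proof.
move=> uO; have pO d : d = 1 \/ d = 'i -> forall a, Omega a ->
    exists2 r, 0 < r & real_part_on (partial d u) a r.
  by move=> dP a /uO[r r0 ur]; exists r => //; exact: real_part_on_partial.
split; first by split; apply: real_part_C1 => //; apply: pO; [left|right].
move=> a /uO[r r0 ur]; have aa : nm (a - a) < r by rewrite subrr nm0.
case: ur => F FP.
have /choice[F' F'P] z : exists D : C, nm (z - a) < r -> hasd F z D.
  by have [/FP[_ [D FD]]|h] := pselect (nm (z - a) < r); [exists D|exists 0 => /h].
have ul d z : d = 1 \/ d = 'i -> nm (z - a) < r -> partial d u z = complex.Re (d * F' z).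
  move=> dP zr; suff /hasl_partial[] : hasl u d z (complex.Re (d * F' z)) by [].
  apply: (@hasl_ext _ (fun w => complex.Re (F w))) => //; last first.
    by apply: hasl_Re => //; exact: F'P.
  apply/nbhs_nm; exists (r - nm (z - a)); first by rewrite subr_gt0.
  by move=> w wz; apply/esym; apply: (FP w _).1; have := nm_tri z w a; lra.
have [D F'D] := derivative_holomorphic r0 F'P.
have second d : d = 1 \/ d = 'i -> partial d (partial d u) a = complex.Re (d * (d * D)).
  move=> dP; suff /hasl_partial[] : hasl (partial d u) d a (complex.Re (d * (d * D))) by [].
  apply: (@hasl_ext _ (fun w => complex.Re (d * F' w))) => //; last first.
    apply: hasl_Re => //; have := hasdM (@hasd_cst _ _ d a) F'D.
    by rewrite mul0r add0r.
  by apply/nbhs_nm; exists r => // w /(ul d w dP) ->.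
rewrite (second 1); last by left.
rewrite (second 'i); last by right.
by case: D {F'D second} => x y /=; ring.
Qed.

End HarmonicRealPart.

(** * Harnack's inequality and Harnack's theorem *)

Section Harnack.
Variable R : realType.
Local Notation C := R[i].
Implicit Types (u v : C -> R) (z w a : C) (t s e r : R).

Lemma ReD z w : complex.Re (z + w) = complex.Re z + complex.Re w.
Proof. by case: z w => ? ? []. Qed.

Lemma ImD z w : complex.Im (z + w) = complex.Im z + complex.Im w.
Proof. by case: z w => ? ? []. Qed.

(** The Cayley transform [(F - m) / (F + m)] maps the half plane to the disc and
    vanishes at [a], so it is small near [a]. *)
Lemma bound_by_real_part_pos (F : C -> C) a r (m : R) : 0 < r -> 0 < m ->
  (forall z, nm (z - a) < r -> 0 <= complex.Re (F z) /\ exists D, hasd F z D) ->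
  F a = m%:C -> forall w, nm (w - a) <= r / 48 -> nm (F w) <= 2 * m.
Proof.
move=> r0 m0 FP Fa w wr; pose B z := (F z - m%:C) * (F z + m%:C)^-1.
have den z : nm (z - a) < r -> F z + m%:C != 0.
  move=> /FP[Fz _]; rewrite -nm_gt0; apply: lt_le_trans (Re_le_nm _).
  by rewrite ReD /= ltr_wpDl.
have Bhol z : nm (z - a) < r -> exists D, hasd B z D.
  move=> zr; have [_ [D FD]] := FP z zr; have h1 := hasdB FD (@hasd_cst _ _ (m%:C) z).
  have h2 := hasdD FD (@hasd_cst _ _ (m%:C) z).
  by eexists; exact: hasdM h1 (hasdV h2 (den z zr)).
have FB z : nm (z - a) < r -> nm (F z - m%:C) <= nm (F z + m%:C).
  move=> /FP[Fz _]; rewrite -(@ler_pXn2r _ 2)// ?nnegrE ?nm_ge0//.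
  by rewrite !nm_sqr ReB ImB ReD ImD /=; nra.
have B1 z : nm (z - a) < r -> nm (B z) <= 1.
  move=> zr; rewrite nmM nmV ler_pdivrMr ?mul1r ?FB//.
  by rewrite nm_gt0 den.
have Ba : B a = 0 by rewrite /B Fa subrr mul0r.
have m2 : 0 <= 2 * m by rewrite mulr_ge0// ltW.
have [wa|wa] := eqVneq w a.
  by rewrite wa Fa nmR gtr0_norm//; lra.
have h0 : w - a != 0 by rewrite subr_eq0.
have w4 : nm (w - a) < r / 4 by lra.
have := nm_slope r0 Bhol B1 h0 w4; rewrite /slope Ba subr0 [a + _]addrC subrK.
rewrite nmZ nmV ler_pdivrMl ?nm_gt0// mulr1 => Bw.
have {}Bw : nm (B w) <= 3^-1.
  apply: (le_trans Bw); apply: (@le_trans _ _ (r / 48 * (8 * (2 / r)))).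
    by rewrite ler_wpM2r// mulr_ge0// divr_ge0// ltW.
  rewrite le_eqVlt; apply/orP; left; apply/eqP; field; exact: lt0r_neq0.
have wr' : nm (w - a) < r by lra.
move: Bw; rewrite nmM nmV ler_pdivrMr ?nm_gt0 ?den// => Bw.
have := nm_le_sub (F w) (m%:C); have := nmD (F w) (m%:C).
by rewrite nmR gtr0_norm//; lra.
Qed.

(** The degenerate case [m = 0] follows by adding small positive constants. *)
Lemma bound_by_real_part (F : C -> C) a r (m : R) : 0 < r ->
  (forall z, nm (z - a) < r -> 0 <= complex.Re (F z) /\ exists D, hasd F z D) ->
  F a = m%:C -> forall w, nm (w - a) <= r / 48 -> nm (F w) <= 2 * m.
Proof.
move=> r0 FP Fa w wr; have m0 : 0 <= m.
  by have := (FP a); rewrite subrr nm0 Fa => /(_ r0)[].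
apply/ler_addgt0Pr => e e0; have e3 : 0 < e / 3 by rewrite divr_gt0.
have me : 0 < m + e / 3 by rewrite ltr_wpDl.
have := @bound_by_real_part_pos (fun z => F z + (e / 3)%:C) a r (m + e / 3) r0 me _ _ w wr.
have H z : nm (z - a) < r -> 0 <= complex.Re (F z + (e / 3)%:C) /\
    exists D, hasd (fun z => F z + (e / 3)%:C) z D.
  move=> /FP[Fz [D FD]]; rewrite ReD /=; split; first by rewrite addr_ge0// ltW.
  by eexists; exact: hasdD FD (@hasd_cst _ _ _ z).
move=> /(_ H); rewrite Fa -rmorphD => /(_ erefl).
have := nm_le_sub (F w) (- (e / 3)%:C); rewrite opprK nmN nmR gtr0_norm//; lra.
Qed.

Definition pos_harmonic (Omega : set C) u :=
  harmonic_on Omega u /\ forall z, Omega z -> 0 <= u z.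

Lemma pos_harmonic_representation (Omega : set C) u a r : 0 < r ->
  (forall z, nm (z - a) < r -> Omega z) -> pos_harmonic Omega u ->
  exists F : C -> C, forall w, nm (w - a) < r / 96 ->
    [/\ u w = complex.Re (F w), exists D, hasd F w D & nm (F w) <= 2 * u a].
Proof.
move=> r0 rO [uh u0]; have [G GP] := harmonic_real_part r0 uh rO.
have r2 : 0 < r / 2 by rewrite divr_gt0.
have aa : nm (a - a) < r / 2 by rewrite subrr nm0.
pose F z := G z - Complex 0 (complex.Im (G a)).
have ReF z : complex.Re (F z) = complex.Re (G z) by rewrite ReB subr0.
have Fhol z : nm (z - a) < r / 2 -> exists D, hasd F z D.
  move=> /GP[_ [D GD]]; eexists; exact: hasdB GD (@hasd_cst _ _ _ z).
have Fa : F a = (u a)%:C.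
  rewrite (GP a aa).1 /F; case: (G a) => x y.
  by apply/eqP; rewrite eq_complex /= subr0 subrr !eqxx.
exists F => w wr; have wr2 : nm (w - a) < r / 2 by lra.
split; [by rewrite ReF (GP w wr2).1|exact: Fhol|].
apply: (bound_by_real_part r2 _ Fa); last by rewrite ltW//; lra.
move=> z zr; split; last exact: Fhol.
by rewrite ReF -(GP z zr).1; apply: u0; apply: rO; lra.
Qed.

(** By [pos_harmonic_representation] the values at nearby points are comparable
    in both directions, so the points for which a constant exists form a set that
    is open and closed in the region. *)
Theorem harnack (Omega : set C) z0 z : open Omega -> connected Omega ->
  Omega z0 -> Omega z -> exists2 c : R, 0 < c & forall u, pos_harmonic Omega u ->
    u z <= c * u z0.
Proof.
move=> oO cO Oz0.
pose Z := [set z | Omega z /\ exists2 c : R, 0 < c & forall u, pos_harmonic Omega u ->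
    u z <= c * u z0].
have disc b : Omega b -> exists2 r : R, 0 < r & forall z, nm (z - b) < r -> Omega z.
  by move=> Ob; have /nbhs_nm[r r0 rP] := open_nbhs_nbhs (conj oO Ob); exists r.
have step b w r : 0 < r -> (forall z, nm (z - b) < r -> Omega z) ->
    nm (w - b) < r / 96 -> Z b -> Z w.
  move=> r0 rO wr [Ob [c c0 cP]]; split; first by apply: rO; lra.
  exists (2 * c); first by rewrite mulr_gt0.
  move=> u up; have [F FP] := pos_harmonic_representation r0 rO up.
  have [-> _ Fw] := FP w wr; have := Re_le_nm (F w); have := cP u up; lra.
suff ZO : Z = Omega by rewrite -[in X in X -> _]ZO => -[].
apply: cO; first by exists z0; split => //; exists 1 => // u _; rewrite mul1r.
  exists Z; last by rewrite setIidr// => b [].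
  rewrite openE => b Zb; have [r r0 rO] := disc b Zb.1.
  by apply/nbhs_nm; exists (r / 96); [rewrite divr_gt0|move=> w wr; exact: step r0 rO wr Zb].
exists (~` [set b | Omega b /\ ~ Z b]).
  apply: open_closedC; rewrite openE => b [Ob nZ]; have [r r0 rO] := disc b Ob.
  apply/nbhs_nm; exists (r / 192); first by rewrite divr_gt0.
  move=> w wr; split; first by apply: rO; lra.
  apply: contra_not nZ; apply: (@step w b (r / 2)).
  - by rewrite divr_gt0.
  - by move=> y yw; apply: rO; have := nm_tri w y b; lra.
  - by rewrite nm_distC; lra.
apply/seteqP; split=> [b Zb|b [Ob nb]]; first by split=> [|[]]; [case: Zb|].
by apply: contrapT => nZ; exact: nb.
Qed.

Lemma hasd_sum (X : normedModType C) (F : nat -> C -> X) n z :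
  (forall j, exists D, hasd (F j) z D) ->
  exists D, hasd (fun w => \sum_(j < n) F j w) z D.
Proof.
move=> FD; elim: n => [|n [D IH]].
  exists 0; apply: (hasd_ext _ (@hasd_cst _ X 0 z)).
  by apply: (filterE (F := nbhs z)) => w; rewrite big_ord0.
have [D' FD'] := FD n; exists (D + D'); apply: (hasd_ext _ (hasdD IH FD')).
by apply: (filterE (F := nbhs z)) => w; rewrite big_ord_recr.
Qed.

Lemma Re_sum (F : nat -> C) n :
  complex.Re (\sum_(j < n) F j) = \sum_(j < n) complex.Re (F j).
Proof. by elim: n => [|n IH]; rewrite ?big_ord0// !big_ord_recr /= ReD IH. Qed.

(** This compares the Cauchy condition of a series with that of a majorant. *)
Lemma nm_sum_le (X : normedModType C) (F : nat -> X) (b : nat -> R) n m' :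
  (forall j, nm (F j) <= b j) -> (m' <= n)%N ->
  nm (\sum_(j < n) F j - \sum_(j < m') F j) <= \sum_(j < n) b j - \sum_(j < m') b j.
Proof.
move=> Fb; elim: n => [|n IH]; first by rewrite leqn0 => /eqP ->; rewrite !subrr nm0.
rewrite leq_eqVlt => /predU1P[->|]; first by rewrite !subrr nm0.
rewrite ltnS => /IH h; rewrite !big_ord_recr /= addrAC (le_trans (nmD _ _))//.
by rewrite [leRHS]addrAC lerD.
Qed.

(** Harnack's theorem on series.  Near [a] write [u j] as the real part of [F j]
    with [|F j| <= 2 u j a].  The partial sums of the [F j] then converge together
    with the bounded monotone sums at [a], and their limit is holomorphic by
    [hasd_limit]. *)
Theorem harnack_series (Omega : set C) z0 (u : nat -> C -> R) (S : R) :
  open Omega -> connected Omega -> Omega z0 ->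
  (forall n, pos_harmonic Omega (u n)) ->
  (forall n, \sum_(j < n) u j z0 <= S) ->
  exists U, [/\ pos_harmonic Omega U, U z0 <= S &
    forall z, Omega z -> forall n, \sum_(j < n) u j z <= U z].
Proof.
move=> oO cO Oz0 up uS; pose s n z := \sum_(j < n) u j z.
have s_up z n m' : Omega z -> (m' <= n)%N -> s m' z <= s n z.
  move=> Oz; rewrite /s; elim: n => [|n IH]; first by rewrite leqn0 => /eqP ->.
  rewrite leq_eqVlt => /predU1P[->//|]; rewrite ltnS => /IH h.
  by rewrite big_ord_recr /= (le_trans h)// lerDl (up n).2.
have sC z : Omega z -> exists c, forall n, s n z <= c.
  move=> Oz; have [c c0 cP] := harnack oO cO Oz0 Oz; exists (c * S) => n.
  apply: (@le_trans _ _ (c * s n z0)); last by rewrite ler_pM2l// uS.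
  by rewrite /s mulr_sumr; apply: ler_sum => j _; exact: cP.
pose U z := sup (range (s ^~ z)).
have sU z n : Omega z -> s n z <= U z.
  move=> /sC[c cP]; apply: ub_le_sup; last by exists n.
  by exists c => _ [k _ <-].
have Uadh z e : Omega z -> 0 < e -> exists N, forall n, (N <= n)%N -> U z - s n z <= e.
  move=> Oz e0; have hs : has_sup (range (s ^~ z)).
    split; first by exists (s 0%N z), 0%N.
    by have [c cP] := sC z Oz; exists c => _ [k _ <-].
  have [_ [N _ <-]] := sup_adherent e0 hs; rewrite -/(U z) => h.
  by exists N => n Nn; have := s_up z n N Oz Nn; lra.
exists U; split; last by move=> z Oz n; exact: sU.
  split; last by move=> z Oz; have := sU z 0%N Oz; rewrite /s big_ord0.
  apply: real_part_harmonic => a Oa.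
  have /nbhs_nm[r r0 rO] := open_nbhs_nbhs (conj oO Oa).
  have /choice[F FP] n := pos_harmonic_representation r0 rO (up n).
  have rho0 : 0 < r / 96 by rewrite divr_gt0.
  have rhoO w : nm (w - a) < r / 96 -> Omega w by move=> wr; apply: rO; lra.
  pose G n w := \sum_(j < n) F j w.
  have Gdiff w n m' : nm (w - a) < r / 96 -> (m' <= n)%N ->
      nm (G n w - G m' w) <= 2 * (s n a - s m' a).
    move=> wr mn; rewrite mulrBr /s !mulr_sumr.
    apply: (@nm_sum_le _ (F ^~ w) (fun j => 2 * u j a)) => // j.
    by case: (FP j w wr).
  have [g gP] : exists g : C -> C, forall w, nm (w - a) < r / 96 -> tends (G ^~ w) (g w).
    have h w : exists l, nm (w - a) < r / 96 -> tends (G ^~ w) l.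
      have [wr|nwr] := pselect (nm (w - a) < r / 96); last by exists 0 => /nwr.
      suff [l lP] : exists l, tends (G ^~ w) l by exists l.
      apply: complex_complete => e e0.
      have [N NP] := Uadh a _ Oa (divr_gt0 e0 (ltr0n _ 2)); exists N.
      have close n m' : (N <= m')%N -> (m' <= n)%N -> nm (G n w - G m' w) <= e.
        move=> Nm mn; apply: (le_trans (Gdiff w n m' wr mn)).
        by have := NP m' Nm; have := sU a n Oa; lra.
      move=> k n Nk Nn; have [kn|nk] := leqP k n; last by apply: close => //; exact: ltnW.
      by rewrite nm_distC close.
    by have /choice[g gP] := h; exists g.
  exists (r / 96) => //; exists g => w wr; split.
    apply/eqP; rewrite -subr_eq0 -normr_le0; apply/ler_addgt0Pr => e e0; rewrite add0r.
    have e2 : 0 < e / 2 by rewrite divr_gt0.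
    have [N NP] := Uadh w _ (rhoO w wr) e2; have [N' NP'] := gP w wr _ e2.
    pose n := maxn N N'; have := NP n (leq_maxl _ _); have := NP' n (leq_maxr _ _).
    have := sU w n (rhoO w wr); have := Re_lip (G n w) (g w).
    have -> : complex.Re (G n w) = s n w.
      by rewrite /G (Re_sum (F ^~ w)); apply: eq_bigr => j _; case: (FP j w wr).
    move=> h1 h2 h3 h4; rewrite (_ : U w - complex.Re (g w) =
      (U w - s n w) + (s n w - complex.Re (g w))); last by ring.
    apply: (le_trans (ler_normD _ _)); rewrite ger0_norm ?subr_ge0//; lra.
  pose t := r / 96 - nm (w - a); have t0 : 0 < t by rewrite subr_gt0.
  have tr z : nm (z - w) < t -> nm (z - a) < r / 96.
    by move=> zt; have := nm_tri w z a; rewrite /t in zt; lra.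
  apply: (@hasd_limit _ _ [set id] G g w t (2 * U a) (norming_id R)
    (@complex_complete R) t0).
  - by move=> n z zt; apply: hasd_sum => j; case: (FP j z (tr z zt)).
  - move=> n z zt; have := Gdiff z n 0%N (tr z zt) (leq0n n).
    by rewrite /G /s !big_ord0 !subr0; have := sU a n Oa; rewrite /s; lra.
  - by move=> z zt; apply: gP; exact: tr.
apply: ge_sup; first by exists (s 0%N z0), 0%N.
by move=> _ [n _ <-]; exact: uS.
Qed.

End Harnack.

(** * Uniform boundedness *)

Section GlidingHump.
Variable R : realType.
Local Notation C := R[i].
Variables (V : lmodType C) (B P : set V) (I : Type) (T : I -> V -> R).
Hypothesis TD : forall i x y, T i (x + y) <= T i x + T i y.
Hypothesis TZ : forall i (c : R) x, 0 <= c -> T i (c%:C *: x) = c * T i x.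
Hypothesis TN : forall i x, T i (- x) = T i x.
Hypothesis BN : forall x, B x -> B (- x).
(* Weighted sums of the form [\sum_j 2 / 3 ^ (j + 1) *: f (n + j)], described by
   their recursion and up to vectors that no seminorm sees. *)
Hypothesis B_sum : forall f : nat -> V, (forall n, B (f n)) -> exists g : nat -> V,
  P (g 0%N) /\ forall n, B (g n) /\
  forall i, T i (g n - ((2 / 3)%:C *: f n + (1 / 3)%:C *: g n.+1)) = 0.
Hypothesis T_bounded : forall i, exists M : R, forall x, B x -> T i x <= M.
Hypothesis T_pointwise : forall x, P x -> exists M : R, forall i, T i x <= M.

Let Tz i : T i 0 = 0.
Proof. by have := TZ i 0 (lexx 0); rewrite scaler0 mul0r. Qed.

Let T0 i x : 0 <= T i x.
Proof.
have : T i (x - x) <= T i x + T i x by rewrite -[X in _ <= _ + X]TN TD.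
rewrite subrr Tz.
by rewrite -mulr2n pmulrn_lge0.
Qed.

(** A gliding hump argument.  If the seminorms were unbounded on [B], signs
    could be chosen in a sum with ratio one third so that its [n]-th partial sum
    is large for the [n]-th seminorm; the tail is too small to undo this. *)
Theorem gliding_hump : exists M : R, forall i x, B x -> T i x <= M.
Proof.
apply: contrapT => nM.
have large A : exists ie : I * V, [/\ B ie.2, A < T ie.1 ie.2 &
    forall x, B x -> T ie.1 x <= 10 / 9 * T ie.1 ie.2].
  have [i [x [Bx Ax]]] : exists i x, B x /\ 10 / 9 * `|A| < T i x.
    apply: contrapT => nx; apply: nM; exists (10 / 9 * `|A|) => i x Bx.
    by rewrite leNgt; apply/negP => h; apply: nx; exists i, x.
  pose E := [set T i x | x in B].
  have hE : has_sup E.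
    by split; [exists (T i x), x|have [M MP] := T_bounded i; exists M => _ [y By <-]; exact: MP].
  have xs : T i x <= sup E by apply: (ub_le_sup hE.2); exists x.
  have A0 : 0 <= `|A| by [].
  have s0 : 0 < sup E / 10 by lra.
  have [_ [e Be <-] es] := sup_adherent s0 hE.
  exists (i, e); split => //=.
    by have := ler_norm A; lra.
  move=> y By; have : T i y <= sup E by apply: (ub_le_sup hE.2); exists y.
  by lra.
have /choice[ie ieP] n := large (4 * 3 ^+ n * n.+1%:R).
pose i n := (ie n).1; pose e n := (ie n).2.
pose wt n : R := 2 / 3 / 3 ^+ n.
have wt0 n : 0 <= wt n by rewrite !divr_ge0// exprn_ge0.
pose sgn n x := if wt n * T (i n) (e n) <= T (i n) (x + (wt n)%:C *: e n)
                then e n else - e n.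
have sgnP n x : wt n * T (i n) (e n) <= T (i n) (x + (wt n)%:C *: sgn n x).
  rewrite /sgn; case: ifP => // /negbT; rewrite -ltNge => h.
  have := TD (i n) (x + (wt n)%:C *: e n) (- (x - (wt n)%:C *: e n)).
  rewrite TN opprD opprK addrACA subrr add0r -scalerDl -rmorphD TZ ?addr_ge0//.
  by rewrite scalerN; move: h; lra.
pose X := fix X n := if n is n'.+1 then X n' + (wt n')%:C *: sgn n' (X n') else 0.
pose f n := sgn n (X n).
have Bf n : B (f n).
  by rewrite /f /sgn; case: ifP => _; [|apply: BN]; case: (ieP n).
have [g [Pg gP]] := B_sum Bf.
have gX n k : T k (g 0%N - (X n + (3 ^- n)%:C *: g n)) = 0.
  elim: n => [|n IH].
    by rewrite /= add0r expr0 invr1 scale1r subrr Tz.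
  apply/eqP; rewrite eq_le T0 andbT.
  have [_ /(_ k) h] := gP n.
  have -> : g 0%N - (X n.+1 + (3 ^- n.+1)%:C *: g n.+1) =
    (g 0%N - (X n + (3 ^- n)%:C *: g n)) +
    (3 ^- n)%:C *: (g n - ((2 / 3)%:C *: f n + (1 / 3)%:C *: g n.+1)).
    rewrite scalerBr scalerDr !scalerA -!rmorphM /= -/(f n) exprS invfM.
    have -> : 3 ^- n * (2 / 3) = wt n by rewrite /wt mulrC.
    have -> : 3 ^- n * (1 / 3) = 3^-1 * 3 ^- n :> R by rewrite mul1r mulrC.
    rewrite !opprD !addrA; congr (_ - _); by rewrite subrK.
  apply: (le_trans (TD _ _ _)); rewrite IH TZ; last by rewrite invr_ge0 exprn_ge0.
  by rewrite h mulr0 addr0.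
have [M MP] := T_pointwise Pg.
have := MP (i (truncn `|M|).+1); set n := (truncn `|M|).+1; apply/negP; rewrite -ltNge.
have Mn : M < n%:R by apply: (le_lt_trans (ler_norm M)); exact: truncnS_gt.
apply: (lt_trans Mn); have [Be big Bb] := ieP n.
have [Bg _] := gP n.+1; have tail := Bb _ Bg.
have X1 := sgnP n (X n).
have h3 : (0 : R) < 3 ^- n by rewrite invr_gt0 exprn_gt0.
have : T (i n) (X n.+1) <= T (i n) (g 0%N) + 3 ^- n.+1 * T (i n) (g n.+1).
  have -> : X n.+1 = g 0%N - (g 0%N - (X n.+1 + (3 ^- n.+1)%:C *: g n.+1)) -
      (3 ^- n.+1)%:C *: g n.+1 by rewrite opprB [g 0%N + _]addrC subrK addrK.
  apply: (le_trans (TD _ _ _)); rewrite TN TZ ?invr_ge0 ?exprn_ge0// lerD2r.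
  by apply: (le_trans (TD _ _ _)); rewrite TN gX addr0.
rewrite -/(i n) -/(e n) in big tail.
have w3 : wt n = 2 / 3 * 3 ^- n by [].
have s3 : 3 ^- n.+1 = 1 / 3 * 3 ^- n :> R by rewrite exprS invfM mul1r.
have b3 : 4 * n.+1%:R < 3 ^- n * T (i n) (e n).
  by rewrite [ltRHS]mulrC ltr_pdivlMr ?exprn_gt0// mulrAC.
move: X1; rewrite w3 s3 -[X n + _]/(X n.+1).
have : 3 ^- n * T (i n) (g n.+1) <= 3 ^- n * (10 / 9 * T (i n) (e n)).
  by rewrite ler_pM2l.
have : (n%:R : R) < n.+1%:R by rewrite ltr_nat.
have : 0 <= (n%:R : R) by [].
move: b3; rewrite -[n.+1%:R]natr1.
move: (T (i n) (g n.+1)) (T (i n) (e n)) (3 ^- n) (T (i n) (g 0%N)) (n%:R : R).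
by move=> G t p y k *; lra.
Qed.

End GlidingHump.

Section GeometricSums.
Variable R : realType.
Local Notation C := R[i].

(** Weights of total mass one such that every tail is a multiple of the whole
    sequence; this gives the recursion in [geometric_sum]. *)
Definition wt (j : nat) : R := 2 / 3 / 3 ^+ j.

Lemma wt_ge0 j : 0 <= wt j. Proof. by rewrite !divr_ge0// exprn_ge0. Qed.

Lemma sum_wt n : \sum_(j < n) wt j = 1 - 3 ^- n.
Proof.
elim: n => [|n IH]; first by rewrite big_ord0 expr0 invr1 subrr.
by rewrite big_ord_recr /= IH /wt exprS; field; rewrite expf_neq0.
Qed.

Lemma sum_wt_le1 n : \sum_(j < n) wt j <= 1.
Proof. by rewrite sum_wt gerBl invr_ge0 exprn_ge0. Qed.

(** Jensen's inequality, for weights of total mass at most one. *)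
Lemma sum_wt_sqr (a : nat -> R) n :
  (\sum_(j < n) wt j * a j) ^+ 2 <= \sum_(j < n) wt j * a j ^+ 2.
Proof.
set s := \sum_(j < n) _; have sE : s = \sum_(j < n) wt j * a j by [].
clearbody s.
have : 0 <= \sum_(j < n) wt j * (a j - s) ^+ 2.
  by apply: sumr_ge0 => j _; rewrite mulr_ge0 ?wt_ge0 ?sqr_ge0.
have -> : \sum_(j < n) wt j * (a j - s) ^+ 2 =
    \sum_(j < n) wt j * a j ^+ 2 - 2 * s * s + s ^+ 2 * \sum_(j < n) wt j.
  have -> : 2 * s * s = \sum_(j < n) 2 * s * (wt j * a j).
    by rewrite -mulr_sumr -sE.
  by rewrite mulr_sumr -sumrB -big_split /=; apply: eq_bigr => j _; ring.
have := sum_wt_le1 n; have := sqr_ge0 s; nra.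
Qed.

Lemma nm_sum_wt (X : normedModType C) (x : nat -> X) n :
  nm (\sum_(j < n) (wt j)%:C *: x j) <= \sum_(j < n) wt j * nm (x j).
Proof.
elim: n => [|n IH]; first by rewrite !big_ord0 nm0.
rewrite !big_ord_recr /= (le_trans (nmD _ _))// lerD// nmZ nmR ger0_norm ?wt_ge0//.
Qed.

Lemma nm_sum_wt_le (X : normedModType C) (x : nat -> X) n (c : R) :
  (forall j, nm (x j) <= c) -> nm (\sum_(j < n) (wt j)%:C *: x j) <= c.
Proof.
move=> xc; apply: (le_trans (nm_sum_wt _ _)).
apply: (@le_trans _ _ ((\sum_(j < n) wt j) * c)).
  by rewrite mulr_suml; apply: ler_sum => j _; rewrite ler_wpM2l ?wt_ge0.
have c0 : 0 <= c by apply: le_trans (xc 0%N); exact: nm_ge0.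
by rewrite ler_piMl// sum_wt_le1.
Qed.

Lemma geometric_sum (X : normedModType C) (x : nat -> X) (c : R) : seq_complete X ->
  (forall j, nm (x j) <= c) -> exists g : nat -> X, forall n,
    tends (fun N => \sum_(j < N) (wt j)%:C *: x (n + j)%N) (g n) /\
    g n = (2 / 3)%:C *: x n + (1 / 3)%:C *: g n.+1.
Proof.
move=> Xc xc; have c0 : 0 <= c by apply: le_trans (xc 0%N); exact: nm_ge0.
have lim n : exists l, tends (fun N => \sum_(j < N) (wt j)%:C *: x (n + j)%N) l.
  apply: Xc => e e0; have [N NP] := pow2_small c e0; exists N.
  have diff k l : (N <= k)%N -> (k <= l)%N ->
    nm (\sum_(j < l) (wt j)%:C *: x (n + j)%N - \sum_(j < k) (wt j)%:C *: x (n + j)%N) <= e.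
    move=> Nk kl; have h := @nm_sum_le _ _ (fun j => (wt j)%:C *: x (n + j)%N)
      (fun j => wt j * c) l k _ kl.
    apply: (le_trans (h _)).
      by move=> j; rewrite nmZ nmR ger0_norm ?wt_ge0// ler_wpM2l ?wt_ge0.
    rewrite -!mulr_suml -mulrBl !sum_wt; apply: le_trans (ltW NP).
    rewrite mulrC ler_wpM2l//.
    rewrite (_ : 1 - 3 ^- l - (1 - 3 ^- k) = 3 ^- k - 3 ^- l); last by ring.
    have h2 : 3 ^- k <= 2 ^- N :> R.
      rewrite lef_pV2 ?posrE ?exprn_gt0//.
      apply: (@le_trans _ _ (3 ^+ N)); first by rewrite lerXn2r ?nnegrE// ler_nat.
      by rewrite ler_weXn2l// ler1n.
    apply: le_trans h2; rewrite gerBl invr_ge0 exprn_ge0//.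
  move=> k l Nk Nl; have [kl|/ltnW lk] := leqP k l; last exact: diff.
  by rewrite nm_distC diff.
have /choice[g gP] := lim; exists g => n; split=> //.
apply: (tends_unique (u := fun N => \sum_(j < N.+1) (wt j)%:C *: x (n + j)%N)).
  by move=> e /(gP n)[N NP]; exists N => k Nk; apply: NP; rewrite leqW.
have h := tendsZ (1 / 3)%:C (gP n.+1).
move=> e /h[N NP]; exists N => k /NP; congr (nm _ <= _).
rewrite big_ord_recl /= addn0 {2}/wt expr0 divr1.
rewrite opprD addrACA subrr add0r; congr (_ - _).
rewrite scaler_sumr; apply: eq_bigr => j _; rewrite scalerA -rmorphM /=.
rewrite /bump /= add1n addnS addSn; congr (_%:C *: _).
by rewrite /wt exprS; field; rewrite expf_neq0.
Qed.

End GeometricSums.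

(** * The unit ball of the Hardy space *)

Section HardyBall.
Variable R : realType.
Local Notation C := R[i].
Variables (Omega : set C) (z0 : C).
Hypotheses (oO : open Omega) (cO : connected Omega) (Oz0 : Omega z0).

Lemma region_disc a : Omega a -> exists2 r : R, 0 < r & forall z, nm (z - a) < r -> Omega z.
Proof. by move=> Oa; have /nbhs_nm[r r0 rP] := open_nbhs_nbhs (conj oO Oa); exists r. Qed.

Lemma harmonic_scale u (c : R) : harmonic_on Omega u -> harmonic_on Omega (fun z => c * u z).
Proof.
move=> uh; apply: real_part_harmonic => a Oa; have [r r0 rO] := region_disc Oa.
have [F FP] := harmonic_real_part r0 uh rO.
exists (r / 2); first by rewrite divr_gt0.
exists (fun z => c%:C * F z) => z /FP[-> [D FD]]; split.
  by case: (F z) => x y /=; ring.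
by eexists; exact: hasdM (@hasd_cst _ _ (c%:C) z) FD.
Qed.

Lemma pos_harmonic_scale u (c : R) : 0 <= c -> pos_harmonic Omega u ->
  pos_harmonic Omega (fun z => c * u z).
Proof.
move=> c0 [uh u0]; split; first exact: harmonic_scale.
by move=> z Oz; rewrite mulr_ge0// u0.
Qed.

Lemma harmonic_cst (c : R) : harmonic_on Omega (fun=> c).
Proof.
apply: real_part_harmonic => a Oa; exists 1 => //; exists (fun=> c%:C) => z _.
by split=> //; exists 0; exact: hasd_cst.
Qed.

Variables (X : normedModType C) (L : set (X -> C)).
Hypotheses (Xc : seq_complete X) (LX : norming L).

(** The unit ball of the Hardy space for the norm given by the value at [z0] of
    the least harmonic majorant of the squared norm. *)
Definition hardy_ball (f : C -> X) :=
  (forall z, Omega z -> exists d, hasd f z d) /\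
  exists u, [/\ pos_harmonic Omega u, u z0 <= 1 &
    forall z, Omega z -> nm (f z) ^+ 2 <= u z].

Lemma sqr_bound (x c : R) : 0 <= x -> x ^+ 2 <= c -> x <= 1 + c.
Proof. by move=> x0 xc; nra. Qed.

(** Evaluations are bounded on the ball, locally uniformly, by Harnack's
    inequality for the majorants. *)
Lemma hardy_ball_bounded a : Omega a -> exists2 r : R, 0 < r &
  (forall z, nm (z - a) < r -> Omega z) /\
  exists c : R, forall f, hardy_ball f -> forall z, nm (z - a) < r -> nm (f z) <= c.
Proof.
move=> Oa; have [r r0 rO] := region_disc Oa; have [c c0 cP] := harnack oO cO Oz0 Oa.
exists (r / 96); first by rewrite divr_gt0.
split; first by move=> z zr; apply: rO; lra.
exists (1 + 2 * c) => f [fh [u [up u1 fu]]] z zr.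
have Oz : Omega z by apply: rO; lra.
apply: sqr_bound (nm_ge0 _) _; apply: (le_trans (fu z Oz)).
have [F /(_ z zr)[-> _ Fz]] := pos_harmonic_representation r0 rO up.
have := Re_le_nm (F z); have := cP u up; nra.
Qed.

(** Completeness of the Hardy space, in the form that the gliding hump argument
    consumes: the weighted sums of a sequence in the ball converge and stay in
    the ball.  A majorant of the sum is the weighted sum of the majorants, by
    Jensen's inequality and Harnack's theorem. *)
Lemma hardy_ball_series (f : nat -> C -> X) : (forall n, hardy_ball (f n)) ->
  exists g : nat -> C -> X, forall n, hardy_ball (g n) /\
    forall z, Omega z -> g n z = (2 / 3)%:C *: f n z + (1 / 3)%:C *: g n.+1 z.
Proof.
move=> fB; have gz z : exists g : nat -> X, Omega z -> forall n,
    tends (fun N => \sum_(j < N) (wt R j)%:C *: f (n + j)%N z) (g n) /\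
    g n = (2 / 3)%:C *: f n z + (1 / 3)%:C *: g n.+1.
  have [Oz|nOz] := pselect (Omega z); last by exists (fun=> 0) => /nOz.
  have [r r0 [_ [c cP]]] := hardy_ball_bounded Oz.
  have zz : nm (z - z) < r by rewrite subrr nm0.
  have [g gP] := geometric_sum Xc (fun j => cP (f j) (fB j) z zz).
  by exists g.
have /choice[g gP] := gz; exists (fun n z => g z n) => n.
split; last by move=> z /gP/(_ n)[].
split.
  move=> a Oa; have [r r0 [rO [c cP]]] := hardy_ball_bounded Oa.
  apply: (@hasd_limit _ _ L (fun N z => \sum_(j < N) (wt R j)%:C *: f (n + j)%N z)
    (g ^~ n) a r c LX Xc r0).
  - move=> N z zr; apply: (@hasd_sum _ _ (fun j z => (wt R j)%:C *: f (n + j)%N z)) => j.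
    have [d fd] := (fB (n + j)%N).1 z (rO z zr).
    by eexists; exact: hasdZ (@hasd_cst _ _ ((wt R j)%:C) z) fd.
  - by move=> N z zr; apply: (@nm_sum_wt_le _ _ (fun j => f (n + j)%N z)) => j; exact: cP.
  - by move=> z zr; case: (gP z (rO z zr) n).
have /choice[u uP] : forall j, exists u, [/\ pos_harmonic Omega u, u z0 <= 1 &
    forall z, Omega z -> nm (f (n + j)%N z) ^+ 2 <= u z] by move=> j; case: (fB (n + j)%N).
have [||U [Up U1 UP]] := @harnack_series _ Omega z0 (fun j z => wt R j * u j z) 1 oO cO Oz0.
- by move=> j; apply: pos_harmonic_scale; [exact: wt_ge0|case: (uP j)].
- move=> N; apply: le_trans (sum_wt_le1 R N); apply: ler_sum => j _.
  by rewrite -[leRHS]mulr1 ler_wpM2l ?wt_ge0//; case: (uP j).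
exists U; split=> // z Oz; have [gt _] := gP z Oz n.
have U0 : 0 <= U z by have := UP z Oz 0%N; rewrite big_ord0.
rewrite -(sqr_sqrtr U0) ler_sqr ?nnegrE ?nm_ge0 ?sqrtr_ge0//.
apply: (tends_nm_le gt) => N; rewrite -ler_sqr ?nnegrE ?nm_ge0 ?sqrtr_ge0// sqr_sqrtr//.
apply: le_trans (UP z Oz N).
apply: (@le_trans _ _ (\sum_(j < N) wt R j * nm (f (n + j)%N z) ^+ 2)); last first.
  by apply: ler_sum => j _; rewrite ler_wpM2l ?wt_ge0//; case: (uP j) => _ _; exact.
apply: le_trans (sum_wt_sqr (fun j => nm (f (n + j)%N z)) N).
rewrite ler_sqr ?nnegrE ?nm_ge0//; last first.
  by apply: sumr_ge0 => j _; rewrite mulr_ge0 ?wt_ge0 ?nm_ge0.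
exact: (nm_sum_wt (fun j => f (n + j)%N z)).
Qed.

Lemma hardy_ballN f : hardy_ball f -> hardy_ball (fun z => - f z).
Proof.
move=> [fh [u [up u1 fu]]]; split.
  by move=> z /fh[d fd]; eexists; exact: hasdN fd.
by exists u; split=> // z Oz; rewrite nmN fu.
Qed.

Lemma hardy_ball_cst (x : X) : nm x <= 1 -> hardy_ball (fun=> x).
Proof.
move=> x1; split; first by move=> z _; exists 0; exact: hasd_cst.
exists (fun=> 1); split=> //; first by split=> //; exact: harmonic_cst.
by move=> z _; rewrite expr_le1// nm_ge0.
Qed.

End HardyBall.

(** * The function spaces in terms of real-valued norms *)

Section Translation.
Variable R : realType.
Local Notation C := R[i].
Variable Omega : set C.

Lemma holomorphic_onP (X : normedModType C) (f : C -> X) :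
  holomorphic_on Omega f <-> forall z, Omega z -> exists d, hasd f z d.
Proof. by split=> fh z /fh /derivable_hasd. Qed.

Lemma boundedP (X : normedModType C) (f : C -> X) :
  [bounded f z | z in Omega] <-> exists M : R, forall z, Omega z -> nm (f z) <= M.
Proof.
split.
  move=> /pinfty_ex_gt0[r r0 rf]; exists (complex.Re r) => z Oz.
  have rE : (complex.Re r)%:C = r by rewrite RRe_real// gtr0_real.
  by rewrite -lecR rE nmE; exact: rf.
move=> [M MP]; rewrite /bounded_near; near=> r => z Oz /=.
rewrite -nmE (@le_trans _ _ (Num.max 0 M)%:C) ?lecR ?le_max ?MP ?orbT//.
by near: r; apply: nbhs_pinfty_ge; rewrite ger0_real// ler0c le_max lexx.
Unshelve. all: by end_near. Qed.

Lemma HinftyP (X : normedModType C) (f : C -> X) : Hinfty Omega f <->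
  (forall z, Omega z -> exists d, hasd f z d) /\
  exists M : R, forall z, Omega z -> nm (f z) <= M.
Proof.
by split=> -[/holomorphic_onP h /boundedP b].
Qed.

Lemma H2P (X : normedModType C) (f : C -> X) : H2 Omega f <->
  (forall z, Omega z -> exists d, hasd f z d) /\
  exists2 u, pos_harmonic Omega u & forall z, Omega z -> nm (f z) ^+ 2 <= u z.
Proof.
have E z (c : R) : (`|f z| ^+ 2 <= c%:C) = (nm (f z) ^+ 2 <= c).
  by rewrite -nmE -rmorphXn lecR.
split=> -[/holomorphic_onP fh [u uh fu]]; split=> //.
  exists u; last by move=> z Oz; rewrite -E fu.
  by split=> // z Oz; apply: le_trans (sqr_ge0 (nm (f z))) _; rewrite -E fu.
by exists u; [case: uh|move=> z Oz; rewrite E fu].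
Qed.

Lemma op_hasd (K : normedModType C) (A : C -> bop K) (f : C -> K) z d d' :
  hasd A z d -> hasd f z d' -> hasd (fun w => A w (f w)) z (d (f z) + A z d').
Proof.
apply: (@hasd_bilinear R (bop K) K K (fun A x => A x)) => //.
- by move=> B x y; rewrite linearD.
- by move=> c B x; rewrite linearZ.
- by move=> B x; exact: nm_bop.
Qed.

(** Nontangential limits are limits of values inside the region, so a nonzero
    one excludes the zero function; such limits exist because the boundary has
    full harmonic measure. *)
Lemma quasi_inner_neq0 (z0 : C) (m : probability (borelC R) R) (theta : C -> C) :
  harmonic_measure Omega z0 m -> quasi_inner Omega m theta ->
  exists2 z, Omega z & theta z != 0.
Proof.
move=> [m1 _] [c c0 [N [mN mN0 thetaN]]].
have [[zeta [bz nz]]|none] := pselect (exists zeta, boundary Omega zeta /\ ~ N zeta); last first.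
  have sub : boundary Omega `<=` N.
    by move=> zeta bz; apply: contrapT => nz; apply: none; exists zeta.
  have mopen (A : set C) : open A -> measurable (A : set (borelC R)).
    by move=> oA; exact: sub_sigma_algebra.
  have mb : measurable (boundary Omega : set (borelC R)).
    apply: measurableD; last by apply: mopen; exact: open_interior.
    rewrite -[closure _]setCK; apply: measurableC; apply: mopen.
    by apply: closed_openC; exact: closed_closure.
  have : (m (boundary Omega) <= m N)%E by apply: le_measure; rewrite ?inE.
  by rewrite m1 mN0 lee_fin ler10.
have [l [[a a0 cl] lim] cl_] : exists2 l, nt_limit Omega theta zeta l & c%:C <= `|l|.
  by apply: contrapT => h; apply: nz; apply: thetaN => /= /(_ bz).
have l0 : 0 < nm l by rewrite -(ltcR 0) nmE (lt_le_trans _ cl_)// (ltcR 0).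
have H : (\forall z \near zeta, nt_region Omega zeta a z -> nm (theta z - l) < nm l).
  have /cvg_nm/(_ _ l0) := lim a a0; exact.
have [z [reg /(_ reg) zl]] := cl _ H; exists z; first by case: reg.
by apply: contraTneq zl => ->; rewrite sub0r nmN ltxx.
Qed.

End Translation.

(** * Duality in the Hilbert space *)

Section HilbertSpace.
Variables (R : realType).
Local Notation C := R[i].
Variables (K : completeNormedModType C) (dot : {dot K for conjC}).
Hypothesis normK : forall x : K, `|x| ^+ 2 = dot x x.

Lemma nm_dot x y : nm (dot x y : C) <= nm x * nm y.
Proof. by rewrite -lecR rmorphM /= !nmE; exact: dot_le_norm. Qed.

Lemma dot_self x : dot x x = (nm x ^+ 2)%:C.
Proof. by rewrite -normK -nmE rmorphXn. Qed.

Lemma nm_conj (w : C) : nm (conjC w : C) = nm w.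
Proof. by rewrite /nm norm_conjC. Qed.

Lemma nm_dual x (M : R) : 0 <= M ->
  (forall y, nm y <= 1 -> nm (dot x y : C) <= M) -> nm x <= M.
Proof.
move=> M0 xM; have [->|x0] := eqVneq x 0; first by rewrite nm0.
have nx : 0 < nm x by rewrite nm_gt0.
have := xM ((nm x)^-1%:C *: x); rewrite nmZ nmR ger0_norm ?invr_ge0 ?nm_ge0//.
rewrite mulVf ?gt_eqF// => /(_ (lexx 1)).
rewrite linearZr_LR /= dot_self nmM.
have -> : nm (conjC ((nm x)^-1%:C) : C) = (nm x)^-1.
  by rewrite nm_conj nmR ger0_norm// invr_ge0 nm_ge0.
by rewrite nmR ger0_norm ?sqr_ge0// expr2 mulKf ?gt_eqF.
Qed.

Lemma norming_dot : norming [set l : K -> C | exists2 y, nm y <= 1 & l = dot^~ y].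
Proof.
split=> [_ [y y1 ->]|x M M0 xM].
  split; first by move=> a x z; rewrite /= linearDl linearZl_LR.
  move=> x; apply: (le_trans (nm_dot _ _)).
  by rewrite -[leRHS]mulr1 ler_wpM2l ?nm_ge0.
by apply: nm_dual => // y y1; apply: (xM (dot^~ y)); exists y.
Qed.

Lemma norming_op : norming [set l : bop K -> C |
  exists k y, [/\ nm k <= 1, nm y <= 1 & l = fun A : bop K => dot (A k) y]].
Proof.
split=> [_ [k [y [k1 y1 ->]]]|A M M0 AM].
  split; first by move=> a A B /=; rewrite linearDl linearZl_LR.
  move=> A; apply: (le_trans (nm_dot _ _)); rewrite -[leRHS]mulr1.
  apply: ler_pM => //; rewrite ?nm_ge0//.
  by rewrite (le_trans (nm_bop _ _))// -[leRHS]mulr1 ler_wpM2l ?nm_ge0.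
apply: nm_bop_le => // k; have [->|k0] := eqVneq k 0.
  by rewrite linear0 nm0 mulr0.
have nk : 0 < nm k by rewrite nm_gt0.
have nV : nm ((nm k)^-1%:C : C) = (nm k)^-1.
  by rewrite nmR ger0_norm// invr_ge0 nm_ge0.
rewrite -ler_pdivrMr// mulrC -nV -nmZ -linearZ; apply: nm_dual => // y y1.
apply: (AM (fun A : bop K => dot (A ((nm k)^-1%:C *: k)) y)); exists ((nm k)^-1%:C *: k), y; split=> //.
by rewrite nmZ nV mulVf// gt_eqF.
Qed.

(** The order relation between the two positive operators says that the adjoint
    of [A] is bounded by [c], and an operator and its adjoint have the same norm. *)
Lemma adjoint_le (A : bop K) (c : R) : 0 <= c ->
  bop_le dot (bop_comp A (adjoint dot A)) ((c ^+ 2)%:C *: bop_id K) <->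
  forall k, nm (A k) <= c * nm k.
Proof.
move=> c0; have adj := adjointP normK A.
have E x : dot (((c ^+ 2)%:C *: bop_id K - bop_comp A (adjoint dot A)) x) x =
    ((c * nm x) ^+ 2 - nm (adjoint dot A x) ^+ 2)%:C.
  rewrite bopB linearBl /= linearZl_LR /= adj !dot_self.
  by rewrite exprMn -rmorphM -rmorphB.
have le_iff : bop_le dot (bop_comp A (adjoint dot A)) ((c ^+ 2)%:C *: bop_id K) <->
    forall k, nm (adjoint dot A k) <= c * nm k.
  have sq k : (0 <= dot (((c ^+ 2)%:C *: bop_id K - bop_comp A (adjoint dot A)) k) k) =
      (nm (adjoint dot A k) <= c * nm k).
    by rewrite E ler0c subr_ge0 ler_sqr ?nnegrE ?mulr_ge0 ?nm_ge0.
  by split=> H k; [rewrite -sq; exact: H|rewrite sq; exact: H].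
rewrite le_iff; split=> H k.
  have [->|k0] := eqVneq (A k) 0; first by rewrite nm0 mulr_ge0 ?nm_ge0.
  rewrite -(@ler_pM2r _ (nm (A k))) ?nm_gt0// -expr2.
  have -> : nm (A k) ^+ 2 = nm (dot (A k) (A k) : C).
    by rewrite dot_self nmR ger0_norm ?sqr_ge0.
  rewrite adj (le_trans (nm_dot _ _))// mulrAC mulrC ler_wpM2r ?nm_ge0 ?H//.
have [->|k0] := eqVneq (adjoint dot A k) 0; first by rewrite nm0 mulr_ge0 ?nm_ge0.
rewrite -(@ler_pM2r _ (nm (adjoint dot A k))) ?nm_gt0// -expr2.
have -> : nm (adjoint dot A k) ^+ 2 = nm (dot (adjoint dot A k) (adjoint dot A k) : C).
  by rewrite dot_self nmR ger0_norm ?sqr_ge0.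
by rewrite -adj (le_trans (nm_dot _ _))// mulrAC ler_wpM2r ?nm_ge0 ?H.
Qed.

End HilbertSpace.

(** * Division and domination *)

Section Division.
Variables (R : realType).
Local Notation C := R[i].
Variables (K : completeNormedModType C) (dot : {dot K for conjC}).
Hypothesis normK : forall x : K, `|x| ^+ 2 = dot x x.
Variables (Omega : set C) (z0 z1 : C) (theta : C -> C) (phi : C -> bop K).
Hypotheses (oO : open Omega) (cO : connected Omega) (Oz0 : Omega z0).
Hypotheses (theta_hol : forall z, Omega z -> exists d, hasd theta z d)
  (phi_hol : forall z, Omega z -> exists d, hasd phi z d).
Hypotheses (Oz1 : Omega z1) (theta_z1 : theta z1 != 0).

Definition dominated (c : R) :=
  forall z, Omega z -> forall k, nm (phi z k) <= c * nm (theta z) * nm k.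

Lemma divides_Hinfty : divides Omega theta phi ->
  op_image Omega phi (Hinfty Omega (X := K)) `<=`
    scalar_image Omega theta (Hinfty Omega (X := K)).
Proof.
move=> [psi /HinftyP[psih [M MP]] phiE] g [f /HinftyP[fh [N NP]] gE].
exists (fun z => psi z (f z)); last by move=> z Oz; rewrite gE// phiE.
apply/HinftyP; split.
  move=> z Oz; have [d psid] := psih z Oz; have [d' fd] := fh z Oz.
  by eexists; exact: op_hasd psid fd.
exists (M * N) => z Oz; apply: (le_trans (nm_bop _ _)).
by rewrite ler_pM ?nm_ge0 ?MP ?NP.
Qed.

Lemma divides_H2 : divides Omega theta phi ->
  op_image Omega phi (H2 Omega (X := K)) `<=`
    scalar_image Omega theta (H2 Omega (X := K)).
Proof.
move=> [psi /HinftyP[psih [M MP]] phiE] g [f /H2P[fh [u up fu]] gE].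
exists (fun z => psi z (f z)); last by move=> z Oz; rewrite gE// phiE.
apply/H2P; split.
  move=> z Oz; have [d psid] := psih z Oz; have [d' fd] := fh z Oz.
  by eexists; exact: op_hasd psid fd.
exists (fun z => M ^+ 2 * u z); first by apply: pos_harmonic_scale => //; exact: sqr_ge0.
move=> z Oz; have M0 : 0 <= M by apply: le_trans (MP z Oz); exact: nm_ge0.
apply: (@le_trans _ _ ((M * nm (f z)) ^+ 2)).
  rewrite ler_sqr ?nnegrE ?mulr_ge0 ?nm_ge0// (le_trans (nm_bop _ _))//.
  by rewrite ler_wpM2r ?nm_ge0 ?MP.
by rewrite exprMn ler_wpM2l ?sqr_ge0 ?fu.
Qed.

(** Off the zeros of [theta], which are isolated, the quotient is bounded by [c];
    at the zeros it has removable singularities. *)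
Lemma dominated_divides (c : R) : 0 <= c -> dominated c -> divides Omega theta phi.
Proof.
move=> c0 phic; pose q z := (theta z)^-1 *: phi z.
have q_le z : Omega z -> theta z != 0 -> nm (q z) <= c.
  move=> Oz tz; apply: nm_bop_le => // k; rewrite /q /= nmZ nmV.
  by rewrite ler_pdivrMl ?nm_gt0// mulrA [_ * c]mulrC phic.
have q_hol z : Omega z -> theta z != 0 -> exists d, hasd q z d.
  move=> Oz tz; have [d td] := theta_hol Oz; have [d' pd] := phi_hol Oz.
  by eexists; exact: hasdZ (hasdV td tz) pd.
have iso := isolated_zeros oO cO Oz1 theta_z1 theta_hol.
have /choice[x xP] a : exists x : bop K, Omega a -> theta a = 0 -> nm x <= c /\
    exists d, hasd (fun z => if z == a then x else q z) a d.
  have [Oa|nO] := pselect (Omega a); last by exists 0 => /nO.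
  have [r r0 rO] := region_disc oO Oa; have [s s0 sP] := iso a Oa.
  have t0 : 0 < Num.min r s by rewrite lt_min r0.
  have [||x xc xd] := @removable _ _ _ q a (Num.min r s) c (norming_op normK)
    (@bop_complete R K) t0 c0.
  - apply: (weakly_holomorphicW (norming_op normK)) => z [za].
    rewrite lt_min => /andP[zr zs]; apply: q_hol; [exact: rO|exact: sP].
  - move=> z za; rewrite lt_min => /andP[zr zs].
    by apply: q_le; [exact: rO|exact: sP].
  by exists x.
pose psi z := if theta z == 0 then x z else q z.
exists psi; last first.
  move=> z Oz; rewrite /psi; case: eqVneq => [tz|tz].
    rewrite tz scale0r; apply: bopP => k; apply/eqP; rewrite -nm_le0.
    by have := phic z Oz k; rewrite tz nm0 mulr0 mul0r.
  by rewrite /q scalerA mulfV// scale1r.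
apply/HinftyP; split; last first.
  exists c => z Oz; rewrite /psi; case: eqVneq => [tz|tz]; last exact: q_le.
  by case: (xP z Oz tz).
move=> a Oa; have [s s0 sP] := iso a Oa.
have [ta|ta] := eqVneq (theta a) 0.
  have [_ [d xd]] := xP a Oa ta; exists d; apply: (hasd_ext _ xd).
  apply/nbhs_nm; exists s => // z zs; rewrite /psi.
  by have [->|za] := eqVneq z a; rewrite ?ta ?eqxx// (negPf (sP z za zs)).
have [d qd] := q_hol a Oa ta; exists d; apply: (hasd_ext _ qd).
apply/nbhs_nm; exists s => // z zs; rewrite /psi.
by have [->|za] := eqVneq z a; rewrite ?(negPf ta)// (negPf (sP z za zs)).
Qed.

Lemma domination (c : R) :
  (forall z, Omega z -> theta z = 0 -> phi z = 0) ->
  (forall z, Omega z -> theta z != 0 -> forall k, nm k <= 1 ->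
    nm (phi z k) <= c * nm (theta z)) -> exists2 c : R, 0 < c & dominated c.
Proof.
move=> phi0 phic; exists (`|c| + 1); first by rewrite ltr_wpDl.
move=> z Oz k; have [->|k0] := eqVneq k 0; first by rewrite linear0 nm0 mulr0.
have [tz|tz] := eqVneq (theta z) 0.
  by rewrite phi0// nm0 !mulr_ge0 ?nm_ge0 ?addr_ge0.
have nk : 0 < nm k by rewrite nm_gt0.
have nV : nm ((nm k)^-1%:C : C) = (nm k)^-1.
  by rewrite nmR ger0_norm// invr_ge0 nm_ge0.
have := phic z Oz tz ((nm k)^-1%:C *: k); rewrite linearZ !nmZ nV mulVf ?gt_eqF//.
move=> /(_ (lexx 1)); rewrite mulrC ler_pdivrMr// => /le_trans; apply.
rewrite ler_wpM2r ?nm_ge0// ler_wpM2r ?nm_ge0//.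
by have := ler_norm c; lra.
Qed.

(** Uniform boundedness on the unit ball of [K], the inclusion being tested on
    constant functions. *)
Lemma Hinfty_dominated :
  op_image Omega phi (Hinfty Omega (X := K)) `<=`
    scalar_image Omega theta (Hinfty Omega (X := K)) ->
  exists2 c : R, 0 < c & dominated c.
Proof.
move=> sub; have cst k : exists2 f : C -> K, Hinfty Omega f &
    forall z, Omega z -> phi z k = theta z *: f z.
  have [|f fH fE] := sub (fun z => phi z k); last by exists f.
  exists (fun=> k) => //; apply/HinftyP; split; last by exists (nm k).
  by move=> z _; exists 0; exact: hasd_cst.
pose T (z : {z | Omega z /\ theta z != 0}) (k : K) :=
  nm (phi (sval z) k) / nm (theta (sval z)).
have [|||||||c cP] := @gliding_hump R K [set k | nm k <= 1] setT _ T.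
- move=> z x y; rewrite /T -mulrDl ler_wpM2r ?invr_ge0 ?nm_ge0//.
  by rewrite linearD nmD.
- by move=> z a x a0; rewrite /T linearZ nmZ nmR ger0_norm// mulrA.
- by move=> z x; rewrite /T linearN nmN.
- by move=> x; rewrite /= nmN.
- move=> f f1; have [g gP] := geometric_sum (@complete_seq_complete R K) f1.
  exists g; split=> // n; have [gt gE] := gP n; split.
    by apply: (tends_nm_le gt) => M; apply: (nm_sum_wt_le (x := fun j => f (n + j)%N)) => j; exact: f1.
  by move=> z; rewrite -gE subrr /T linear0 nm0 mul0r.
- move=> z; exists (nm (phi (sval z)) / nm (theta (sval z))) => k k1.
  rewrite /T ler_wpM2r ?invr_ge0 ?nm_ge0// (le_trans (nm_bop _ _))//.
  by rewrite -[leRHS]mulr1 ler_wpM2l ?nm_ge0.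
- move=> k _; have [f /HinftyP[_ [M MP]] fE] := cst k; exists M => -[z [Oz tz]].
  rewrite /T /= fE// nmZ mulrAC mulfV ?mul1r ?MP//.
  by rewrite gt_eqF// nm_gt0.
apply: (@domination c).
  move=> z Oz tz; apply: bopP => k; have [f _ fE] := cst k.
  by rewrite fE// tz scale0r.
move=> z Oz tz k k1; have := cP (exist _ z (conj Oz tz)) k k1.
by rewrite /T /= ler_pdivrMr ?nm_gt0.
Qed.

(** Uniform boundedness on the ball of the Hardy space for the evaluations of
    [phi f / theta], each divided by the norm [N z] of the evaluation at [z]. *)
Lemma H2_dominated :
  op_image Omega phi (H2 Omega (X := K)) `<=`
    scalar_image Omega theta (H2 Omega (X := K)) ->
  exists2 c : R, 0 < c & dominated c.
Proof.
move=> sub; pose B := @hardy_ball R Omega z0 K.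
pose E z := [set nm (f z) | f in B].
pose N z := sup (E z).
have B0 : B (fun=> 0) by apply: hardy_ball_cst => //; rewrite nm0.
have hE z : Omega z -> has_sup (E z).
  move=> Oz; split; first by exists (nm (0 : K)), (fun=> 0).
  have [r r0 [_ [c cP]]] := hardy_ball_bounded oO cO Oz0 K Oz.
  by exists c => _ [f fB <-]; apply: cP => //; rewrite subrr nm0.
have NP z f : Omega z -> B f -> nm (f z) <= N z.
  by move=> Oz fB; apply: (ub_le_sup (hE z Oz).2); exists f.
have N0 z : Omega z -> 0 <= N z by move=> Oz; apply: le_trans (NP z _ Oz B0); exact: nm_ge0.
pose T (z : {z | Omega z /\ theta z != 0}) (f : C -> K) :=
  nm (phi (sval z) (f (sval z))) / (nm (theta (sval z)) * N (sval z)).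
have den z : Omega z -> 0 <= (nm (theta z) * N z)^-1.
  by move=> Oz; rewrite invr_ge0 mulr_ge0 ?nm_ge0 ?N0.
have [|||||||c cP] := @gliding_hump R (C -> K) B (H2 Omega (X := K)) _ T.
- move=> [z [Oz tz]] f g; rewrite /T /= -mulrDl ler_wpM2r ?den//.
  by rewrite linearD nmD.
- by move=> z a f a0; rewrite /T /= linearZ nmZ nmR ger0_norm// mulrA.
- by move=> z f; rewrite /T /= linearN nmN.
- by move=> f; exact: hardy_ballN.
- move=> f fB; have [g gP] := hardy_ball_series oO cO Oz0
    (@complete_seq_complete R K) (norming_dot normK) fB.
  exists g; split.
    by apply/H2P; have [[gh [u [up _ gu]]] _] := gP 0%N; split=> //; exists u.
  move=> n; have [gB gE] := gP n; split=> // -[z [Oz tz]].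
  rewrite /T /= (_ : (g n - _) z = 0) ?linear0 ?nm0 ?mul0r//.
  by rewrite -[LHS]/(g n z - ((2 / 3)%:C *: f n z + (1 / 3)%:C *: g n.+1 z)) gE// subrr.
- move=> [z [Oz tz]]; exists (nm (phi z) * N z / (nm (theta z) * N z)) => f fB.
  rewrite /T /= ler_wpM2r ?den// (le_trans (nm_bop _ _))//.
  by rewrite ler_wpM2l ?nm_ge0 ?NP.
- move=> f fH; have [|h /H2P[hh [v vp hv]] hE'] := sub (fun z => phi z (f z)).
    by exists f.
  (* The 1 makes [S] positive, so that [h] can be scaled into the ball. *)
  pose S := 1 + v z0; have S0 : 0 < S by rewrite ltr_pwDl// vp.2.
  pose s := Num.sqrt S; have s0 : 0 < s by rewrite sqrtr_gt0.
  have hB : B (fun z => s^-1%:C *: h z).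
    split.
      move=> z /hh[d hd].
      by eexists; exact: hasdZ (@hasd_cst _ _ (s^-1%:C) z) hd.
    exists (fun z => S^-1 * v z); split.
    + by apply: pos_harmonic_scale => //; rewrite invr_ge0 ltW.
    + by rewrite mulrC ler_pdivrMr// mul1r /S lerDr.
    + move=> z Oz; rewrite nmZ nmR ger0_norm ?invr_ge0 ?(ltW s0)// exprMn exprVn sqr_sqrtr ?(ltW S0)//.
      by rewrite ler_pM2l ?invr_gt0// hv.
  exists s => -[z [Oz tz]]; rewrite /T /= hE'// nmZ.
  have := NP z _ Oz hB; rewrite nmZ nmR ger0_norm ?invr_ge0 ?(ltW s0)// => h1.
  have nt : nm (theta z) != 0 by rewrite gt_eqF// nm_gt0.
  rewrite invfM mulrACA mulfV// mul1r.
  have [n0|n0] := eqVneq (N z) 0; first by rewrite n0 invr0 mulr0 ltW.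
  rewrite ler_pdivrMr; last by rewrite lt0r n0 N0.
  by move: h1; rewrite mulrC ler_pdivrMr// mulrC.
have cst k : exists f : C -> K, forall z, Omega z -> phi z k = theta z *: f z.
  have [|f _ fE] := sub (fun z => phi z k); last by exists f.
  exists (fun=> k) => //; apply/H2P; split.
    by move=> z _; exists 0; exact: hasd_cst.
  exists (fun=> nm k ^+ 2) => //; split; first exact: harmonic_cst.
  by move=> z _; rewrite sqr_ge0.
apply: (@domination (2 * `|c|)).
  move=> z Oz tz; apply: bopP => k; have [f fE] := cst k.
  by rewrite fE// tz scale0r.
move=> z Oz tz k k1.
have nt : 0 < nm (theta z) by rewrite nm_gt0.
have [n0|n0] := eqVneq (N z) 0.
  have kB : B (fun=> k) by apply: hardy_ball_cst.
  have := NP z _ Oz kB; rewrite n0 nm_le0 => /eqP ->.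
  by rewrite linear0 nm0 mulr_ge0 ?nm_ge0//.
have Npos : 0 < N z by rewrite lt0r n0 N0.
have [_ [f fB <-] fN] := sup_adherent (divr_gt0 Npos (ltr0n _ 2)) (hE z Oz).
rewrite -/(N z) in fN.
have fz0 : 0 < nm (f z) by lra.
pose e := ((nm (f z))^-1)%:C *: f z.
have e1 : nm e <= 1.
  by rewrite nmZ nmR ger0_norm ?invr_ge0 ?nm_ge0// mulVf// gt_eqF.
(* Pairing [f], nearly of maximal size at [z], with the direction of [f z] gives
   a scalar function of the same size at [z], which can carry any vector [k]. *)
pose g w := (dot (f w) e : C) *: k.
have gB : B g.
  have [fh [u [up u1 fu]]] := fB; split.
    have [ll lM] := (norming_dot normK).1 (dot^~ e) (ex_intro2 _ _ e e1 erefl).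
    have bl : exists2 M : R, 0 < M & forall x, nm (dot x e : C) <= M * nm x.
      by exists 1 => // x; rewrite mul1r; exact: lM.
    move=> w /fh[d fd]; eexists.
    exact: hasdZ (hasd_linear ll bl fd) (@hasd_cst _ _ k w).
  exists u; split=> // w Ow; apply: le_trans (fu w Ow).
  rewrite ler_sqr ?nnegrE ?nm_ge0// nmZ -[leRHS]mulr1.
  rewrite ler_pM ?nm_ge0// (le_trans (nm_dot normK _ _))// -[leRHS]mulr1.
  by rewrite ler_wpM2l ?nm_ge0.
have := cP (exist _ z (conj Oz tz)) g gB; rewrite /T /=.
rewrite ler_pdivrMr ?mulr_gt0// /g linearZ nmZ.
have -> : nm (dot (f z) e : C) = nm (f z).
  rewrite /e linearZr_LR /= dot_self// nmM nm_conj !nmR.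
  rewrite !ger0_norm ?invr_ge0 ?nm_ge0 ?sqr_ge0//.
  by rewrite expr2 mulKf// gt_eqF.
have := ler_norm c; have := normr_ge0 c.
move: fN fz0 nt Npos (nm_ge0 (phi z k)).
move: (nm (f z)) (N z) (nm (theta z)) (nm (phi z k)) `|c| => x y t p c' fN x0 t0 y0 p0 c0 cc h.
rewrite -(ler_pM2l x0); apply: (le_trans h).
apply: (@le_trans _ _ (c' * (t * y))); first by rewrite ler_wpM2r// mulr_ge0 ?ltW.
have : 0 <= c' * t by rewrite mulr_ge0// ltW.
nra.
Qed.

End Division.

Unset Implicit Arguments.

Theorem theorem4p5 (R : realType)
    (K : completeNormedModType R[i]) (dot : {dot K for conjC})
    (normK : forall x : K, `|x| ^+ 2 = dot x x)
    (Omega : set R[i]) (regOmega : bounded_finitely_connected_region Omega)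
    (z0 : R[i]) (Omega_z0 : Omega z0)
    (m : probability (borelC R) R) (harm : harmonic_measure Omega z0 m)
    (theta : R[i] -> R[i]) (phi : R[i] -> bop K)
    (Htheta : Hinfty Omega theta) (Hphi : Hinfty Omega phi)
    (qtheta : quasi_inner Omega m theta) (qphi : quasi_inner_op Omega m phi) :
  [<-> divides Omega theta phi;
       op_image Omega phi (Hinfty Omega (X := K)) `<=`
         scalar_image Omega theta (Hinfty Omega (X := K));
       op_image Omega phi (H2 Omega (X := K)) `<=`
         scalar_image Omega theta (H2 Omega (X := K));
       exists2 lambda : R, 0 < lambda & forall z, Omega z ->
         bop_le dot (bop_comp (phi z) (adjoint dot (phi z)))
           ((lambda%:C ^+ 2 * `|theta z| ^+ 2) *: bop_id K)].
Proof.
have [oO cO _ _ _] := regOmega.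
have [z1 Oz1 theta_z1] := quasi_inner_neq0 harm qtheta.
have [theta_hol _] := (HinftyP _ _).1 Htheta.
have [phi_hol _] := (HinftyP _ _).1 Hphi.
have dom_div c : 0 <= c -> dominated Omega theta phi c -> divides Omega theta phi.
  exact: (dominated_divides normK oO cO theta_hol phi_hol Oz1 theta_z1).
have order (c : R) (z : R[i]) : 0 <= c ->
    bop_le dot (bop_comp (phi z) (adjoint dot (phi z)))
      ((c%:C ^+ 2 * `|theta z| ^+ 2) *: bop_id K) <->
    forall k, nm (phi z k) <= c * nm (theta z) * nm k.
  move=> c0; have -> : c%:C ^+ 2 * `|theta z| ^+ 2 = ((c * nm (theta z)) ^+ 2)%:C.
    by rewrite -nmE -!rmorphXn -rmorphM exprMn.
  by apply: (adjoint_le normK); rewrite mulr_ge0 ?nm_ge0.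
tfae.
- exact: divides_Hinfty.
- move=> /Hinfty_dominated[c c0 cP]; apply: divides_H2 => //.
  by apply: (dom_div c) => //; exact: ltW.
- move=> /(H2_dominated normK oO cO Omega_z0)[c c0 cP]; exists c => // z Oz.
  by apply/order; [exact: ltW|exact: cP].
- move=> [c c0 cP]; apply: (dom_div c); first exact: ltW.
  by move=> z Oz; apply/(order c z (ltW c0)); exact: cP.
Qed.
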